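(* Let $\varphi$ be an entire function, $0\le s<\infty$, $p>0$ and $\alpha>-1$, such that $p-2<\alpha<p-1$. Then $S_\varphi(\mathcal{D}^p_\alpha)\subset Q_s$ if and only if $\varphi$ is constant.
   Context: $\mathbb{D}=\{z\in\mathbb{C}:|z|<1\}$, $\mathcal{H}ol(\mathbb{D})$ is the space of analytic functions in $\mathbb{D}$, and $dA(z)=\frac1\pi\,dx\,dy$. Superposition operator: for an entire function $\varphi$, $S_\varphi(f)=\varphi\circ f$ for $f\in\mathcal{H}ol(\mathbb{D})$. For $X,Y\subset\mathcal{H}ol(\mathbb{D})$, $S_\varphi(X)\subset Y$ means $\varphi\circ f\in Y$ for every $f\in X$. Spaces: for $0<p<\infty$ and $\alpha>-1$, $\mathcal{D}^p_\alpha$ is the set of $f\in\mathcal{H}ol(\mathbb{D})$ with $\int_{\mathbb{D}}(1-|z|^2)^\alpha|f'(z)|^p\,dA(z)<\infty$. For $0\le s<\infty$, $Q_s$ is the set of $f\in\mathcal{H}ol(\mathbb{D})$ with $\sup_{a\in\mathbb{D}}\int_{\mathbb{D}}|f'(z)|^2g(z,a)^s\,dA(z)<\infty$, where $g(z,a)=\log\left|\frac{1-\overline{a}z}{z-a}\right|$. *)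

(* Defs.v *)
From HB Require Import structures.
From mathcomp Require Import all_boot all_order all_algebra.
From mathcomp Require Import complex.
From mathcomp Require Import all_classical all_reals all_analysis.

Set Implicit Arguments.
Unset Strict Implicit.
Unset Printing Implicit Defensive.

Import Order.TTheory GRing.Theory Num.Theory.
Import numFieldNormedType.Exports.

Local Open Scope classical_set_scope.
Local Open Scope ring_scope.

(* The complex numbers, packaged as a [numFieldType] so that they are a normed
   space over themselves: below, [derivable f z 1] and [derive1 f z] are complex
   differentiability and the complex derivative. *)
Definition Cplx (R : realType) : numFieldType := R[i]%C.

(* The modulus as an element of [R] (the generic [`|z|] is valued in [R[i]]). *)
Definition cabs (R : realType) (z : Cplx R) : R := ComplexField.Normc.normc z.

Definition cconj (R : realType) (z : Cplx R) : Cplx R := conjc z.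

Definition disc (R : realType) : set (Cplx R) := [set z | cabs z < 1].
Arguments disc : clear implicits.

Definition entire (R : realType) (phi : Cplx R -> Cplx R) : Prop :=
  forall z, derivable phi z 1.

(* A function on the disc is represented by a total function, whose values
   outside the (open) disc are irrelevant to every definition below. *)
Definition Hol (R : realType) : set (Cplx R -> Cplx R) :=
  [set f | forall z, disc R z -> derivable f z 1].
Arguments Hol : clear implicits.

(* Integral over the disc against dA = (1/pi) dx dy. *)
Definition disc_integral (R : realType) (F : Cplx R -> R) : \bar R :=
  ((pi^-1)%:E *
   \int[@lebesgue_measure R \x @lebesgue_measure R]_(xy in
        [set xy : R * R | disc R (xy.1 +i* xy.2)%C])
     (F (xy.1 +i* xy.2)%C)%:E)%E.

(* At [z = a], where the logarithm is infinite, this takes the value 0; it only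
   enters integrals over [z], in which a single point is negligible. *)
Definition green (R : realType) (z a : Cplx R) : R :=
  ln (cabs ((1 - cconj a * z) / (z - a))).

Definition Dspace (R : realType) (p alpha : R) : set (Cplx R -> Cplx R) :=
  [set f | Hol R f /\
    (disc_integral (fun z =>
       (((1 - cabs z ^+ 2) `^ alpha) * (cabs (derive1 f z) `^ p))%R) < +oo)%E].

(* For [s = 0] the weight is the constant 1, since [x `^ 0 = 1] for all [x]. *)
Definition Qspace (R : realType) (s : R) : set (Cplx R -> Cplx R) :=
  [set f | Hol R f /\
    (ereal_sup [set disc_integral (fun z =>
       ((cabs (derive1 f z) ^+ 2) * (green z a `^ s))%R) | a in disc R] < +oo)%E].

Definition superposition (R : realType) (phi f : Cplx R -> Cplx R) :
  Cplx R -> Cplx R := phi \o f.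

(* Main.v *)
(* If phi o f lies in Q_s for all f in D^p_alpha, then each g = phi o f is a Bloch
   function: the Green function is at least ln 2 near a, so the Q_s condition
   bounds the area integral of |g'|^2 over a square centered at a of side comparable
   to 1 - |a|; by Tonelli the square contains a rectangle around a on whose sides
   |g'|^2 has a small integral, and Cauchy's formula for g' on that rectangle bounds
   |g'(a)| (1 - |a|).  Since p < alpha + 2, for e = 2^-m small enough all the
   functions f_c(z) = c (1 - z)^-e belong to D^p_alpha.  When w = f_c(a) with a in a
   Stolz angle at 1, |f_c'(a)| (1 - |a|) is comparable to |w|, so the Bloch bound for
   phi o f_c gives |phi'(w)| |w| <= K on a sector around the direction of c.  Finitely
   many c cover all directions, hence phi' tends to 0 at infinity and vanishes by
   Liouville's theorem. *)
Require Import Defs.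
From HB Require Import structures.
From mathcomp Require Import all_boot all_order all_algebra.
From mathcomp Require Import complex ring lra.
From mathcomp Require Import all_classical all_reals all_analysis.
From mathcomp Require Import measurable_realfun.

Import Order.TTheory GRing.Theory Num.Theory.
Import numFieldNormedType.Exports.

Local Open Scope classical_set_scope.
Local Open Scope ring_scope.

Set Implicit Arguments.
Unset Strict Implicit.
Unset Printing Implicit Defensive.

(** * Coordinates and modulus on the complex numbers *)

(** Contours are rectangles with sides parallel to the axes because the area integral is taken
    against a product measure: Tonelli's theorem then yields good sides directly, with no passage to
    polar coordinates. Cauchy's formula carries the integral of 1/(z - w) as an unevaluated factor,
    which enters only through two facts: its derivative in w is 0, and its modulus is at least 1/4
    for w well inside the rectangle. Dividing by it gives the continuity of g', and integrating by
    parts in the formula with kernel 1/(z - w)^2 gives Cauchy's formula for g' from that continuity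
    alone. The exponent is dyadic so that (1 - z)^e is an iterated square root with an explicit
    formula on the right half-plane, which contains 1 - z. The integrand of f_c in D^p_alpha is
    singular both along the circle and at 1. The lower bounds of |1 - z| by |y| and by the
    horizontal distance to the circle share its exponent between the two variables. *)

Section ComplexCoordinates.
Variable R : realType.
Implicit Types (z w : Cplx R) (x y : R).

Definition re z : R := complex.Re z.
Definition im z : R := complex.Im z.
Definition mkC x y : Cplx R := (x +i* y)%C.

Lemma re_mkC x y : re (mkC x y) = x. Proof. by []. Qed.
Lemma im_mkC x y : im (mkC x y) = y. Proof. by []. Qed.

Lemma mkC_re_im z : mkC (re z) (im z) = z. Proof. by case: z. Qed.

Lemma Cplx_eq z w : re z = re w -> im z = im w -> z = w.
Proof. by move=> h1 h2; rewrite -[z]mkC_re_im -[w]mkC_re_im h1 h2. Qed.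

Lemma reD z w : re (z + w) = re z + re w. Proof. by case: z; case: w. Qed.
Lemma imD z w : im (z + w) = im z + im w. Proof. by case: z; case: w. Qed.
Lemma reN z : re (- z) = - re z. Proof. by case: z. Qed.
Lemma imN z : im (- z) = - im z. Proof. by case: z. Qed.
Lemma reB z w : re (z - w) = re z - re w. Proof. by rewrite reD reN. Qed.
Lemma imB z w : im (z - w) = im z - im w. Proof. by rewrite imD imN. Qed.
Lemma reM z w : re (z * w) = re z * re w - im z * im w.
Proof. by case: z; case: w. Qed.
Lemma imM z w : im (z * w) = re z * im w + im z * re w.
Proof. by case: z; case: w. Qed.
Lemma re0 : re 0 = 0. Proof. by []. Qed.
Lemma im0 : im 0 = 0. Proof. by []. Qed.
Lemma re1 : re 1 = 1. Proof. by []. Qed.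
Lemma im1 : im 1 = 0. Proof. by []. Qed.

Lemma cabsE z : cabs z = Num.sqrt (re z ^+ 2 + im z ^+ 2).
Proof. by case: z. Qed.

Lemma cabs_ge0 z : 0 <= cabs z. Proof. by rewrite cabsE sqrtr_ge0. Qed.

Lemma cabs_sqr z : cabs z ^+ 2 = re z ^+ 2 + im z ^+ 2.
Proof. by rewrite cabsE sqr_sqrtr // addr_ge0 ?sqr_ge0. Qed.

Lemma cabsM z w : cabs (z * w) = cabs z * cabs w.
Proof. exact: ComplexField.Normc.normcM. Qed.

Lemma cabsV z : cabs z^-1 = (cabs z)^-1.
Proof. exact: ComplexField.Normc.normcV. Qed.

Lemma cabs_norm z : `|z| = mkC (cabs z) 0.
Proof. by []. Qed.

Lemma cabs0 : cabs (0 : Cplx R) = 0.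
Proof. by rewrite cabsE re0 im0 expr0n addr0 sqrtr0. Qed.

Lemma cabs1 : cabs (1 : Cplx R) = 1.
Proof. by rewrite cabsE re1 im1 expr0n expr1n addr0 sqrtr1. Qed.

Lemma cabs_eq0 z : (cabs z == 0) = (z == 0).
Proof.
apply/eqP/eqP => [/ComplexField.Normc.eq0_normc//|->]; exact: cabs0.
Qed.

Lemma cabs_gt0 z : (0 < cabs z) = (z != 0).
Proof. by rewrite lt_def cabs_eq0 cabs_ge0 andbT. Qed.

Lemma cabsN z : cabs (- z) = cabs z.
Proof. by rewrite !cabsE reN imN !sqrrN. Qed.

Lemma cabsBC z w : cabs (z - w) = cabs (w - z).
Proof. by rewrite -cabsN opprB. Qed.

Lemma cabsD_le z w : cabs (z + w) <= cabs z + cabs w.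
Proof.
by have := ler_normD z w; rewrite !cabs_norm /mkC lecE => /andP[_ /=].
Qed.

Lemma cabsB_le z w : cabs (z - w) <= cabs z + cabs w.
Proof. by rewrite -(cabsN w) cabsD_le. Qed.

Lemma cabsB_ge z w : cabs z - cabs w <= cabs (z - w).
Proof. by rewrite lerBlDr (le_trans _ (cabsD_le _ _)) // subrK. Qed.

Lemma cabsX z n : cabs (z ^+ n) = cabs z ^+ n.
Proof. by elim: n => [|n IH]; rewrite ?expr0 ?cabs1 // !exprS cabsM IH. Qed.

Lemma re_le_cabs z : `|re z| <= cabs z.
Proof. by rewrite cabsE -sqrtr_sqr ler_sqrt ?lerDl ?addr_ge0 ?sqr_ge0. Qed.

Lemma im_le_cabs z : `|im z| <= cabs z.
Proof. by rewrite cabsE -sqrtr_sqr ler_sqrt ?lerDr ?addr_ge0 ?sqr_ge0. Qed.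

Lemma cabs_le_re_im z : cabs z <= `|re z| + `|im z|.
Proof.
rewrite cabsE -[leRHS]ger0_norm ?addr_ge0// -sqrtr_sqr.
rewrite ler_sqrt ?sqr_ge0// sqrrD !real_normK ?num_real// -addrA lerD2l lerDr.
by rewrite mulrn_wge0 ?mulr_ge0.
Qed.

Lemma cabs_real x : cabs (mkC x 0) = `|x|.
Proof. by rewrite cabsE re_mkC im_mkC expr0n addr0 sqrtr_sqr. Qed.

Lemma cabs_conj z : cabs (cconj z) = cabs z.
Proof. by case: z => x y; rewrite !cabsE /cconj /= /re /im /= sqrrN. Qed.

Lemma disc_integralE (F : Cplx R -> R) : disc_integral F =
  ((pi^-1)%:E * \int[@lebesgue_measure R \x @lebesgue_measure R]_(p in
     [set p : R * R | (cabs (mkC p.1 p.2) < 1)%R]) (F (mkC p.1 p.2))%:E)%E.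
Proof. by []. Qed.

(** Radii of balls in [Cplx R] are themselves complex, but positivity in [R[i]] forces a zero
    imaginary part, so real radii suffice. *)
Lemma nbhs_cabsP z (P : set (Cplx R)) :
  nbhs z P <-> exists2 d, 0 < d & forall w, cabs (w - z) < d -> P w.
Proof.
split.
  move=> /nbhs_ballP[e /= e0 he].
  have [e'0 ee] : 0 < re e /\ e = mkC (re e) 0.
    by move: e0; rewrite ltcE => /andP[/eqP h1 h2]; split=> //; apply/Cplx_eq.
  exists (re e) => // w hw; apply: he.
  by rewrite -ball_normE /= cabs_norm ee cabsBC [ltLHS]/mkC ltcR.
move=> [d d0 hd]; apply/nbhs_ballP; exists (mkC d 0); first by rewrite /= ltcR.
move=> w; rewrite -ball_normE /= cabs_norm cabsBC => hw; apply: hd.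
by rewrite -ltcR.
Qed.

End ComplexCoordinates.
(* Otherwise unification unfolds arithmetic on [Cplx R] into pairs of reals. *)
#[global] Opaque Cplx cabs re im mkC.

(** * Complex derivatives *)

Section ContinuityAtPoint.
Variables (T : topologicalType) (K : numFieldType).
Implicit Types (f g : T -> K) (z : T).

Lemma cts_cst (a : K) z : {for z, continuous (fun=> a : K)}.
Proof. exact: cvg_cst. Qed.

Lemma ctsD f g z : {for z, continuous f} -> {for z, continuous g} ->
  {for z, continuous (fun w => f w + g w)}.
Proof. move=> cf cg; exact: (@cvgD _ _ _ (nbhs z) _ f g _ _ cf cg). Qed.

Lemma ctsN f z : {for z, continuous f} -> {for z, continuous (fun w => - f w)}.
Proof. move=> cf; exact: (@cvgN _ _ _ (nbhs z) _ f _ cf). Qed.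

Lemma ctsB f g z : {for z, continuous f} -> {for z, continuous g} ->
  {for z, continuous (fun w => f w - g w)}.
Proof. by move=> cf /ctsN; exact: ctsD. Qed.

Lemma ctsM f g z : {for z, continuous f} -> {for z, continuous g} ->
  {for z, continuous (fun w => f w * g w)}.
Proof. move=> cf cg; exact: (@cvgM _ _ (nbhs z) _ f g _ _ cf cg). Qed.

Lemma ctsV f z : f z != 0 -> {for z, continuous f} ->
  {for z, continuous (fun w => (f w)^-1)}.
Proof. move=> fz cf; exact: (@cvgV _ _ (nbhs z) _ f _ fz cf). Qed.

Lemma near_cts f g z : (\near z, f z = g z) -> {for z, continuous f} ->
  {for z, continuous g}.
Proof.
move=> fg cf; rewrite /prop_for /continuous_at -(nbhs_singleton fg).
apply: cvg_trans (cf : f w @[w --> z] --> f z).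
by apply: (@near_eq_cvg _ _ (nbhs z)); apply: filterS fg => w <-.
Qed.

End ContinuityAtPoint.

Section ComplexDerivative.
Variable K : numFieldType.
Implicit Types (f g : K -> K) (z w d e : K).

(** Carathéodory's form of the derivative: the difference quotient, extended by d at z, is
    continuous there. The product and chain rules become algebraic identities between such
    quotients. *)
Definition cder g z d := exists q : K -> K,
  [/\ {for z, continuous q}, q z = d & forall w, g w - g z = q w * (w - z)].

Lemma derivable_cder g z : derivable g z 1 -> cder g z (derive1 g z).
Proof.
move=> dg; exists (fun w => if w == z then derive1 g z else (g w - g z) / (w - z)).
split; last 2 first.
- by rewrite eqxx.
- move=> w; case: eqP => [->|/eqP]; first by rewrite !subrr mulr0.
  by rewrite -subr_eq0 => wz; rewrite divfK.
apply/continuous_withinNshiftx; rewrite eqxx derive1E.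
apply: cvg_trans dg; apply: near_eq_cvg; near=> h.
have h0 : h != 0 by near: h; exact: nbhs_dnbhs_neq.
rewrite /= -subr_eq0 addrK (negPf h0) [h%:A]mulr1.
by rewrite mulrC.
Unshelve. all: by end_near. Qed.

Lemma cder_derivable g z d : cder g z d -> derivable g z 1 /\ derive1 g z = d.
Proof.
move=> [q [cq qz gq]].
have H : h^-1 *: ((g \o shift z) (h *: 1) - g z) @[h --> 0^'] --> d.
  have F1 : (q \o shift z) h @[h --> 0^'] --> d.
    by rewrite -qz; apply/continuous_withinNshiftx.
  apply: cvg_trans F1; apply: near_eq_cvg; near=> h.
  have h0 : h != 0 by near: h; exact: nbhs_dnbhs_neq.
  rewrite /= gq addrK [h%:A]mulr1 [RHS]mulrC mulfK //.
split; first by apply/cvg_ex; exists d.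
by rewrite derive1E; apply: cvg_lim.
Unshelve. all: by end_near. Qed.

Lemma cder_unique g z d e : cder g z d -> cder g z e -> d = e.
Proof. by move=> /cder_derivable[_ <-] /cder_derivable[_ <-]. Qed.

Lemma cder_continuous g z d : cder g z d -> {for z, continuous g}.
Proof.
move=> [q [cq qz gq]].
have -> : g = (fun w => g z + q w * (w - z)).
  by apply/funext => w; rewrite -gq addrC subrK.
apply: ctsD; first exact: cts_cst.
by apply: ctsM => //; apply: ctsB; [exact: cvg_id|exact: cts_cst].
Qed.

(** A quotient must satisfy its equation at every w, so away from z it has to be rebuilt from g;
    near z it agrees with that of f. *)
Lemma near_cder f g z d : (\near z, f z = g z) -> cder f z d -> cder g z d.
Proof.
move=> fg [q [cq qz gq]]; have fgz := nbhs_singleton fg.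
exists (fun w => if w == z then d else (g w - g z) / (w - z)); split.
- apply: near_cts cq; near=> w; case: eqP => [->|/eqP wz]; first exact: qz.
  have <- : f w = g w by near: w.
  by rewrite -fgz gq mulfK // subr_eq0.
- by rewrite eqxx.
- move=> w; case: eqP => [->|/eqP]; first by rewrite !subrr mulr0.
  by rewrite -subr_eq0 => wz; rewrite divfK.
Unshelve. all: by end_near. Qed.

Lemma cder_cst d z : cder (fun=> d) z 0.
Proof.
by exists (fun=> 0); split=> // [|w]; [exact: cts_cst|rewrite subrr mul0r].
Qed.

Lemma cder_id z : cder id z 1.
Proof. by exists (fun=> 1); split=> // [|w]; [exact: cts_cst|rewrite mul1r]. Qed.

Lemma cderD f g z d e : cder f z d -> cder g z e ->
  cder (fun w => f w + g w) z (d + e).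
Proof.
move=> [q [cq <- gq]] [r [cr <- gr]]; exists (fun w => q w + r w); split=> //.
  exact: ctsD.
by move=> w; rewrite mulrDl -gq -gr; ring.
Qed.

Lemma cderM f g z d e : cder f z d -> cder g z e ->
  cder (fun w => f w * g w) z (d * g z + f z * e).
Proof.
move=> df [r [cr <- gr]]; have cf := cder_continuous df.
case: df => [q [cq <- gq]]; exists (fun w => q w * g z + f w * r w); split=> //.
  apply: ctsD; last exact: ctsM.
  by apply: ctsM => //; exact: cts_cst.
move=> w; rewrite mulrDl mulrAC -gq -mulrA -gr; ring.
Qed.

Lemma cderZ a g z e : cder g z e -> cder (fun w => a * g w) z (a * e).
Proof. by move=> /(cderM (cder_cst a z)); rewrite mul0r add0r. Qed.

Lemma cderN g z e : cder g z e -> cder (fun w => - g w) z (- e).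
Proof.
move=> /(cderZ (-1)); rewrite mulN1r; congr cder.
by apply/funext => w; rewrite mulN1r.
Qed.

Lemma cderB f g z d e : cder f z d -> cder g z e ->
  cder (fun w => f w - g w) z (d - e).
Proof. by move=> df /cderN dg; exact: cderD. Qed.

Lemma cderV g z e : g z != 0 -> cder g z e ->
  cder (fun w => (g w)^-1) z (- e / g z ^+ 2).
Proof.
move=> gz dg; have cg := cder_continuous dg.
case: dg => [q [cq <- gq]].
apply: (@near_cder (fun w => if g w == 0 then 0 else (g w)^-1)).
  by near=> w; case: eqP => // ->; rewrite invr0.
(* Where g vanishes its inverse is 0 by convention, and the first branch is the quotient for that
   value. This case does not occur near z. *)
exists (fun w => if g w == 0 then
   - (g z)^-1 / (w - z) else - q w / (g w * g z)); split.
- have H : {for z, continuous (fun w => - q w / (g w * g z))}.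
    apply: ctsM; first exact: ctsN.
    apply: ctsV; first by rewrite mulf_neq0.
    by apply: ctsM => //; exact: cts_cst.
  apply: near_cts H; near=> w.
  case: eqP => // gw; exfalso; move/eqP: gw; apply/negP.
  near: w; exact: (@cvgr_neq0 _ _ _ (nbhs z) _ g _ cg gz).
- by rewrite (negPf gz) expr2.
- move=> w; rewrite (negPf gz); case: eqP => [gw|/eqP gw].
    rewrite sub0r; have [wz|wz] := eqVneq w z; first by rewrite -wz gw eqxx in gz.
    by rewrite divfK // subr_eq0.
  rewrite mulrAC mulNr -gq; field.
  by rewrite gw gz.
Unshelve. all: by end_near. Qed.

Lemma cder_comp f g z d e : cder f z d -> cder g (f z) e ->
  cder (fun w => g (f w)) z (e * d).
Proof.
move=> df [r [cr <- gr]]; have cf := cder_continuous df.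
case: df => [q [cq <- gq]]; exists (fun w => r (f w) * q w); split=> //.
  by apply: ctsM => //; exact: (continuous_comp cf cr).
by move=> w; rewrite gr gq mulrA.
Qed.

End ComplexDerivative.

(** * Line integrals *)

Section ContinuityComplexValued.
Variables (R : realType) (T : topologicalType).
Implicit Types (f : T -> Cplx R) (z : T).

Lemma cts_cabsP f z : {for z, continuous f} <->
  (forall e, 0 < e -> \forall w \near z, cabs (f w - f z) < e).
Proof.
split=> [cf e e0|H].
  have : nbhs (f z) [set y | cabs (y - f z) < e].
    by apply/nbhs_cabsP; exists e.
  exact: cf.
move=> P /nbhs_cabsP[e e0 he]; apply: filterS (H _ e0) => w; exact: he.
Qed.

Lemma ctsR_P (u : T -> R) z : {for z, continuous u} <->
  (forall e, 0 < e -> \forall w \near z, `|u w - u z| < e).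
Proof.
split=> [cu e e0|H].
  have /cvgrPdist_lt/(_ _ e0) : u w @[w --> z] --> u z by exact: cu.
  by apply: filterS => w; rewrite distrC.
apply/cvgrPdist_lt => e e0; apply: filterS (H _ e0) => w.
by rewrite distrC.
Qed.

Lemma cts_re f z : {for z, continuous f} ->
  {for z, continuous (fun w => re (f w))}.
Proof.
move=> /cts_cabsP cf; apply/ctsR_P => e /cf; apply: filterS => w.
by rewrite -reB; apply: le_lt_trans; exact: re_le_cabs.
Qed.

Lemma cts_im f z : {for z, continuous f} ->
  {for z, continuous (fun w => im (f w))}.
Proof.
move=> /cts_cabsP cf; apply/ctsR_P => e /cf; apply: filterS => w.
by rewrite -imB; apply: le_lt_trans; exact: im_le_cabs.
Qed.

Lemma cts_cabs f z : {for z, continuous f} ->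
  {for z, continuous (fun w => cabs (f w))}.
Proof.
move=> /cts_cabsP cf; apply/ctsR_P => e /cf; apply: filterS => w.
apply: le_lt_trans; rewrite ler_norml cabsB_ge andbT lerNl opprB cabsBC.
exact: cabsB_ge.
Qed.

Lemma cts_mkC (u v : T -> R) z : {for z, continuous u} ->
  {for z, continuous v} -> {for z, continuous (fun w => mkC (u w) (v w))}.
Proof.
move=> /ctsR_P cu /ctsR_P cv; apply/cts_cabsP => e e0.
have e2 : 0 < e / 2 by rewrite divr_gt0.
apply: filterS2 (cu _ e2) (cv _ e2) => w hu hv.
apply: le_lt_trans (cabs_le_re_im _) _.
by rewrite reB imB !re_mkC !im_mkC (splitr e) ltrD.
Qed.

End ContinuityComplexValued.

Section ComplexIntegral.
Variable R : realType.
Notation leb := (@lebesgue_measure R).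
Implicit Types (a b t : R) (u v : R -> R) (f h : R -> Cplx R).

Lemma cts_integrable u a b :
  (forall t, a <= t <= b -> {for t, continuous u}) ->
  leb.-integrable `[a, b] (EFin \o u).
Proof.
move=> cu; apply: continuous_compact_integrable; first exact: segment_compact.
apply: continuous_in_subspaceT => t; rewrite inE /= in_itv /=; exact: cu.
Qed.

Definition cint a b h : Cplx R :=
  mkC (\int[leb]_(t in `[a, b]) re (h t)) (\int[leb]_(t in `[a, b]) im (h t)).

Definition cts_on a b h := forall t, a <= t <= b -> {for t, continuous h}.

Lemma cts_on_re a b h : cts_on a b h ->
  leb.-integrable `[a, b] (EFin \o (fun t => re (h t))).
Proof. by move=> ch; apply: cts_integrable => t /ch; exact: cts_re. Qed.

Lemma cts_on_im a b h : cts_on a b h ->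
  leb.-integrable `[a, b] (EFin \o (fun t => im (h t))).
Proof. by move=> ch; apply: cts_integrable => t /ch; exact: cts_im. Qed.

Lemma eq_cint a b f h : (forall t, a <= t <= b -> f t = h t) ->
  cint a b f = cint a b h.
Proof.
move=> fh; congr mkC; apply: eq_Rintegral => t; rewrite inE /= in_itv /= => /fh.
  by move->.
by move->.
Qed.

Lemma cintD a b f h : cts_on a b f -> cts_on a b h ->
  cint a b (fun t => f t + h t) = cint a b f + cint a b h.
Proof.
move=> cf ch; apply: Cplx_eq; rewrite ?reD ?imD !(re_mkC, im_mkC).
- under eq_Rintegral do rewrite reD.
  by rewrite RintegralD//; exact: cts_on_re.
- under eq_Rintegral do rewrite imD.
  by rewrite RintegralD//; exact: cts_on_im.
Qed.

Lemma cintZ a b (c : Cplx R) h : cts_on a b h ->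
  cint a b (fun t => c * h t) = c * cint a b h.
Proof.
move=> ch; have ir := cts_on_re ch; have ii := cts_on_im ch.
have irZ k : leb.-integrable `[a, b] (EFin \o (fun t => k * re (h t))).
  by apply: cts_integrable => t /ch /cts_re; apply: ctsM; exact: cts_cst.
have iiZ k : leb.-integrable `[a, b] (EFin \o (fun t => k * im (h t))).
  by apply: cts_integrable => t /ch /cts_im; apply: ctsM; exact: cts_cst.
apply: Cplx_eq; rewrite ?reM ?imM !(re_mkC, im_mkC).
- under eq_Rintegral do rewrite reM.
  by rewrite RintegralB// !RintegralZl.
- under eq_Rintegral do rewrite imM.
  by rewrite RintegralD// !RintegralZl.
Qed.

Lemma cint_split a c b h : a <= c <= b -> cts_on a b h ->
  cint a b h = cint a c h + cint c b h.
Proof.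
move=> /andP[ac cb] ch.
have H u : leb.-integrable `[a, b] (EFin \o u) ->
    \int[leb]_(t in `[a, b]) u t =
    \int[leb]_(t in `[a, c]) u t + \int[leb]_(t in `[c, b]) u t.
  move=> iu.
  have := @Rintegral_itvB R u (BLeft a) (BRight b) c iu.
  rewrite !bnd_simp => /(_ ac cb) /eqP; rewrite subr_eq addrC => /eqP ->.
  congr (_ + _); apply: Rintegral_itv_obnd_cbnd.
  apply: integrableS iu => //; apply: subset_itv; rewrite ?bnd_simp//.
apply: Cplx_eq; rewrite ?reD ?imD !(re_mkC, im_mkC).
- by apply: H; exact: cts_on_re.
- by apply: H; exact: cts_on_im.
Qed.

Lemma Rintegral_cst_itv a b (k : R) : a <= b ->
  \int[leb]_(t in `[a, b]) k = k * (b - a).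
Proof.
move=> ab; rewrite Rintegral_cst//= lebesgue_measure_itv/= lte_fin.
by case: ltgtP ab => //= ->; rewrite subrr.
Qed.

(** Real and imaginary parts are bounded separately, whence the factor 2. *)
Lemma cint_le a b h M : a <= b -> cts_on a b h ->
  (forall t, a <= t <= b -> cabs (h t) <= M) ->
  cabs (cint a b h) <= 2 * (M * (b - a)).
Proof.
move=> ab ch hM.
have H u : leb.-integrable `[a, b] (EFin \o u) ->
    (forall t, a <= t <= b -> `|u t| <= M) ->
    `|\int[leb]_(t in `[a, b]) u t| <= M * (b - a).
  move=> iu uM; rewrite -Rintegral_cst_itv//.
  apply: le_trans (le_normr_Rintegral _ iu) _ => //.
  apply: le_Rintegral => //; first exact: (integrable_norm iu).
  by apply: cts_integrable => t _; exact: cts_cst.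
apply: le_trans (cabs_le_re_im _) _; rewrite re_mkC im_mkC mulr_natl mulr2n.
apply: lerD; apply: H.
- exact: cts_on_re.
- by move=> t /hM; apply: le_trans; exact: re_le_cabs.
- exact: cts_on_im.
- by move=> t /hM; apply: le_trans; exact: im_le_cabs.
Qed.

Lemma cint_le_Rintegral a b h v : cts_on a b h ->
  leb.-integrable `[a, b] (EFin \o v) ->
  (forall t, a <= t <= b -> cabs (h t) <= v t) ->
  cabs (cint a b h) <= 2 * \int[leb]_(t in `[a, b]) v t.
Proof.
move=> ch iv hM.
have H u : leb.-integrable `[a, b] (EFin \o u) ->
    (forall t, a <= t <= b -> `|u t| <= v t) ->
    `|\int[leb]_(t in `[a, b]) u t| <= \int[leb]_(t in `[a, b]) v t.
  move=> iu uM; apply: le_trans (le_normr_Rintegral _ iu) _ => //.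
  by apply: le_Rintegral => //; exact: (integrable_norm iu).
apply: le_trans (cabs_le_re_im _) _; rewrite re_mkC im_mkC mulr_natl mulr2n.
apply: lerD; apply: H.
- exact: cts_on_re.
- by move=> t /hM; apply: le_trans; exact: re_le_cabs.
- exact: cts_on_im.
- by move=> t /hM; apply: le_trans; exact: im_le_cabs.
Qed.

(** The primitive is described by Carathéodory quotients, the form in which [cder] passes on its
    real and imaginary parts. *)
Lemma Rintegral_derive a b u (U : R -> R) : a <= b ->
  (forall t, a <= t <= b -> {for t, continuous u}) ->
  (forall t, a <= t <= b -> exists q : R -> R, [/\ {for t, continuous q},
     q t = u t & forall s, U s - U t = q s * (s - t)]) ->
  \int[leb]_(t in `[a, b]) u t = U b - U a.
Proof.
rewrite le_eqVlt => /predU1P[->|ab] cu dU.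
  by rewrite set_itv1 Rintegral_set1 subrr.
have dU' t : a <= t <= b -> is_derive t 1 U (u t).
  move=> /dU[q [cq qt Uq]]; apply/is_derive1_caratheodory; exists q; split=> //.
have cU t : a <= t <= b -> {for t, continuous U}.
  move=> /dU' [dUt _]; exact/differentiable_continuous/derivable1_diffP.
rewrite /Rintegral (@continuous_FTC2 _ u U)//.
- apply: continuous_in_subspaceT => t; rewrite inE /= in_itv /=; exact: cu.
- split.
  + by move=> t; rewrite in_itv/= => /andP[h1 h2]; case: (dU' t) => //; rewrite !ltW.
  + apply: cvg_at_right_filter; apply: cU; lra.
  + apply: cvg_at_left_filter; apply: cU; lra.
- move=> t; rewrite in_itv/= => /andP[h1 h2].
  by rewrite derive1E; case: (dU' t) => //; rewrite !ltW.
Qed.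

(** With e equal to 1 or i and c on an axis, the parameter t is the varying coordinate itself, so
    integrals along sides are the slices that occur in Tonelli's theorem. *)
Definition lpt (c e : Cplx R) t : Cplx R := c + mkC t 0 * e.

Lemma cts_lpt c e t : {for t, continuous (lpt c e)}.
Proof.
apply: ctsD; first exact: cts_cst.
apply: ctsM; last exact: cts_cst.
by apply: cts_mkC; [exact: cvg_id|exact: cts_cst].
Qed.

Lemma cts_on_lpt a b c e (g : Cplx R -> Cplx R) :
  (forall t, a <= t <= b -> {for lpt c e t, continuous g}) ->
  cts_on a b (fun t => g (lpt c e t)).
Proof. by move=> cg t /cg; exact: (continuous_comp (@cts_lpt c e t)). Qed.

Definition lint a b c e (g : Cplx R -> Cplx R) : Cplx R :=
  e * cint a b (fun t => g (lpt c e t)).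

Lemma lint_derive a b c e (g G : Cplx R -> Cplx R) : a <= b ->
  (forall t, a <= t <= b -> {for lpt c e t, continuous g}) ->
  (forall t, a <= t <= b -> cder G (lpt c e t) (g (lpt c e t))) ->
  lint a b c e g = G (lpt c e b) - G (lpt c e a).
Proof.
move=> ab cg dG; rewrite /lint -cintZ; last exact: cts_on_lpt.
have ch t : a <= t <= b -> {for t, continuous (fun t => e * g (lpt c e t))}.
  by move=> /(cts_on_lpt cg); apply: ctsM; exact: cts_cst.
have dlpt t s : lpt c e s - lpt c e t = mkC (s - t) 0 * e.
  have -> : mkC (s - t) 0 = mkC s 0 - mkC t 0.
    by apply: Cplx_eq; rewrite ?(reB, imB, re_mkC, im_mkC)// subrr.
  by rewrite /lpt; ring.
apply: Cplx_eq; rewrite ?(reB, imB, re_mkC, im_mkC).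
- apply: (@Rintegral_derive _ _ _ (fun t => re (G (lpt c e t)))) => [//|t tab|t tab].
    by apply: cts_re; exact: ch.
  have [q [cq qt Gq]] := dG t tab.
  exists (fun s => re (q (lpt c e s) * e)); split.
  + apply/cts_re/ctsM; last exact: cts_cst.
    exact: (continuous_comp (@cts_lpt c e t) cq).
  + by rewrite qt mulrC.
  + move=> s; rewrite -reB Gq dlpt [mkC _ _ * _]mulrC mulrA reM re_mkC im_mkC.
    by rewrite mulr0 subr0.
- apply: (@Rintegral_derive _ _ _ (fun t => im (G (lpt c e t)))) => [//|t tab|t tab].
    by apply: cts_im; exact: ch.
  have [q [cq qt Gq]] := dG t tab.
  exists (fun s => im (q (lpt c e s) * e)); split.
  + apply/cts_im/ctsM; last exact: cts_cst.
    exact: (continuous_comp (@cts_lpt c e t) cq).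
  + by rewrite qt mulrC.
  + move=> s; rewrite -imB Gq dlpt [mkC _ _ * _]mulrC mulrA imM re_mkC im_mkC.
    by rewrite mulr0 add0r.
Qed.

Implicit Types (x y : R) (k e c : Cplx R).

Lemma lpt_hor y t : lpt (mkC 0 y) 1 t = mkC t y.
Proof.
by apply: Cplx_eq; rewrite /lpt mulr1 (reD, imD) !(re_mkC, im_mkC) ?add0r ?addr0.
Qed.

Lemma lpt_ver x t : lpt (mkC x 0) (mkC 0 1) t = mkC x t.
Proof.
by apply: Cplx_eq; rewrite /lpt ?(reD, imD, reM, imM) !(re_mkC, im_mkC); ring.
Qed.

Lemma lintD a b c e (f g : Cplx R -> Cplx R) :
  (forall t, a <= t <= b -> {for lpt c e t, continuous f}) ->
  (forall t, a <= t <= b -> {for lpt c e t, continuous g}) ->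
  lint a b c e (fun z => f z + g z) = lint a b c e f + lint a b c e g.
Proof.
move=> /cts_on_lpt cf /cts_on_lpt cg.
by rewrite /lint (cintD cf cg) mulrDr.
Qed.

Lemma lintZ a b c e k g :
  (forall t, a <= t <= b -> {for lpt c e t, continuous g}) ->
  lint a b c e (fun z => k * g z) = k * lint a b c e g.
Proof.
by move=> /cts_on_lpt cg; rewrite /lint (cintZ k cg) mulrCA.
Qed.

Lemma eq_lint a b c e (f g : Cplx R -> Cplx R) :
  (forall t, a <= t <= b -> f (lpt c e t) = g (lpt c e t)) ->
  lint a b c e f = lint a b c e g.
Proof. by move=> fg; rewrite /lint (eq_cint fg). Qed.

Lemma lint_le a b c e g M : a <= b -> cabs e = 1 ->
  (forall t, a <= t <= b -> {for lpt c e t, continuous g}) ->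
  (forall t, a <= t <= b -> cabs (g (lpt c e t)) <= M) ->
  cabs (lint a b c e g) <= 2 * (M * (b - a)).
Proof.
by move=> ab e1 /cts_on_lpt cg gM; rewrite cabsM e1 mul1r (cint_le ab cg gM).
Qed.

Lemma lint_split a x b c e (g : Cplx R -> Cplx R) : a <= x <= b ->
  (forall t, a <= t <= b -> {for lpt c e t, continuous g}) ->
  lint a b c e g = lint a x c e g + lint x b c e g.
Proof.
by move=> hc /cts_on_lpt cg; rewrite /lint (cint_split hc cg) mulrDr.
Qed.

Lemma lintE a b c e (g : Cplx R -> Cplx R) :
  lint a b c e g = e * cint a b (fun t => g (lpt c e t)).
Proof. by []. Qed.

Lemma im_lint1 a b c (g : Cplx R -> Cplx R) :
  im (lint a b c 1 g) = \int[leb]_(t in `[a, b]) im (g (lpt c 1 t)).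
Proof. by rewrite /lint mul1r im_mkC. Qed.

Lemma im_lint_i a b c (g : Cplx R -> Cplx R) :
  im (lint a b c (mkC 0 1) g) = \int[leb]_(t in `[a, b]) re (g (lpt c (mkC 0 1) t)).
Proof. by rewrite /lint imM !re_mkC !im_mkC mul0r add0r mul1r. Qed.

Lemma Rintegral_itv_ge a b u (k : R) : a <= b ->
  leb.-integrable `[a, b] (EFin \o u) -> (forall t, a <= t <= b -> k <= u t) ->
  k * (b - a) <= \int[leb]_(t in `[a, b]) u t.
Proof.
move=> ab iu ku; rewrite -Rintegral_cst_itv//; apply: le_Rintegral => //.
by apply: cts_integrable => t _; exact: cts_cst.
Qed.

Lemma Rintegral_itv_le a b u (k : R) : a <= b ->
  leb.-integrable `[a, b] (EFin \o u) -> (forall t, a <= t <= b -> u t <= k) ->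
  \int[leb]_(t in `[a, b]) u t <= k * (b - a).
Proof.
move=> ab iu ku; rewrite -Rintegral_cst_itv//; apply: le_Rintegral => //.
by apply: cts_integrable => t _; exact: cts_cst.
Qed.

End ComplexIntegral.
#[global] Opaque cint lint lpt.

(** * Integrals over the boundary of a rectangle *)

Section RectangleIntegral.
Variable R : realType.
Implicit Types (x y a b : R) (z w d : Cplx R) (f g G : Cplx R -> Cplx R).

(** The counterclockwise boundary integral: bottom, right, then top and left traversed backwards. *)
Definition rint x0 x1 y0 y1 g : Cplx R :=
  lint x0 x1 (mkC 0 y0) 1 g + lint y0 y1 (mkC x1 0) (mkC 0 1) g
  - lint x0 x1 (mkC 0 y1) 1 g - lint y0 y1 (mkC x0 0) (mkC 0 1) g.

Lemma rintE x0 x1 y0 y1 g : rint x0 x1 y0 y1 g =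
  lint x0 x1 (mkC 0 y0) 1 g + lint y0 y1 (mkC x1 0) (mkC 0 1) g
  - lint x0 x1 (mkC 0 y1) 1 g - lint y0 y1 (mkC x0 0) (mkC 0 1) g.
Proof. by []. Qed.

Definition rect x0 x1 y0 y1 z := x0 <= re z <= x1 /\ y0 <= im z <= y1.

Definition rbdry x0 x1 y0 y1 z := rect x0 x1 y0 y1 z /\
  [\/ re z = x0, re z = x1, im z = y0 | im z = y1].

Lemma rbdry_sides x0 x1 y0 y1 : x0 <= x1 -> y0 <= y1 ->
  [/\ forall t, x0 <= t <= x1 -> rbdry x0 x1 y0 y1 (mkC t y0),
      forall t, x0 <= t <= x1 -> rbdry x0 x1 y0 y1 (mkC t y1),
      forall t, y0 <= t <= y1 -> rbdry x0 x1 y0 y1 (mkC x0 t) &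
      forall t, y0 <= t <= y1 -> rbdry x0 x1 y0 y1 (mkC x1 t)].
Proof.
move=> hx hy; split=> t ht; rewrite /rbdry /rect re_mkC im_mkC ?lexx ?hx ?hy;
  split=> //; by [constructor 1|constructor 2|constructor 3|constructor 4].
Qed.

Definition cts_rbdry x0 x1 y0 y1 g :=
  forall z, rbdry x0 x1 y0 y1 z -> {for z, continuous g}.

Lemma cts_sides x0 x1 y0 y1 g : x0 <= x1 -> y0 <= y1 ->
  cts_rbdry x0 x1 y0 y1 g ->
  [/\ forall t, x0 <= t <= x1 -> {for lpt (mkC 0 y0) 1 t, continuous g},
      forall t, x0 <= t <= x1 -> {for lpt (mkC 0 y1) 1 t, continuous g},
      forall t, y0 <= t <= y1 -> {for lpt (mkC x0 0) (mkC 0 1) t, continuous g} &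
      forall t, y0 <= t <= y1 -> {for lpt (mkC x1 0) (mkC 0 1) t, continuous g}].
Proof.
move=> hx hy cg; have [h1 h2 h3 h4] := rbdry_sides hx hy.
split=> t ht.
- by rewrite lpt_hor; exact: cg (h1 t ht).
- by rewrite lpt_hor; exact: cg (h2 t ht).
- by rewrite lpt_ver; exact: cg (h3 t ht).
- by rewrite lpt_ver; exact: cg (h4 t ht).
Qed.

Lemma rintD x0 x1 y0 y1 f g : x0 <= x1 -> y0 <= y1 ->
  cts_rbdry x0 x1 y0 y1 f -> cts_rbdry x0 x1 y0 y1 g ->
  rint x0 x1 y0 y1 (fun z => f z + g z) = rint x0 x1 y0 y1 f + rint x0 x1 y0 y1 g.
Proof.
move=> hx hy /(cts_sides hx hy)[f1 f2 f3 f4] /(cts_sides hx hy)[g1 g2 g3 g4].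
rewrite /rint (lintD f1 g1) (lintD f2 g2) (lintD f3 g3) (lintD f4 g4).
have E (a b c d a' b' c' d' : Cplx R) : (a + a') + (b + b') - (c + c') - (d + d') =
  (a + b - c - d) + (a' + b' - c' - d') by ring.
exact: E.
Qed.

Lemma rintZ x0 x1 y0 y1 k g : x0 <= x1 -> y0 <= y1 ->
  cts_rbdry x0 x1 y0 y1 g ->
  rint x0 x1 y0 y1 (fun z => k * g z) = k * rint x0 x1 y0 y1 g.
Proof.
move=> hx hy /(cts_sides hx hy)[g1 g2 g3 g4].
rewrite /rint (lintZ k g1) (lintZ k g2) (lintZ k g3) (lintZ k g4).
by rewrite !mulrBr mulrDr.
Qed.

Lemma rintB x0 x1 y0 y1 f g : x0 <= x1 -> y0 <= y1 ->
  cts_rbdry x0 x1 y0 y1 f -> cts_rbdry x0 x1 y0 y1 g ->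
  rint x0 x1 y0 y1 (fun z => f z - g z) = rint x0 x1 y0 y1 f - rint x0 x1 y0 y1 g.
Proof.
move=> hx hy cf cg; rewrite -mulN1r -(rintZ (-1) hx hy cg).
rewrite -(rintD hx hy cf); last by move=> z /cg; apply: ctsM; exact: cts_cst.
by congr rint; apply/funext => z; rewrite mulN1r.
Qed.

Lemma eq_rint x0 x1 y0 y1 f g : x0 <= x1 -> y0 <= y1 ->
  (forall z, rbdry x0 x1 y0 y1 z -> f z = g z) ->
  rint x0 x1 y0 y1 f = rint x0 x1 y0 y1 g.
Proof.
move=> hx hy fg; have [h1 h2 h3 h4] := rbdry_sides hx hy.
have e1 : lint x0 x1 (mkC 0 y0) 1 f = lint x0 x1 (mkC 0 y0) 1 g.
  by apply: eq_lint => t ht; rewrite lpt_hor; exact: fg (h1 t ht).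
have e2 : lint x0 x1 (mkC 0 y1) 1 f = lint x0 x1 (mkC 0 y1) 1 g.
  by apply: eq_lint => t ht; rewrite lpt_hor; exact: fg (h2 t ht).
have e3 : lint y0 y1 (mkC x0 0) (mkC 0 1) f = lint y0 y1 (mkC x0 0) (mkC 0 1) g.
  by apply: eq_lint => t ht; rewrite lpt_ver; exact: fg (h3 t ht).
have e4 : lint y0 y1 (mkC x1 0) (mkC 0 1) f = lint y0 y1 (mkC x1 0) (mkC 0 1) g.
  by apply: eq_lint => t ht; rewrite lpt_ver; exact: fg (h4 t ht).
by rewrite /rint e1 e2 e3 e4.
Qed.

Lemma cabs_i : cabs (mkC 0 1 : Cplx R) = 1.
Proof. by rewrite cabsE re_mkC im_mkC expr0n expr1n add0r sqrtr1. Qed.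

Lemma rint_le_sides x0 x1 y0 y1 g K :
  [/\ cabs (lint x0 x1 (mkC 0 y0) 1 g) <= K,
      cabs (lint x0 x1 (mkC 0 y1) 1 g) <= K,
      cabs (lint y0 y1 (mkC x0 0) (mkC 0 1) g) <= K &
      cabs (lint y0 y1 (mkC x1 0) (mkC 0 1) g) <= K] ->
  cabs (rint x0 x1 y0 y1 g) <= 4 * K.
Proof.
move=> [h1 h2 h3 h4]; rewrite /rint.
apply: le_trans (cabsB_le _ _) _; apply: (@le_trans _ _ (3 * K + K)); last by lra.
apply: lerD => //.
apply: le_trans (cabsB_le _ _) _; apply: (@le_trans _ _ (2 * K + K)); last by lra.
apply: lerD => //.
apply: le_trans (cabsD_le _ _) _; apply: (@le_trans _ _ (K + K)); last by lra.
by apply: lerD.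
Qed.

(** Four sides, each with the factor 2 of [lint_le]. *)
Lemma rint_le x0 x1 y0 y1 g M L : x0 <= x1 -> y0 <= y1 ->
  x1 - x0 <= L -> y1 - y0 <= L -> 0 <= M ->
  cts_rbdry x0 x1 y0 y1 g ->
  (forall z, rbdry x0 x1 y0 y1 z -> cabs (g z) <= M) ->
  cabs (rint x0 x1 y0 y1 g) <= 8 * (M * L).
Proof.
move=> hx hy xL yL M0 /(cts_sides hx hy)[g1 g2 g3 g4] gM.
have [h1 h2 h3 h4] := rbdry_sides hx hy.
have -> : 8 * (M * L) = 4 * (2 * (M * L)) by ring.
have Hx : 2 * (M * (x1 - x0)) <= 2 * (M * L) by rewrite ler_pM2l// ler_wpM2l.
have Hy : 2 * (M * (y1 - y0)) <= 2 * (M * L) by rewrite ler_pM2l// ler_wpM2l.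
apply: rint_le_sides; split.
- apply: le_trans Hx; apply: (lint_le hx (cabs1 R) g1) => t ht.
  by rewrite lpt_hor; exact: gM (h1 t ht).
- apply: le_trans Hx; apply: (lint_le hx (cabs1 R) g2) => t ht.
  by rewrite lpt_hor; exact: gM (h2 t ht).
- apply: le_trans Hy; apply: (lint_le hy cabs_i g3) => t ht.
  by rewrite lpt_ver; exact: gM (h3 t ht).
- apply: le_trans Hy; apply: (lint_le hy cabs_i g4) => t ht.
  by rewrite lpt_ver; exact: gM (h4 t ht).
Qed.

(** Each side contributes the difference of G at its two corners, and these differences cancel
    around the boundary. *)
Lemma rint_derive x0 x1 y0 y1 g G : x0 <= x1 -> y0 <= y1 ->
  cts_rbdry x0 x1 y0 y1 g ->
  (forall z, rbdry x0 x1 y0 y1 z -> cder G z (g z)) ->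
  rint x0 x1 y0 y1 g = 0.
Proof.
move=> hx hy /(cts_sides hx hy)[g1 g2 g3 g4] dG.
have [h1 h2 h3 h4] := rbdry_sides hx hy.
have d1 t : x0 <= t <= x1 -> cder G (lpt (mkC 0 y0) 1 t) (g (lpt (mkC 0 y0) 1 t)).
  by move=> ht; rewrite lpt_hor; exact: dG (h1 t ht).
have d2 t : x0 <= t <= x1 -> cder G (lpt (mkC 0 y1) 1 t) (g (lpt (mkC 0 y1) 1 t)).
  by move=> ht; rewrite lpt_hor; exact: dG (h2 t ht).
have d3 t : y0 <= t <= y1 ->
    cder G (lpt (mkC x0 0) (mkC 0 1) t) (g (lpt (mkC x0 0) (mkC 0 1) t)).
  by move=> ht; rewrite lpt_ver; exact: dG (h3 t ht).
have d4 t : y0 <= t <= y1 ->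
    cder G (lpt (mkC x1 0) (mkC 0 1) t) (g (lpt (mkC x1 0) (mkC 0 1) t)).
  by move=> ht; rewrite lpt_ver; exact: dG (h4 t ht).
rewrite /rint (lint_derive hx g1 d1) (lint_derive hx g2 d2).
by rewrite (lint_derive hy g3 d3) (lint_derive hy g4 d4) !lpt_hor !lpt_ver; ring.
Qed.

(** The common side is traversed once in each direction. *)
Lemma rint_splitx x0 c x1 y0 y1 g : x0 <= c <= x1 -> y0 <= y1 ->
  cts_rbdry x0 x1 y0 y1 g ->
  rint x0 x1 y0 y1 g = rint x0 c y0 y1 g + rint c x1 y0 y1 g.
Proof.
move=> hc hy cg; have hx : x0 <= x1 by case/andP: hc; exact: le_trans.
have [g1 g2 g3 g4] := cts_sides hx hy cg.
rewrite /rint (lint_split hc g1) (lint_split hc g2).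
have E (a a' b k c' d m : Cplx R) : (a + a') + b - (k + c') - d =
  (a + m - k - d) + (a' + b - c' - m) by ring.
exact: E.
Qed.

Lemma rint_splity x0 x1 y0 c y1 g : x0 <= x1 -> y0 <= c <= y1 ->
  cts_rbdry x0 x1 y0 y1 g ->
  rint x0 x1 y0 y1 g = rint x0 x1 y0 c g + rint x0 x1 c y1 g.
Proof.
move=> hx hc cg; have hy : y0 <= y1 by case/andP: hc; exact: le_trans.
have [g1 g2 g3 g4] := cts_sides hx hy cg.
rewrite /rint (lint_split hc g3) (lint_split hc g4).
have E (a b b' k d d' m : Cplx R) : a + (b + b') - k - (d + d') =
  (a + b - m - d) + (m + b' - k - d') by ring.
exact: E.
Qed.

Definition cts_rect x0 x1 y0 y1 g :=
  forall z, rect x0 x1 y0 y1 z -> {for z, continuous g}.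

Lemma cts_rectS a0 a1 b0 b1 x0 x1 y0 y1 g :
  x0 <= a0 -> a1 <= x1 -> y0 <= b0 -> b1 <= y1 ->
  cts_rect x0 x1 y0 y1 g -> cts_rect a0 a1 b0 b1 g.
Proof.
move=> h1 h2 h3 h4 cg z [/andP[u1 u2] /andP[u3 u4]]; apply: cg; split;
 apply/andP; split; by [exact: le_trans u1|exact: le_trans h2|exact: le_trans u3|exact: le_trans h4].
Qed.

Lemma cts_rect_bdry x0 x1 y0 y1 g :
  cts_rect x0 x1 y0 y1 g -> cts_rbdry x0 x1 y0 y1 g.
Proof. by move=> cg z [/cg]. Qed.

Lemma nested_itv (a b : nat -> R) :
  (forall n, a n <= a n.+1) -> (forall n, b n.+1 <= b n) ->
  (forall n, a n <= b n) -> exists c, forall n, a n <= c <= b n.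
Proof.
move=> ai bd ab.
have aM : forall m n, (m <= n)%N -> a m <= a n.
  by move=> m n; apply: (homo_leq (r := fun x y => x <= y)) => // x y z; exact: le_trans.
have bM : forall m n, (m <= n)%N -> b n <= b m.
  by move=> m n; apply: (homo_leq (r := fun x y => y <= x)) => // x y z h1 h2; exact: le_trans h2 h1.
have amb m n : a m <= b n.
  apply: le_trans (aM _ _ (leq_maxl m n)) _.
  by apply: le_trans (ab _) _; apply: bM; exact: leq_maxr.
have hs : has_sup (range a).
  by split; [exists (a 0%N), 0%N|exists (b 0%N) => _ [n _ <-]].
exists (sup (range a)) => n; apply/andP; split.
  by apply: sup_ubound; [case: hs|exists n].
by apply: sup_le_ub; [case: hs|move=> _ [m _ <-]].
Qed.

End RectangleIntegral.
#[global] Opaque rint.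

(** * Goursat's theorem *)

Section Goursat.
Variable R : realType.
Implicit Types (x y a b u v : R) (z w d : Cplx R) (f g G : Cplx R -> Cplx R).

Lemma cabs_sum4_lt (A B C D : Cplx R) k : 4 * cabs A < k -> 4 * cabs B < k ->
  4 * cabs C < k -> 4 * cabs D < k -> cabs (A + B + (C + D)) < k.
Proof.
have := cabsD_le (A + B) (C + D); have := cabsD_le A B; have := cabsD_le C D.
lra.
Qed.

(** Bisection step: the four quarters add up to the whole, so one of them carries at least a quarter
    of its modulus. A quarter is recorded by its lower left corner. *)
Lemma rint_quarter a b u v g : 0 <= u -> 0 <= v ->
  cts_rect a (a + u) b (b + v) g ->
  exists p : R * R, [/\ p.1 = a \/ p.1 = a + u / 2, p.2 = b \/ p.2 = b + v / 2 &
    cabs (rint a (a + u) b (b + v) g) <=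
    4 * cabs (rint p.1 (p.1 + u / 2) p.2 (p.2 + v / 2) g)].
Proof.
move=> u0 v0 cg.
have eu : a + u = (a + u / 2) + u / 2 by lra.
have ev : b + v = (b + v / 2) + v / 2 by lra.
have cl : cts_rect a (a + u / 2) b (b + v) g by apply: cts_rectS cg; lra.
have cr : cts_rect (a + u / 2) (a + u) b (b + v) g by apply: cts_rectS cg; lra.
have E : rint a (a + u) b (b + v) g =
   (rint a (a + u / 2) b (b + v / 2) g +
    rint a (a + u / 2) (b + v / 2) (b + v / 2 + v / 2) g) +
   (rint (a + u / 2) (a + u / 2 + u / 2) b (b + v / 2) g +
    rint (a + u / 2) (a + u / 2 + u / 2) (b + v / 2) (b + v / 2 + v / 2) g).
  rewrite (@rint_splitx _ _ (a + u / 2)); last exact: cts_rect_bdry.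
  - rewrite (@rint_splity _ a _ b (b + v / 2)); last exact: cts_rect_bdry.
    + rewrite (@rint_splity _ (a + u / 2) _ b (b + v / 2)); last exact: cts_rect_bdry.
      * by rewrite -eu -ev.
      * lra.
      * by apply/andP; split; lra.
    + lra.
    + by apply/andP; split; lra.
  - by apply/andP; split; lra.
  - lra.
pose I p := cabs (rint p.1 (p.1 + u / 2) p.2 (p.2 + v / 2) g).
apply: contrapT => H.
have I4 (p : R * R) : p.1 = a \/ p.1 = a + u / 2 -> p.2 = b \/ p.2 = b + v / 2 ->
    4 * I p < cabs (rint a (a + u) b (b + v) g).
  by move=> p1 p2; rewrite ltNge; apply/negP => hp; apply: H; exists p.
have i1 := I4 (a, b) (or_introl erefl) (or_introl erefl).
have i2 := I4 (a, b + v / 2) (or_introl erefl) (or_intror erefl).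
have i3 := I4 (a + u / 2, b) (or_intror erefl) (or_introl erefl).
have i4 := I4 (a + u / 2, b + v / 2) (or_intror erefl) (or_intror erefl).
by have := cabs_sum4_lt i1 i2 i3 i4; rewrite -E ltxx.
Qed.

(** Allows the tangent map at z to be subtracted from the integrand without changing the boundary
    integral. *)
Lemma rint_affine x0 x1 y0 y1 z c d : x0 <= x1 -> y0 <= y1 ->
  rint x0 x1 y0 y1 (fun w => c + d * (w - z)) = 0.
Proof.
move=> hx hy.
have ca w : {for w, continuous (fun w => c + d * (w - z))}.
  apply: ctsD; first exact: cts_cst.
  apply: ctsM; first exact: cts_cst.
  apply: ctsB; [exact: cvg_id|exact: cts_cst].
apply: (@rint_derive _ _ _ _ _ _ (fun w => c * w + d / 2 * ((w - z) * (w - z)))) => //.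
move=> w _.
have dz : cder (fun w => w - z) w (1 - 0) by apply: cderB; [exact: cder_id|exact: cder_cst].
have := cderD (cderZ c (cder_id w)) (cderZ (d / 2) (cderM dz dz)).
by congr cder; rewrite subr0 mulr1 mul1r mulr1 -mulr2n -mulr_natl; field.
Qed.

Lemma cabs_rect_le a b u v z w : rect a (a + u) b (b + v) z ->
  rect a (a + u) b (b + v) w -> cabs (w - z) <= u + v.
Proof.
move=> [/andP[z1 z2] /andP[z3 z4]] [/andP[w1 w2] /andP[w3 w4]].
apply: le_trans (cabs_le_re_im _) _; rewrite reB imB; apply: lerD;
  rewrite ler_norml; lra.
Qed.

(** Repeated bisection leads to a point z common to all the rectangles [s n]. There g differs from
    its tangent map by at most e' |w - z|, while diameter and side lengths are at most L / 2^n. The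
    n-th integral is thus at most 8 e' L^2 / 4^n, which cancels the factor 4^n lost by bisecting. *)
Theorem goursat x0 x1 y0 y1 g : x0 <= x1 -> y0 <= y1 ->
  (forall z, rect x0 x1 y0 y1 z -> exists d, cder g z d) ->
  rint x0 x1 y0 y1 g = 0.
Proof.
move=> hx hy dg.
have cg : cts_rect x0 x1 y0 y1 g by move=> z /dg[d]; exact: cder_continuous.
pose u n : R := (x1 - x0) / 2 ^+ n.
pose v n : R := (y1 - y0) / 2 ^+ n.
have uS n : u n.+1 = u n / 2 by rewrite /u exprS invfM mulrA mulrAC.
have vS n : v n.+1 = v n / 2 by rewrite /v exprS invfM mulrA mulrAC.
have u0 n : 0 <= u n by rewrite divr_ge0 ?exprn_ge0 ?subr_ge0.
have v0 n : 0 <= v n by rewrite divr_ge0 ?exprn_ge0 ?subr_ge0.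
pose good n (p q : R * R) := [/\ q.1 = p.1 \/ q.1 = p.1 + u n / 2,
  q.2 = p.2 \/ q.2 = p.2 + v n / 2 &
  cabs (rint p.1 (p.1 + u n) p.2 (p.2 + v n) g) <=
    4 * cabs (rint q.1 (q.1 + u n / 2) q.2 (q.2 + v n / 2) g)].
(* The default of [xget] is never taken: a good quarter exists as long as the current rectangle lies
   in the original one. This is why [s_in] proves containment and goodness in one induction. *)
pose s := fix s n := if n is m.+1 then xget (s m) [set q | good m (s m) q]
                     else (x0, y0).
have s_in n : [/\ x0 <= (s n).1, (s n).1 + u n <= x1, y0 <= (s n).2 &
                  (s n).2 + v n <= y1] /\ good n (s n) (s n.+1).
  have step m : [/\ x0 <= (s m).1, (s m).1 + u m <= x1, y0 <= (s m).2 &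
                  (s m).2 + v m <= y1] -> good m (s m) (s m.+1).
    move=> [h1 h2 h3 h4].
    have [] := @rint_quarter (s m).1 (s m).2 (u m) (v m) g => //.
      exact: cts_rectS cg.
    move=> q hq; exact: (@xgetPex _ (s m) [set q | good m (s m) q] (ex_intro _ q hq)).
  elim: n => [|n [[h1 h2 h3 h4] [p1 p2 _]]].
    have h : [/\ x0 <= (s 0%N).1, (s 0%N).1 + u 0%N <= x1, y0 <= (s 0%N).2 &
                  (s 0%N).2 + v 0%N <= y1].
      by rewrite /= /u /v expr0 !divr1; split; lra.
    by split => //; exact: step.
  have h : [/\ x0 <= (s n.+1).1, (s n.+1).1 + u n.+1 <= x1, y0 <= (s n.+1).2 &
                  (s n.+1).2 + v n.+1 <= y1].
    have := u0 n; have := v0 n; rewrite uS vS => a1 a2.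
    by split; [case: p1 => ->|case: p1 => ->|case: p2 => ->|case: p2 => ->]; lra.
  by split => //; exact: step.
have [c1 hc1] : exists c, forall n, (s n).1 <= c <= (s n).1 + u n.
  apply: nested_itv => n; have := u0 n; rewrite ?uS;
  have [_ [p1 p2 _]] := s_in n; try case: p1 => ->; lra.
have [c2 hc2] : exists c, forall n, (s n).2 <= c <= (s n).2 + v n.
  apply: nested_itv => n; have := v0 n; rewrite ?vS;
  have [_ [p1 p2 _]] := s_in n; try case: p2 => ->; lra.
pose z := mkC c1 c2.
have zin n : rect (s n).1 ((s n).1 + u n) (s n).2 ((s n).2 + v n) z.
  by split; rewrite ?re_mkC ?im_mkC.
have big n : cabs (rint x0 x1 y0 y1 g) <= 4 ^+ n *
   cabs (rint (s n).1 ((s n).1 + u n) (s n).2 ((s n).2 + v n) g).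
  elim: n => [|n IH].
    rewrite expr0 mul1r /= /u /v expr0 !divr1.
    by have -> : x0 + (x1 - x0) = x1 by [lra]; have -> : y0 + (y1 - y0) = y1 by [lra].
  apply: le_trans IH _; rewrite exprSr -mulrA ler_pM2l ?exprn_gt0// uS vS.
  by have [_ []] := s_in n.
have [d [q [cq qd gq]]] : exists d, cder g z d.
  apply: dg; have [[h1 h2 h3 h4] _] := s_in 0%N.
  have [/andP[k1 k2] /andP[k3 k4]] := zin 0%N.
  by split; apply/andP; split; lra.
pose L := (x1 - x0) + (y1 - y0).
have L0 : 0 <= L by rewrite /L; lra.
apply/eqP; rewrite -cabs_eq0 eq_le cabs_ge0 andbT; apply/ler_addgt0Pr => e e0.
rewrite add0r.
(* The final bound is 8 L^2 e'; the added 1 keeps the denominator positive for a degenerate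
   rectangle. *)
pose e' := e / (8 * L * L + 1).
have e'0 : 0 < e'.
  by rewrite divr_gt0// ltr_wpDl// mulr_ge0// mulr_ge0.
have [dl dl0 hdl] : exists2 dl, 0 < dl & forall w, cabs (w - z) < dl -> cabs (q w - q z) < e'.
  by move/cts_cabsP : cq => /(_ _ e'0) /nbhs_cabsP.
have [n hn] : exists n, L / 2 ^+ n < dl.
  exists (Num.truncn (L / dl)).+1; rewrite ltr_pdivrMr ?exprn_gt0// mulrC -ltr_pdivrMr//.
  apply: lt_le_trans (truncnS_gt _) _.
  by rewrite -natrX ler_nat; apply/ltnW/ltn_expl.
have uvn : u n + v n = L / 2 ^+ n by rewrite /u /v -mulrDl.
apply: le_trans (big n) _.
have [[h1 h2 h3 h4] _] := s_in n.
have cgn : cts_rect (s n).1 ((s n).1 + u n) (s n).2 ((s n).2 + v n) g.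
  exact: cts_rectS cg.
have ha : (s n).1 <= (s n).1 + u n by rewrite lerDl.
have hb : (s n).2 <= (s n).2 + v n by rewrite lerDl.
have caf w : {for w, continuous (fun w => g z + d * (w - z))}.
  apply: ctsD; first exact: cts_cst.
  apply: ctsM; first exact: cts_cst.
  apply: ctsB; [exact: cvg_id|exact: cts_cst].
have := rintB ha hb (cts_rect_bdry cgn) (fun w _ => caf w).
rewrite (rint_affine z (g z) d ha hb) subr0 => <-.
have Hle : cabs (rint (s n).1 ((s n).1 + u n) (s n).2 ((s n).2 + v n)
   (fun w => g w - (g z + d * (w - z)))) <= 8 * ((e' * (L / 2 ^+ n)) * (L / 2 ^+ n)).
  have Ln0 : 0 <= L / 2 ^+ n by rewrite divr_ge0// exprn_ge0.
  have un : (s n).1 + u n - (s n).1 <= L / 2 ^+ n by rewrite -uvn addrC addKr lerDl.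
  have vn : (s n).2 + v n - (s n).2 <= L / 2 ^+ n by rewrite -uvn addrC addKr lerDr.
  have M0 : 0 <= e' * (L / 2 ^+ n) by rewrite mulr_ge0// ltW.
  apply: (rint_le ha hb un vn M0) => [w hw|w [hw _]].
    by apply: ctsB; [exact: (cts_rect_bdry cgn)|exact: caf].
  have -> : g w - (g z + d * (w - z)) = (q w - q z) * (w - z).
    by rewrite mulrBl qd -gq opprD addrA.
  have wz : cabs (w - z) <= L / 2 ^+ n by rewrite -uvn; exact: (cabs_rect_le (zin n) hw).
  rewrite cabsM; apply: ler_pM; [exact: cabs_ge0|exact: cabs_ge0| |exact: wz].
  by apply/ltW/hdl; exact: le_lt_trans wz hn.
apply: (@le_trans _ _ (4 ^+ n * (8 * ((e' * (L / 2 ^+ n)) * (L / 2 ^+ n))))).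
  by rewrite ler_wpM2l// exprn_ge0.
have -> : 4 ^+ n * (8 * ((e' * (L / 2 ^+ n)) * (L / 2 ^+ n))) = e' * (8 * L * L).
  have -> : (4 : R) ^+ n = 2 ^+ n * 2 ^+ n by rewrite -exprMn; congr (_ ^+ _); ring.
  by field; rewrite expf_neq0.
rewrite /e' mulrAC ler_pdivrMr; last by rewrite ltr_wpDl// mulr_ge0// mulr_ge0.
by rewrite ler_pM2l// lerDl.
Qed.

End Goursat.

(** * Cauchy's formula *)

Section CauchyFormula.
Variable R : realType.
Implicit Types (x y a b : R) (z w d : Cplx R) (f g h G : Cplx R -> Cplx R).

Definition inside x0 x1 y0 y1 w := x0 < re w < x1 /\ y0 < im w < y1.

Lemma inside_neq x0 x1 y0 y1 w z : inside x0 x1 y0 y1 w -> rbdry x0 x1 y0 y1 z ->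
  z != w.
Proof.
move=> [/andP[w1 w2] /andP[w3 w4]] [_ hz]; apply/eqP => zw; rewrite zw in hz.
by case: hz => e; move: w1 w2 w3 w4; rewrite e ltxx.
Qed.

Lemma inside_le x0 x1 y0 y1 w : inside x0 x1 y0 y1 w -> x0 <= x1 /\ y0 <= y1.
Proof.
by move=> [/andP[w1 w2] /andP[w3 w4]]; split; apply/ltW; [exact: lt_trans w2|exact: lt_trans w4].
Qed.

Lemma cder_subV w z : z != w ->
  cder (fun z => (z - w)^-1) z (- (1 - 0) / (z - w) ^+ 2).
Proof.
move=> zw; apply: cderV; first by rewrite subr_eq0.
by apply: cderB; [exact: cder_id|exact: cder_cst].
Qed.

Lemma cts_subV w z : z != w -> {for z, continuous (fun z => (z - w)^-1)}.
Proof. by move=> /cder_subV /cder_continuous. Qed.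

(** The outer rectangle is the inner one plus four rectangles that miss w, and Goursat's theorem
    applies to each of these. *)
Lemma rint_sub x0 x1 y0 y1 a0 a1 b0 b1 w h :
  x0 <= a0 -> a1 <= x1 -> y0 <= b0 -> b1 <= y1 -> inside a0 a1 b0 b1 w ->
  (forall z, rect x0 x1 y0 y1 z -> z != w -> exists d, cder h z d) ->
  rint x0 x1 y0 y1 h = rint a0 a1 b0 b1 h.
Proof.
move=> h1 h2 h3 h4 [/andP[w1 w2] /andP[w3 w4]] dh.
have xw : x0 <= x1 by lra.
have yw : y0 <= y1 by lra.
have cb u0 u1 v0 v1 : x0 <= u0 -> u1 <= x1 -> y0 <= v0 -> v1 <= y1 ->
    inside u0 u1 v0 v1 w -> cts_rbdry u0 u1 v0 v1 h.
  move=> k1 k2 k3 k4 iw z hz; have zw := inside_neq iw hz.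
  case: hz => -[/andP[z1 z2] /andP[z3 z4]] _.
  have [|d] := dh z _ zw; first by split; apply/andP; split; lra.
  exact: cder_continuous.
have zero u0 u1 v0 v1 : x0 <= u0 -> u1 <= x1 -> y0 <= v0 -> v1 <= y1 ->
    u0 <= u1 -> v0 <= v1 -> ~ rect u0 u1 v0 v1 w -> rint u0 u1 v0 v1 h = 0.
  move=> k1 k2 k3 k4 k5 k6 nw; apply: goursat => [//|//|z hz].
  apply: dh; last by apply/eqP => zw; apply: nw; rewrite -zw.
  by move: hz => -[/andP[z1 z2] /andP[z3 z4]]; split; apply/andP; split; lra.
rewrite (@rint_splitx _ x0 a0 x1); [|by apply/andP; split; lra|lra|].
  2: by apply: cb; [lra|lra|lra|lra|split; apply/andP; split; lra].
rewrite (zero x0 a0); [|lra|lra|lra|lra|lra|lra|by case=> /andP[k1 k2] _; lra].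
rewrite add0r (@rint_splitx _ a0 a1 x1); [|by apply/andP; split; lra|lra|].
  2: by apply: cb; [lra|lra|lra|lra|split; apply/andP; split; lra].
rewrite (zero a1 x1); [|lra|lra|lra|lra|lra|lra|by case=> /andP[k1 k2] _; lra].
rewrite addr0 (@rint_splity _ a0 a1 y0 b0 y1); [|lra|by apply/andP; split; lra|].
  2: by apply: cb; [lra|lra|lra|lra|split; apply/andP; split; lra].
rewrite (zero a0 a1 y0 b0); [|lra|lra|lra|lra|lra|lra|by case=> _ /andP[k1 k2]; lra].
rewrite add0r (@rint_splity _ a0 a1 b0 b1 y1); [|lra|by apply/andP; split; lra|].
  2: by apply: cb; [lra|lra|lra|lra|split; apply/andP; split; lra].
rewrite (zero a0 a1 b1 y1); [|lra|lra|lra|lra|lra|lra|by case=> _ /andP[k1 k2]; lra].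
by rewrite addr0.
Qed.

(** The contour can be shrunk to a square of half side k around w. There h is bounded by M, so the
    integral is at most 16 M k. *)
Lemma goursat_punctured x0 x1 y0 y1 w h : inside x0 x1 y0 y1 w ->
  (forall z, rect x0 x1 y0 y1 z -> z != w -> exists d, cder h z d) ->
  {for w, continuous h} -> rint x0 x1 y0 y1 h = 0.
Proof.
move=> [/andP[w1 w2] /andP[w3 w4]] dh ch.
pose M := cabs (h w) + 1.
have M0 : 0 < M by rewrite /M; have := cabs_ge0 (h w); lra.
have [dl dl0 hdl] : exists2 dl, 0 < dl & forall z, cabs (z - w) < dl -> cabs (h z) <= M.
  move/cts_cabsP : ch => /(_ _ ltr01) /nbhs_cabsP[dl dl0 hdl]; exists dl => // z /hdl hz.
  by have := cabsB_ge (h z) (h w); rewrite /M; lra.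
apply/eqP; rewrite -cabs_eq0 eq_le cabs_ge0 andbT; apply/ler_addgt0Pr => e e0.
rewrite add0r.
pose m := Num.min (Num.min (re w - x0) (x1 - re w)) (Num.min (im w - y0) (y1 - im w)).
have m0 : 0 < m by rewrite /m !lt_min !subr_gt0 w1 w2 w3 w4.
have [m1 m2 m3 m4] : [/\ m <= re w - x0, m <= x1 - re w, m <= im w - y0 & m <= y1 - im w].
  by rewrite /m; split; rewrite !ge_min lexx ?orbT.
(* The three bounds keep the square inside the rectangle, put its boundary (within 2 k of w) into
   the ball where h is bounded, and make 16 M k at most e. *)
pose k := Num.min m (Num.min (dl / 3) (e / (16 * M))).
have k0 : 0 < k by rewrite /k lt_min m0 /= lt_min !divr_gt0// mulr_gt0.
have [km kd ke] : [/\ k <= m, k <= dl / 3 & k <= e / (16 * M)].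
  by rewrite /k; split; rewrite ge_min ?lexx//; apply/orP; right; rewrite ge_min lexx ?orbT.
have ine : inside (re w - k) (re w + k) (im w - k) (im w + k) w.
  by split; apply/andP; split; lra.
rewrite (rint_sub _ _ _ _ ine dh); [|lra|lra|lra|lra].
have kx : re w - k <= re w + k by lra.
have ky : im w - k <= im w + k by lra.
have kl : re w + k - (re w - k) <= 2 * k by lra.
have kl' : im w + k - (im w - k) <= 2 * k by lra.
have -> : e = 8 * (M * (2 * (e / (16 * M)))) by field; rewrite gt_eqF.
apply: (@le_trans _ _ (8 * (M * (2 * k)))); last first.
  by rewrite !ler_pM2l.
apply: (rint_le kx ky kl kl' (ltW M0)) => z hz.
  have zw := inside_neq ine hz; case: hz => -[/andP[z1 z2] /andP[z3 z4]] _.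
  have [|d] := dh z _ zw; first by split; apply/andP; split; lra.
  exact: cder_continuous.
apply: hdl; case: hz => -[/andP[z1 z2] /andP[z3 z4]] _.
apply: le_lt_trans (cabs_le_re_im _) _; rewrite reB imB.
have h1 : `|re z - re w| <= k by rewrite ler_norml; apply/andP; split; lra.
have h2 : `|im z - im w| <= k by rewrite ler_norml; apply/andP; split; lra.
lra.
Qed.

(** This is $2\pi i$ times the winding number. It enters only through [cder_winding] and
    [winding_ge]. *)
Definition winding x0 x1 y0 y1 w : Cplx R :=
  rint x0 x1 y0 y1 (fun z => (z - w)^-1).

(** The quotient q of g at w is continuous at w and equals (g z - g w) / (z - w) elsewhere, hence is
    holomorphic off w. The punctured form of Goursat's theorem makes its integral vanish. *)
Lemma cauchy_formula x0 x1 y0 y1 w g : inside x0 x1 y0 y1 w ->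
  (forall z, rect x0 x1 y0 y1 z -> exists d, cder g z d) ->
  rint x0 x1 y0 y1 (fun z => g z / (z - w)) = g w * winding x0 x1 y0 y1 w.
Proof.
move=> iw dg; have [hx hy] := inside_le iw.
have [dw [q [cq _ gq]]] : exists d, cder g w d.
  by apply: dg; case: iw => /andP[w1 w2] /andP[w3 w4]; split; apply/andP; split; lra.
have q0 : rint x0 x1 y0 y1 q = 0.
  apply: (goursat_punctured iw _ cq) => z hz zw.
  have [d dz] := dg z hz.
  exists ((d - 0) * (z - w)^-1 + (g z - g w) * (- (1 - 0) / (z - w) ^+ 2)).
  apply: (@near_cder _ (fun z => (g z - g w) * (z - w)^-1)); last first.
    apply: cderM; last exact: cder_subV.
    by apply: cderB => //; exact: cder_cst.
  have zw0 : 0 < cabs (z - w) by rewrite cabs_gt0 subr_eq0.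
  apply/nbhs_cabsP; exists (cabs (z - w)) => // v hv.
  rewrite gq mulfK//; apply/eqP => vw.
  have : v - z = - (z - w) + (v - w) by ring.
  by rewrite vw addr0 => vz; move: hv; rewrite vz cabsN ltxx.
have cg : cts_rbdry x0 x1 y0 y1 g by move=> z [/dg[d /cder_continuous]].
have cV : cts_rbdry x0 x1 y0 y1 (fun z => (z - w)^-1).
  by move=> z /(inside_neq iw); exact: cts_subV.
have cgV : cts_rbdry x0 x1 y0 y1 (fun z => g z / (z - w)).
  by move=> z hz; apply: ctsM; [exact: cg|exact: cV].
have cwV : cts_rbdry x0 x1 y0 y1 (fun z => g w / (z - w)).
  by move=> z hz; apply: ctsM; [exact: cts_cst|exact: cV].
apply/eqP; rewrite -subr_eq0 /winding -(rintZ (g w) hx hy cV) -(rintB hx hy cgV cwV).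
rewrite -q0; apply/eqP; apply: (eq_rint hx hy) => z hz.
by rewrite -mulrBl gq mulfK// subr_eq0; exact: inside_neq hz.
Qed.

End CauchyFormula.

(** * Differentiation under the boundary integral *)

Section CauchyDerivative.
Variable R : realType.
Implicit Types (x y a b : R) (z w d v : Cplx R) (f g h G : Cplx R -> Cplx R).

(** The factor 2 lets w move by less than k and still keep distance k from the boundary, see
    [kernel_dist]. *)
Lemma rbdry_dist x0 x1 y0 y1 w : inside x0 x1 y0 y1 w ->
  exists2 k, 0 < k & forall z, rbdry x0 x1 y0 y1 z -> 2 * k <= cabs (z - w).
Proof.
move=> [/andP[w1 w2] /andP[w3 w4]].
pose m := Num.min (Num.min (re w - x0) (x1 - re w)) (Num.min (im w - y0) (y1 - im w)).
have m0 : 0 < m by rewrite /m !lt_min !subr_gt0 w1 w2 w3 w4.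
have [m1 m2 m3 m4] : [/\ m <= re w - x0, m <= x1 - re w, m <= im w - y0 & m <= y1 - im w].
  by rewrite /m; split; rewrite !ge_min lexx ?orbT.
exists (m / 2); first by rewrite divr_gt0.
move=> z [_ hz]; rewrite mulrC divfK//.
have hr := re_le_cabs (z - w); have hi := im_le_cabs (z - w).
rewrite reB in hr; rewrite imB in hi.
case: hz => e; rewrite e in hr hi *.
- by apply: le_trans hr; rewrite ler0_norm; lra.
- by apply: le_trans hr; rewrite ger0_norm; lra.
- by apply: le_trans hi; rewrite ler0_norm; lra.
- by apply: le_trans hi; rewrite ger0_norm; lra.
Qed.

Lemma lpt_bounded a b c e g : a <= b ->
  (forall t, a <= t <= b -> {for lpt c e t, continuous g}) ->
  exists M, forall t, a <= t <= b -> cabs (g (lpt c e t)) <= M.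
Proof.
move=> ab /cts_on_lpt cg.
have [|t0 _ ht] := @EVT_max R (fun t => cabs (g (lpt c e t))) a b ab.
  apply: continuous_in_subspaceT => t; rewrite inE /= in_itv /= => /cg ct.
  exact: (cts_cabs ct).
by exists (cabs (g (lpt c e t0))) => t hab; apply: ht; rewrite in_itv.
Qed.

Lemma rbdry_bounded x0 x1 y0 y1 g : x0 <= x1 -> y0 <= y1 ->
  cts_rbdry x0 x1 y0 y1 g ->
  exists2 M, 0 <= M & forall z, rbdry x0 x1 y0 y1 z -> cabs (g z) <= M.
Proof.
move=> hx hy /(cts_sides hx hy)[g1 g2 g3 g4].
have [M1 h1] := lpt_bounded hx g1; have [M2 h2] := lpt_bounded hx g2.
have [M3 h3] := lpt_bounded hy g3; have [M4 h4] := lpt_bounded hy g4.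
exists (`|M1| + `|M2| + (`|M3| + `|M4|)) => [|z [[hz1 hz2] hz]].
  by rewrite !addr_ge0.
have n1 := normr_ge0 M1; have n2 := normr_ge0 M2.
have n3 := normr_ge0 M3; have n4 := normr_ge0 M4.
have l1 := ler_norm M1; have l2 := ler_norm M2.
have l3 := ler_norm M3; have l4 := ler_norm M4.
rewrite -[z]mkC_re_im; case: hz => ->.
- by have := h3 _ hz2; rewrite lpt_ver; lra.
- by have := h4 _ hz2; rewrite lpt_ver; lra.
- by have := h1 _ hz1; rewrite lpt_hor; lra.
- by have := h2 _ hz1; rewrite lpt_hor; lra.
Qed.

Lemma cts_rint_param x0 x1 y0 y1 w (h : Cplx R -> Cplx R -> Cplx R) k M :
  x0 <= x1 -> y0 <= y1 -> 0 < k -> 0 <= M ->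
  (forall v, cabs (v - w) < k -> cts_rbdry x0 x1 y0 y1 (h v)) ->
  (forall v z, cabs (v - w) < k -> rbdry x0 x1 y0 y1 z ->
     cabs (h v z - h w z) <= M * cabs (v - w)) ->
  {for w, continuous (fun v => rint x0 x1 y0 y1 (h v))}.
Proof.
move=> hx hy k0 M0 ch hM; apply/cts_cabsP => e e0; apply/nbhs_cabsP.
pose L := (x1 - x0) + (y1 - y0).
have [L0 Lx Ly] : [/\ 0 <= L, x1 - x0 <= L & y1 - y0 <= L] by rewrite /L; split; lra.
pose D := 8 * M * L + 1.
have D0 : 0 < D by rewrite /D ltr_wpDl// !mulr_ge0.
exists (Num.min k (e / D)); first by rewrite lt_min k0 divr_gt0.
move=> v; rewrite lt_min => /andP[vk]; rewrite ltr_pdivlMr// => ve.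
have wk : cabs (w - w) < k by rewrite subrr cabs0.
rewrite -(rintB hx hy (ch v vk) (ch w wk)).
have Mv0 : 0 <= M * cabs (v - w) by rewrite mulr_ge0// cabs_ge0.
apply: (@le_lt_trans _ _ (8 * (M * cabs (v - w) * L))).
  apply: (rint_le hx hy Lx Ly Mv0) => [z hz|z hz]; last exact: hM.
  by apply: ctsB; [exact: (ch v vk)|exact: (ch w wk)].
apply: le_lt_trans ve; rewrite /D.
have := cabs_ge0 (v - w); nra.
Qed.

Lemma cts_bdry_kernel x0 x1 y0 y1 G w n : inside x0 x1 y0 y1 w ->
  cts_rbdry x0 x1 y0 y1 G ->
  cts_rbdry x0 x1 y0 y1 (fun z => G z / (z - w) ^+ n).
Proof.
move=> iw cG z hz; apply: ctsM; first exact: cG.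
have zw := inside_neq iw hz.
have e : (fun z => ((z - w) ^+ n)^-1) = (fun z => ((z - w)^-1) ^+ n).
  by apply/funext => t; rewrite exprVn.
rewrite e; elim: n {e} => [|n IH].
  by rewrite (_ : (fun z => _) = (fun=> 1)); [exact: cts_cst|apply/funext => t; rewrite expr0].
rewrite (_ : (fun z => _) = (fun z => (z - w)^-1 * (z - w)^-1 ^+ n)); last first.
  by apply/funext => t; rewrite exprS.
by apply: ctsM; [exact: cts_subV|exact: IH].
Qed.

Lemma kernel_dist (k : R) z w v : 2 * k <= cabs (z - w) -> cabs (v - w) < k ->
  k <= cabs (z - v).
Proof.
move=> h1 h2; have := cabsB_ge (z - w) (v - w).
have -> : z - w - (v - w) = z - v by ring.
lra.
Qed.

Lemma inside_nbhs x0 x1 y0 y1 w : inside x0 x1 y0 y1 w ->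
  \near w, inside x0 x1 y0 y1 w.
Proof.
move=> [/andP[w1 w2] /andP[w3 w4]]; apply/nbhs_cabsP.
pose m := Num.min (Num.min (re w - x0) (x1 - re w)) (Num.min (im w - y0) (y1 - im w)).
have m0 : 0 < m by rewrite /m !lt_min !subr_gt0 w1 w2 w3 w4.
have [m1 m2 m3 m4] : [/\ m <= re w - x0, m <= x1 - re w, m <= im w - y0 & m <= y1 - im w].
  by rewrite /m; split; rewrite !ge_min lexx ?orbT.
exists m => // v hv.
have := le_lt_trans (re_le_cabs (v - w)) hv; have := le_lt_trans (im_le_cabs (v - w)) hv.
rewrite reB imB !ltr_norml => /andP[h1 h2] /andP[h3 h4].
by split; apply/andP; split; lra.
Qed.

(** The identity 1/(z - v) - 1/(z - w) = (v - w) / ((z - v)(z - w)) exhibits the Carathéodory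
    quotient [Q]. Its continuity at w follows from a Lipschitz estimate that is uniform on the
    boundary. *)
Lemma cder_rint_kernel x0 x1 y0 y1 G w : inside x0 x1 y0 y1 w ->
  cts_rbdry x0 x1 y0 y1 G ->
  cder (fun v => rint x0 x1 y0 y1 (fun z => G z / (z - v))) w
       (rint x0 x1 y0 y1 (fun z => G z / (z - w) ^+ 2)).
Proof.
move=> iw cG; have [hx hy] := inside_le iw.
have [k k0 hk] := rbdry_dist iw; have [M M0 hM] := rbdry_bounded hx hy cG.
pose Q v := rint x0 x1 y0 y1 (fun z => G z / (z - v) ^+ 1 / (z - w) ^+ 1).
have cK v : inside x0 x1 y0 y1 v ->
    cts_rbdry x0 x1 y0 y1 (fun z => G z / (z - v) ^+ 1 / (z - w) ^+ 1).
  by move=> iv; exact: (cts_bdry_kernel (n := 1) iw (cts_bdry_kernel (n := 1) iv cG)).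
have cK1 v : inside x0 x1 y0 y1 v -> cts_rbdry x0 x1 y0 y1 (fun z => G z / (z - v)).
  by move=> iv; exact: (cts_bdry_kernel (n := 1) iv cG).
have /nbhs_cabsP[k' k'0 hk'] := inside_nbhs iw.
have cQ : {for w, continuous Q}.
  apply: (@cts_rint_param _ _ _ _ _ _ (Num.min k k') (M / (k * k * k))).
  - exact: hx.
  - exact: hy.
  - by rewrite lt_min k0.
  - by rewrite divr_ge0// !mulr_ge0// ltW.
  - by move=> v; rewrite lt_min => /andP[_ /hk'/cK].
  - move=> v z; rewrite lt_min => /andP[vk /hk' iv] hz.
    have zw := inside_neq iw hz; have zv := inside_neq iv hz.
    have -> : G z / (z - v) ^+ 1 / (z - w) ^+ 1 - G z / (z - w) ^+ 1 / (z - w) ^+ 1 =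
       G z / (z - v) / (z - w) / (z - w) * (v - w).
      by field; rewrite !subr_eq0 zv zw.
    rewrite cabsM; apply: ler_wpM2r; first exact: cabs_ge0.
    have zvk := kernel_dist (hk z hz) vk.
    have zwk : k <= cabs (z - w) by have := hk z hz; lra.
    rewrite !cabsM !cabsV !invfM !mulrA.
    have Vk a : k <= a -> a^-1 <= k^-1 by move=> ka; rewrite lef_pV2// posrE; lra.
    have V0 v0 : 0 <= (cabs v0)^-1 by rewrite invr_ge0 cabs_ge0.
    apply: ler_pM; [|exact: V0| |exact: Vk].
      by rewrite mulr_ge0// mulr_ge0// cabs_ge0.
    apply: ler_pM; [|exact: V0| |exact: Vk].
      by rewrite mulr_ge0// cabs_ge0.
    apply: ler_pM; [exact: cabs_ge0|exact: V0|exact: hM|exact: Vk].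
pose F v := rint x0 x1 y0 y1 (fun z => G z / (z - v)).
apply: (@near_cder _ (fun v => F w + Q v * (v - w))); last first.
  exists Q; split; [exact: cQ| |].
    rewrite /Q; apply: (eq_rint hx hy) => z _.
    by rewrite -mulrA -invfM.
  by move=> v; rewrite subrr mulr0 addr0 addrC addKr.
apply: filterS (inside_nbhs iw) => v iv; rewrite /F /Q.
rewrite [Q v * _]mulrC -(rintZ (v - w) hx hy (cK v iv)).
rewrite -(rintD hx hy (cK1 w iw)); last first.
  by move=> z hz; apply: ctsM; [exact: cts_cst|exact: (cK v iv z hz)].
apply: (eq_rint hx hy) => z hz.
have zw := inside_neq iw hz; have zv := inside_neq iv hz.
by field; rewrite !subr_eq0 zv zw.
Qed.

(** Prepares the continuity of g' in [continuous_derive1]. The difference of the kernels factors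
    into v - w times a sum of two terms, whence the 2 in the Lipschitz constant. *)
Lemma cts_rint_kernel2 x0 x1 y0 y1 G w : inside x0 x1 y0 y1 w ->
  cts_rbdry x0 x1 y0 y1 G ->
  {for w, continuous (fun v => rint x0 x1 y0 y1 (fun z => G z / (z - v) ^+ 2))}.
Proof.
move=> iw cG; have [hx hy] := inside_le iw.
have [k k0 hk] := rbdry_dist iw; have [M M0 hM] := rbdry_bounded hx hy cG.
have /nbhs_cabsP[k' k'0 hk'] := inside_nbhs iw.
apply: (@cts_rint_param _ _ _ _ _ (fun v z => G z / (z - v) ^+ 2)
  (Num.min k k') (2 * (M / (k * k * k)))).
- exact: hx.
- exact: hy.
- by rewrite lt_min k0.
- by rewrite mulr_ge0// divr_ge0// !mulr_ge0// ltW.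
- by move=> v; rewrite lt_min => /andP[_ /hk' iv]; exact: (cts_bdry_kernel (n := 2) iv cG).
- move=> v z; rewrite lt_min => /andP[vk /hk' iv] hz.
  have zw := inside_neq iw hz; have zv := inside_neq iv hz.
  have -> : G z / (z - v) ^+ 2 - G z / (z - w) ^+ 2 =
     (G z / (z - v) / (z - w) / (z - w) + G z / (z - v) / (z - v) / (z - w)) * (v - w).
    by field; rewrite !subr_eq0 zv zw.
  rewrite cabsM; apply: ler_wpM2r; first exact: cabs_ge0.
  have zvk := kernel_dist (hk z hz) vk.
  have zwk : k <= cabs (z - w) by have := hk z hz; lra.
  apply: le_trans (cabsD_le _ _) _; rewrite mulr_natl mulr2n.
  have Vk a : k <= a -> a^-1 <= k^-1 by move=> ka; rewrite lef_pV2// posrE; lra.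
  have V0 v0 : 0 <= (cabs v0)^-1 by rewrite invr_ge0 cabs_ge0.
  have H v1 v2 v3 : k <= cabs v1 -> k <= cabs v2 -> k <= cabs v3 ->
      cabs (G z / v1 / v2 / v3) <= M / (k * k * k).
    move=> k1 k2 k3; rewrite !cabsM !cabsV !invfM !mulrA.
    apply: ler_pM; [|exact: V0| |exact: Vk].
      by rewrite mulr_ge0// mulr_ge0// cabs_ge0.
    apply: ler_pM; [|exact: V0| |exact: Vk].
      by rewrite mulr_ge0// cabs_ge0.
    apply: ler_pM; [exact: cabs_ge0|exact: V0|exact: hM|exact: Vk].
  by apply: lerD; apply: H.
Qed.

(** Differentiation under the integral produces 1/(z - w)^2, which has the primitive -1/(z - w)
    along the boundary. *)
Lemma cder_winding x0 x1 y0 y1 w : inside x0 x1 y0 y1 w ->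
  cder (winding x0 x1 y0 y1) w 0.
Proof.
move=> iw; have [hx hy] := inside_le iw.
have c1 : cts_rbdry x0 x1 y0 y1 (fun=> 1 : Cplx R) by move=> z _; exact: cts_cst.
have := cder_rint_kernel iw c1.
have -> : rint x0 x1 y0 y1 (fun z => 1 / (z - w) ^+ 2) = 0.
  apply: (rint_derive (G := fun z => - (z - w)^-1) hx hy (cts_bdry_kernel (n := 2) iw c1)).
  move=> z hz; have := cderN (cder_subV (inside_neq iw hz)).
  by congr cder; rewrite subr0 mulNr opprK.
congr cder; apply/funext => v; rewrite /winding; apply: (eq_rint hx hy) => z _.
exact: mul1r.
Qed.

(** Both sides are the derivative at w of [g * winding]: the left one by differentiating the kernel,
    the right one by the product rule with [cder_winding]. *)
Lemma cauchy_formula_derivative x0 x1 y0 y1 w g d : inside x0 x1 y0 y1 w ->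
  (forall z, rect x0 x1 y0 y1 z -> exists d, cder g z d) -> cder g w d ->
  rint x0 x1 y0 y1 (fun z => g z / (z - w) ^+ 2) = d * winding x0 x1 y0 y1 w.
Proof.
move=> iw dg gd.
have cg : cts_rbdry x0 x1 y0 y1 g by move=> z [/dg[e /cder_continuous]].
have h1 := cder_rint_kernel iw cg.
have := cderM gd (cder_winding iw); rewrite mulr0 addr0 => h2.
apply: (cder_unique h1); apply: near_cder h2.
by apply: filterS (inside_nbhs iw) => v iv; rewrite (cauchy_formula iv dg).
Qed.

End CauchyDerivative.

(** * Lower bound for the winding integral, and continuity of the derivative *)

Section WindingBound.
Variable R : realType.
Implicit Types (x y a b : R) (z w d v : Cplx R) (f g h G : Cplx R -> Cplx R).

Lemma reV z : re z^-1 = re z / (re z ^+ 2 + im z ^+ 2).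
Proof.
have [->|z0] := eqVneq z 0; first by rewrite invr0 re0 im0 mul0r.
have E : z * mkC (re z) (- im z) = mkC (re z ^+ 2 + im z ^+ 2) 0.
  by apply: Cplx_eq; rewrite ?(reM, imM) !(re_mkC, im_mkC); ring.
have n0 : re z ^+ 2 + im z ^+ 2 != 0 by rewrite -cabs_sqr expf_neq0 ?cabs_eq0.
have -> : z^-1 = mkC (re z / (re z ^+ 2 + im z ^+ 2)) (- im z / (re z ^+ 2 + im z ^+ 2)).
  apply: (mulfI z0); rewrite divff//; apply: Cplx_eq;
  rewrite ?(reM, imM) !(re_mkC, im_mkC) ?re1 ?im1; field; exact: n0.
by rewrite re_mkC.
Qed.

Lemma imV z : im z^-1 = - im z / (re z ^+ 2 + im z ^+ 2).
Proof.
have -> : im z^-1 = - re (mkC 0 1 * z^-1).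
  by rewrite reM re_mkC im_mkC mul0r mul1r sub0r opprK.
have -> : mkC 0 1 * z^-1 = (- mkC 0 1 * z)^-1.
  rewrite invfM; congr (_ * _); apply/eqP.
  have i2 : - mkC 0 1 * mkC 0 1 = 1 :> Cplx R.
    by apply: Cplx_eq; rewrite ?(reM, imM, reN, imN) !(re_mkC, im_mkC) ?re1 ?im1; ring.
  have i0 : - mkC 0 1 != 0 :> Cplx R.
    by apply/eqP => e; move: i2; rewrite e mul0r => /eqP; rewrite eq_sym oner_eq0.
  by rewrite -(inj_eq (mulfI i0)) i2 divff.
rewrite reV !(reM, imM, reN, imN, re_mkC, im_mkC) -mulNr; congr (_ / _); ring.
Qed.

(* The contour is oriented counterclockwise around [w], so on each side the
   imaginary part of [dz / (z - w)] is positive. *)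
Lemma winding_ge x0 x1 y0 y1 w r : 0 < r ->
  r <= re w - x0 <= 4 * r -> r <= x1 - re w <= 4 * r ->
  r <= im w - y0 <= 4 * r -> r <= y1 - im w <= 4 * r ->
  1 / 4 <= cabs (winding x0 x1 y0 y1 w).
Proof.
move=> r0 /andP[w1 w1'] /andP[w2 w2'] /andP[w3 w3'] /andP[w4 w4'].
have iw : inside x0 x1 y0 y1 w by split; apply/andP; split; lra.
have [hx hy] := inside_le iw.
have cV : cts_rbdry x0 x1 y0 y1 (fun z => (z - w)^-1).
  by move=> z /(inside_neq iw); exact: cts_subV.
have [c1 c2 c3 c4] := cts_sides hx hy cV.
apply: le_trans (im_le_cabs _).
(* On each side the numerator s is at least r and D is at most 32 r^2. Since a side is at least 2 r
   long, it contributes at least 1/16. *)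
have K : forall s t D : R, r <= s <= 4 * r -> - (4 * r) <= t <= 4 * r ->
    D = s ^+ 2 + t ^+ 2 -> (32 * r)^-1 <= s / D.
  move=> s t D /andP[s1 s2] /andP[t1 t2] ->.
  have s0 : 0 < s by lra.
  rewrite -[leLHS]mul1r ler_pdivrMr; last by rewrite mulr_gt0.
  rewrite mulrAC ler_pdivlMr; last by rewrite ltr_pwDl ?exprn_gt0 ?sqr_ge0.
  nra.
have sum4 (A B C D : R) : 1 / 16 <= A -> B <= - (1 / 16) -> C <= - (1 / 16) ->
    1 / 16 <= D -> 1 / 4 <= A + D - B - C by lra.
have [lx ly] : 2 * r <= x1 - x0 /\ 2 * r <= y1 - y0 by split; lra.
have k16 : (32 * r)^-1 * (2 * r) = 1 / 16 by field; rewrite gt_eqF.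
have r32 : 0 <= (32 * r)^-1 by rewrite invr_ge0 mulr_ge0// ltW.
have B1 : 1 / 16 <= im (lint x0 x1 (mkC 0 y0) 1 (fun z => (z - w)^-1)).
  rewrite im_lint1; apply: (@le_trans _ _ ((32 * r)^-1 * (x1 - x0))).
    by rewrite -k16 ler_wpM2l.
  apply: (Rintegral_itv_ge hx (cts_on_im (cts_on_lpt c1))) => t /andP[t1 t2].
  rewrite lpt_hor imV reB imB re_mkC im_mkC.
  clear -K w1 w1' w2 w2' w3 w3' w4 w4' t1 t2.
  by apply: (K _ (t - re w)); [apply/andP; split; lra|apply/andP; split; lra|ring].
have B2 : im (lint x0 x1 (mkC 0 y1) 1 (fun z => (z - w)^-1)) <= - (1 / 16).
  rewrite im_lint1; apply: (@le_trans _ _ (- (32 * r)^-1 * (x1 - x0))); last first.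
    by rewrite -k16 mulNr lerN2 ler_wpM2l.
  apply: (Rintegral_itv_le hx (cts_on_im (cts_on_lpt c2))) => t /andP[t1 t2].
  rewrite lpt_hor imV reB imB re_mkC im_mkC mulNr lerN2.
  clear -K w1 w1' w2 w2' w3 w3' w4 w4' t1 t2.
  by apply: (K _ (t - re w)); [apply/andP; split; lra|apply/andP; split; lra|ring].
have B3 : im (lint y0 y1 (mkC x0 0) (mkC 0 1) (fun z => (z - w)^-1)) <= - (1 / 16).
  rewrite im_lint_i; apply: (@le_trans _ _ (- (32 * r)^-1 * (y1 - y0))); last first.
    by rewrite -k16 mulNr lerN2 ler_wpM2l.
  apply: (Rintegral_itv_le hy (cts_on_re (cts_on_lpt c3))) => t /andP[t1 t2].
  rewrite lpt_ver reV reB imB re_mkC im_mkC -[leLHS]opprK lerN2 -mulNr.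
  clear -K w1 w1' w2 w2' w3 w3' w4 w4' t1 t2.
  by apply: (K _ (t - im w)); [apply/andP; split; lra|apply/andP; split; lra|ring].
have B4 : 1 / 16 <= im (lint y0 y1 (mkC x1 0) (mkC 0 1) (fun z => (z - w)^-1)).
  rewrite im_lint_i; apply: (@le_trans _ _ ((32 * r)^-1 * (y1 - y0))).
    by rewrite -k16 ler_wpM2l.
  apply: (Rintegral_itv_ge hy (cts_on_re (cts_on_lpt c4))) => t /andP[t1 t2].
  rewrite lpt_ver reV reB imB re_mkC im_mkC.
  clear -K w1 w1' w2 w2' w3 w3' w4 w4' t1 t2.
  by apply: (K _ (t - im w)); [apply/andP; split; lra|apply/andP; split; lra|ring].
have -> : im (winding x0 x1 y0 y1 w) =
  im (lint x0 x1 (mkC 0 y0) 1 (fun z => (z - w)^-1)) +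
  im (lint y0 y1 (mkC x1 0) (mkC 0 1) (fun z => (z - w)^-1)) -
  im (lint x0 x1 (mkC 0 y1) 1 (fun z => (z - w)^-1)) -
  im (lint y0 y1 (mkC x0 0) (mkC 0 1) (fun z => (z - w)^-1)).
  by rewrite /winding rintE !imB imD.
exact: le_trans (sum4 _ _ _ _ B1 B2 B3 B4) (ler_norm _).
Qed.

Definition holo_on (U : set (Cplx R)) g := forall z, U z -> exists d, cder g z d.

Lemma holo_on_derive1 U g z : holo_on U g -> U z -> cder g z (derive1 g z).
Proof. by move=> dg /dg[d] /[dup] dz /cder_derivable[_ ->]. Qed.

(** On a small square around z, g' is the quotient of the integral with kernel 1/(z - v)^2 by
    [winding]. Both are continuous at z, and the denominator is nonzero by [winding_ge]. *)
Lemma continuous_derive1 U g z : holo_on U g -> nbhs z U ->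
  {for z, continuous (derive1 g)}.
Proof.
move=> dg /nbhs_cabsP[e e0 he].
pose r := e / 4; have r0 : 0 < r by rewrite divr_gt0.
pose x0 := re z - r; pose x1 := re z + r; pose y0 := im z - r; pose y1 := im z + r.
have iz : inside x0 x1 y0 y1 z.
  by rewrite /x0 /x1 /y0 /y1; split; apply/andP; split; lra.
have RU v : rect x0 x1 y0 y1 v -> U v.
  rewrite /x0 /x1 /y0 /y1 => -[/andP[v1 v2] /andP[v3 v4]]; apply: he.
  apply: le_lt_trans (cabs_le_re_im _) _; rewrite reB imB.
  have h1 : `|re v - re z| <= r by rewrite ler_norml; apply/andP; split; lra.
  have h2 : `|im v - im z| <= r by rewrite ler_norml; apply/andP; split; lra.
  by have : e = 4 * r by [rewrite /r; lra]; lra.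
have dR v : rect x0 x1 y0 y1 v -> exists d, cder g v d by move=> /RU /dg.
have cg : cts_rbdry x0 x1 y0 y1 g by move=> v [/dR[d /cder_continuous]].
have N0 : winding x0 x1 y0 y1 z != 0.
  have h : 1 / 4 <= cabs (winding x0 x1 y0 y1 z).
    by apply: (winding_ge r0); rewrite /x0 /x1 /y0 /y1; apply/andP; split; lra.
  by rewrite -cabs_gt0; lra.
have cW := cder_continuous (cder_winding iz).
have cK := cts_rint_kernel2 iz cg.
apply: (near_cts _ (ctsM cK (ctsV N0 cW))).
have nN : \near z, winding x0 x1 y0 y1 z != 0.
  exact: (@cvgr_neq0 _ _ _ (nbhs z) _ (winding x0 x1 y0 y1) _ cW N0).
apply: filterS2 (inside_nbhs iz) nN => v iv Nv.
have rv : rect x0 x1 y0 y1 v.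
  by case: iv => /andP[v1 v2] /andP[v3 v4]; split; apply/andP; split; lra.
rewrite (cauchy_formula_derivative iv dR (holo_on_derive1 dg (RU v rv))).
by rewrite mulfK.
Qed.

(** Integration by parts: g'/(z - w) - g/(z - w)^2 is the derivative of g/(z - w), so its boundary
    integral vanishes. Only continuity of g' enters. *)
Lemma cauchy_formula_derive1 x0 x1 y0 y1 w g : inside x0 x1 y0 y1 w ->
  holo_on (rect x0 x1 y0 y1) g -> cts_rect x0 x1 y0 y1 (derive1 g) ->
  rint x0 x1 y0 y1 (fun z => derive1 g z / (z - w)) =
  derive1 g w * winding x0 x1 y0 y1 w.
Proof.
move=> iw dg cg'; have [hx hy] := inside_le iw.
have rw : rect x0 x1 y0 y1 w.
  by case: iw => /andP[v1 v2] /andP[v3 v4]; split; apply/andP; split; lra.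
have E := cauchy_formula_derivative iw dg (holo_on_derive1 dg rw).
apply: etrans E.
have cg : cts_rbdry x0 x1 y0 y1 g by move=> v [/dg[d /cder_continuous]].
have c1 : cts_rbdry x0 x1 y0 y1 (fun z => derive1 g z / (z - w)).
  exact: (cts_bdry_kernel (n := 1) iw (cts_rect_bdry cg')).
have c2 := cts_bdry_kernel (n := 2) iw cg.
apply/eqP; rewrite -subr_eq0 -(rintB hx hy c1 c2); apply/eqP.
apply: (rint_derive (G := fun z => g z / (z - w)) hx hy).
  by move=> z hz; apply: ctsB; [exact: c1|exact: c2].
move=> z hz; have zw := inside_neq iw hz.
have := cderM (holo_on_derive1 dg hz.1) (cder_subV zw).
by congr cder; rewrite subr0 mulNr mulrN mul1r.
Qed.

End WindingBound.

(** * Integrals of nonnegative functions on the plane *)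

Section MeasureLemmas.
Variable R : realType.
Notation leb := (@lebesgue_measure R).
Implicit Types (a b k : R).

(* No measurability is needed: the integral of a nonnegative function is a
   supremum over the simple functions below it. *)
Lemma ge0_le_integral_subset d (T : measurableType d) (mu : {measure set T -> \bar R})
    (A B : set T) (f g : T -> \bar R) :
  A `<=` B -> (forall x, A x -> 0 <= f x)%E -> (forall x, B x -> 0 <= g x)%E ->
  (forall x, A x -> f x <= g x)%E ->
  (\int[mu]_(x in A) f x <= \int[mu]_(x in B) g x)%E.
Proof.
move=> AB f0 g0 fg; rewrite !ge0_integralE//.
apply: ereal_sup_le => _ [h hf <-]; exists h => // x.
apply: le_trans (hf x) _; rewrite /patch.
case: ifPn => [|_].
  by rewrite inE => xA; rewrite ifT ?inE; [exact: fg|exact: AB].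
by case: ifPn; rewrite ?inE// => /g0.
Qed.

(** The sigma-algebra on the plane is generated by products, so the open set is written as the
    countable union of the boxes with rational center and radius that it contains. *)
Lemma open_prod_measurable (A : set (R * R)) : open A -> measurable A.
Proof.
move=> oA.
pose box (q : rat * rat * rat) : set (R * R) :=
  (ball (ratr q.1.1 : R) (ratr q.2)) `*` (ball (ratr q.1.2 : R) (ratr q.2)).
have -> : A = \bigcup_(q : rat * rat * rat)
    (if `[< box q `<=` A >] then box q else set0).
  apply/seteqP; split=> [[x y] Axy|p [q _]]; last first.
    by case: ifPn => // /asboolP; exact.
  have [/= e /= e0 eA] : nbhs_ball (x, y) A.
    by apply/nbhs_ballP; apply: open_nbhs_nbhs; split.
  have e4 : 0 < e / 4 by rewrite divr_gt0.
  have [q1] := @rat_in_itvoo R (x - e / 4) (x + e / 4) ltac:(lra).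
  rewrite in_itv/= => /andP[x1 x2].
  have [q2] := @rat_in_itvoo R (y - e / 4) (y + e / 4) ltac:(lra).
  rewrite in_itv/= => /andP[y1 y2].
  (* The center is within e/4 of the point in each coordinate: a radius above e/4 makes the box
     contain the point, and one below e/2 keeps it within 3e/4 of it. *)
  have [q3] := @rat_in_itvoo R (e / 4) (e / 2) ltac:(lra).
  rewrite in_itv/= => /andP[r1 r2].
  exists (q1, q2, q3) => //; rewrite ifT; last first.
    apply/asboolP => -[u v] [/=]; rewrite /ball/= !ltr_norml => /andP[u1 u2] /andP[v1 v2].
    by apply: eA; split; rewrite /ball/= ltr_norml; apply/andP; split; lra.
  by split; rewrite /ball/= ltr_norml; apply/andP; split; lra.
apply: countable_bigcupT_measurable => // q; case: ifPn => // _.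
by apply: measurableX; apply: open_measurable; exact: ball_open.
Qed.

Lemma cts_measurable_fun (U : set (R * R)) (f : R * R -> R) : open U ->
  (forall p, U p -> {for p, continuous f}) -> measurable_fun U f.
Proof.
move=> oU cf; apply: (measurability _ (RGenOpens.measurableE R)).
move=> _ [_ [a [b ->] <-]]; apply: open_prod_measurable.
rewrite openE => p [Up fp]; apply: filterI; first exact: open_nbhs_nbhs.
by apply: (cf p Up); apply: open_nbhs_nbhs; split => //; exact: interval_open.
Qed.

Definition rectR (x0 x1 y0 y1 : R) : set (R * R) := `[x0, x1]%classic `*` `[y0, y1]%classic.

Lemma measurable_rectR x0 x1 y0 y1 : measurable (rectR x0 x1 y0 y1).
Proof. exact: measurableX. Qed.

(** An averaging argument: if every vertical slice had integral at least k, Tonelli's theorem would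
    make the area integral at least k (x1 - x0) > C. *)
Lemma exists_good_vertical x0 x1 y0 y1 (f : R * R -> R) C k :
  x0 <= x1 -> measurable_fun (rectR x0 x1 y0 y1) f -> (forall p, 0 <= f p) ->
  (\int[leb \x leb]_(p in rectR x0 x1 y0 y1) (f p)%:E <= C%:E)%E ->
  C < k * (x1 - x0) -> 0 <= k ->
  exists2 x, x0 <= x <= x1 & (\int[leb]_(y in `[y0, y1]) (f (x, y))%:E <= k%:E)%E.
Proof.
move=> hx mf f0 fC Ck k0; apply: contrapT => H.
have {}H x : x0 <= x <= x1 -> (k%:E <= \int[leb]_(y in `[y0, y1]) (f (x, y))%:E)%E.
  by move=> xx; rewrite leNgt; apply/negP => /ltW h; apply: H; exists x.
pose F := (EFin \o f) \_ (rectR x0 x1 y0 y1).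
have F0 p : (0 <= F p)%E by rewrite /F /patch; case: ifP => // _; rewrite lee_fin.
have mF : measurable_fun setT F.
  apply/(measurable_restrictT _ (measurable_rectR _ _ _ _)).
  exact/measurable_EFinP.
have := fC; rewrite leNgt => /negP; apply; rewrite integral_mkcond.
change (C%:E < \int[leb \x leb]_p F p)%E.
rewrite (@fubini_tonelli1 _ _ _ _ R leb leb F mF F0).
apply: (@lt_le_trans _ _ (\int[leb]_(x in `[x0, x1]) k%:E)%E).
  rewrite integral_cst//= lebesgue_measure_itv/= lte_fin.
  move: hx Ck; rewrite le_eqVlt => /predU1P[->|hx].
    by rewrite ltxx mule0 subrr mulr0 lte_fin.
  by rewrite hx -EFinD -EFinM lte_fin.
apply: ge0_le_integral_subset => // [x _|x xin].
  by apply: integral_ge0.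
apply: (le_trans (H x _)); first by move: xin; rewrite /= in_itv.
rewrite /fubini_F; apply: ge0_le_integral_subset => // [y _|y yin].
  by rewrite lee_fin.
by rewrite /F /patch ifT// inE; split.
Qed.

(** The same with the order of integration exchanged. *)
Lemma exists_good_horizontal x0 x1 y0 y1 (f : R * R -> R) C k :
  y0 <= y1 -> measurable_fun (rectR x0 x1 y0 y1) f -> (forall p, 0 <= f p) ->
  (\int[leb \x leb]_(p in rectR x0 x1 y0 y1) (f p)%:E <= C%:E)%E ->
  C < k * (y1 - y0) -> 0 <= k ->
  exists2 y, y0 <= y <= y1 & (\int[leb]_(x in `[x0, x1]) (f (x, y))%:E <= k%:E)%E.
Proof.
move=> hy mf f0 fC Ck k0; apply: contrapT => H.
have {}H y : y0 <= y <= y1 -> (k%:E <= \int[leb]_(x in `[x0, x1]) (f (x, y))%:E)%E.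
  by move=> xx; rewrite leNgt; apply/negP => /ltW h; apply: H; exists y.
pose F := (EFin \o f) \_ (rectR x0 x1 y0 y1).
have F0 p : (0 <= F p)%E by rewrite /F /patch; case: ifP => // _; rewrite lee_fin.
have mF : measurable_fun setT F.
  apply/(measurable_restrictT _ (measurable_rectR _ _ _ _)).
  exact/measurable_EFinP.
have := fC; rewrite leNgt => /negP; apply; rewrite integral_mkcond.
change (C%:E < \int[leb \x leb]_p F p)%E.
rewrite (@fubini_tonelli2 _ _ _ _ R leb leb F mF F0).
apply: (@lt_le_trans _ _ (\int[leb]_(x in `[y0, y1]) k%:E)%E).
  rewrite integral_cst//= lebesgue_measure_itv/= lte_fin.
  move: hy Ck; rewrite le_eqVlt => /predU1P[->|hy].
    by rewrite ltxx mule0 subrr mulr0 lte_fin.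
  by rewrite hy -EFinD -EFinM lte_fin.
apply: ge0_le_integral_subset => // [y _|y yin].
  by apply: integral_ge0.
apply: (le_trans (H y _)); first by move: yin; rewrite /= in_itv.
rewrite /fubini_G; apply: ge0_le_integral_subset => // [x _|x xin].
  by rewrite lee_fin.
by rewrite /F /patch ifT// inE; split.
Qed.

End MeasureLemmas.

(** * Bloch-type bound on Q_s *)

Section BlochBound.
Variable R : realType.
Notation leb := (@lebesgue_measure R).
Implicit Types (z w a : Cplx R) (g : Cplx R -> Cplx R).

Lemma cts_mkC2 (p : R * R) : {for p, continuous (fun p : R * R => mkC p.1 p.2)}.
Proof. by apply: cts_mkC; [exact: cvg_fst|exact: cvg_snd]. Qed.

Definition discR : set (R * R) := [set p | cabs (mkC p.1 p.2) < 1].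

Lemma open_discR : open discR.
Proof.
rewrite openE => p Dp.
have /ctsR_P/(_ (1 - cabs (mkC p.1 p.2))) : {for p, continuous (fun p : R * R => cabs (mkC p.1 p.2))}.
  exact: (cts_cabs (cts_mkC2 (p := p))).
have p1 : 0 < 1 - cabs (mkC p.1 p.2) by move: Dp; rewrite /discR /= subr_gt0.
move=> /(_ p1); apply: filterS => q; rewrite ltr_norml => /andP[_].
by rewrite /discR /=; lra.
Qed.

Lemma nbhs_disc z : disc R z -> nbhs z (disc R).
Proof.
rewrite /disc /= => z1; apply/nbhs_cabsP; exists (1 - cabs z); first by rewrite subr_gt0.
move=> w hw; have := cabsB_ge w z; rewrite /disc /=; lra.
Qed.

Lemma Hol_holo_on g : Hol R g -> holo_on (disc R) g.
Proof. by move=> hg z /hg /derivable_cder; exists (derive1 g z). Qed.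

(** Here |1 - conj(a) z| >= 1 - |a| >= 2 |z - a|. The point z = a is excluded because [green a a]
    has the default value 0. *)
Lemma green_ge z a : cabs a < 1 -> cabs z < 1 -> z != a ->
  2 * cabs (z - a) <= 1 - cabs a -> ln 2 <= green z a.
Proof.
move=> a1 z1 za h; have d0 : 0 < cabs (z - a) by rewrite cabs_gt0 subr_eq0.
rewrite /green cabsM cabsV ler_ln ?posrE//; last first.
  rewrite mulr_gt0 ?invr_gt0// cabs_gt0; apply/eqP => e.
  have := cabsB_ge 1 (cconj a * z); rewrite e cabs0 cabs1 cabsM cabs_conj.
  have := cabs_ge0 a; have := cabs_ge0 z; nra.
rewrite ler_pdivlMr//; apply: le_trans h _.
have := cabsB_ge 1 (cconj a * z); rewrite cabs1 cabsM cabs_conj.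
have := cabs_ge0 a; have := cabs_ge0 z; nra.
Qed.

Lemma Qspace_bounded s g : Qspace s g -> exists2 C, 0 <= C &
  forall a, disc R a -> (disc_integral (fun z =>
     ((cabs (derive1 g z) ^+ 2) * (green z a `^ s))%R) <= C%:E)%E.
Proof.
move=> [_ hS]; set S := (X in (ereal_sup X < _)%E) in hS.
exists (Num.max 0 (fine (ereal_sup S))); first by rewrite le_max lexx.
move=> a Da; apply: (@le_trans _ _ (ereal_sup S)).
  by apply: ereal_sup_ubound; exists a.
case: (ereal_sup S) hS => [r| |] //= _; last by rewrite leNye.
by rewrite lee_fin le_max lexx orbT.
Qed.

(** A priori I may be infinite; positivity of L and q then makes J infinite, against its bound. *)
Lemma ereal_chain (I J : \bar R) L q C : 0 < L -> 0 < q -> (0 <= I)%E ->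
  (L%:E * I <= J)%E -> ((q^-1)%:E * J <= C%:E)%E -> (I <= (q * C / L)%:E)%E.
Proof.
move=> L0 q0; case: J => [j||].
- case: I => [i||] //.
    rewrite -!EFinM !lee_fin => _ h1 h2; rewrite ler_pdivlMr// mulrC.
    by apply: le_trans h1 _; rewrite -ler_pdivrMl.
  by rewrite gt0_muley ?lte_fin.
- by rewrite gt0_muley ?lte_fin ?invr_gt0.
- by move=> I0 h; have := le_trans (mule_ge0 (ltW L0 : (0 <= L%:E)%E) I0) h.
Qed.

(** On such a rectangle the weight is at least (ln 2)^s, so the Q_s integral dominates the
    unweighted one. The factor pi undoes the normalization of dA. *)
Lemma strip_le s g C a x0 x1 y0 y1 : 0 <= s -> Hol R g -> disc R a ->
  (disc_integral (fun z =>
     ((cabs (derive1 g z) ^+ 2) * (green z a `^ s))%R) <= C%:E)%E ->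
  (forall p, rectR x0 x1 y0 y1 p -> [/\ discR p, mkC p.1 p.2 != a &
     2 * cabs (mkC p.1 p.2 - a) <= 1 - cabs a]) ->
  measurable_fun (rectR x0 x1 y0 y1)
    (fun p => cabs (derive1 g (mkC p.1 p.2)) ^+ 2) /\
  (\int[leb \x leb]_(p in rectR x0 x1 y0 y1)
     (cabs (derive1 g (mkC p.1 p.2)) ^+ 2)%:E <= (pi * C / (ln 2 `^ s))%:E)%E.
Proof.
move=> s0 /Hol_holo_on dg Da hC hA.
have mf : measurable_fun (rectR x0 x1 y0 y1)
    (fun p => cabs (derive1 g (mkC p.1 p.2)) ^+ 2).
  apply: (measurable_funS (E := discR)).
  - exact: open_prod_measurable open_discR.
  - by move=> p /hA[].
  apply: cts_measurable_fun; first exact: open_discR.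
  move=> p Dp; have Dz : disc R (mkC p.1 p.2) by [].
  have cd := continuous_derive1 dg (nbhs_disc Dz).
  have cc : {for p, continuous (fun p => cabs (derive1 g (mkC p.1 p.2)))}.
    apply: (@cts_cabs _ _ (fun p => derive1 g (mkC p.1 p.2))).
    exact: (continuous_comp (cts_mkC2 (p := p)) cd).
  have -> : (fun p : R * R => cabs (derive1 g (mkC p.1 p.2)) ^+ 2) =
     (fun p => cabs (derive1 g (mkC p.1 p.2)) * cabs (derive1 g (mkC p.1 p.2))).
    by apply/funext => q; rewrite expr2.
  exact: (ctsM cc cc).
split=> //.
have ln2 : 0 < ln 2 :> R by rewrite ln_gt0// ltr1n.
have L0 : 0 < (ln 2 : R) `^ s by rewrite powR_gt0.
have I0 : (0 <= \int[leb \x leb]_(p in rectR x0 x1 y0 y1)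
     (cabs (derive1 g (mkC p.1 p.2)) ^+ 2)%:E)%E.
  by apply: integral_ge0 => p _; rewrite lee_fin sqr_ge0.
have le1 : ((ln 2 `^ s)%:E * \int[leb \x leb]_(p in rectR x0 x1 y0 y1)
     (cabs (derive1 g (mkC p.1 p.2)) ^+ 2)%:E <= \int[leb \x leb]_(p in discR)
  (cabs (derive1 g (mkC p.1 p.2)) ^+ 2 * green (mkC p.1 p.2) a `^ s)%:E)%E.
  have Z : (\int[leb \x leb]_(p in rectR x0 x1 y0 y1)
      ((ln 2 `^ s)%:E * (cabs (derive1 g (mkC p.1 p.2)) ^+ 2)%:E) =
      (ln 2 `^ s)%:E * \int[leb \x leb]_(p in rectR x0 x1 y0 y1)
      (cabs (derive1 g (mkC p.1 p.2)) ^+ 2)%:E)%E.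
    apply: ge0_integralZl.
    - exact: measurable_rectR.
    - exact/measurable_EFinP.
    - by move=> p _; rewrite lee_fin sqr_ge0.
    - by rewrite lee_fin ltW.
  rewrite -Z.
  apply: ge0_le_integral_subset => [p /hA[]//|p _|p _|p /hA[Dp pa pd]].
  - by rewrite -EFinM lee_fin mulr_ge0// ?sqr_ge0// ltW.
  - by rewrite lee_fin mulr_ge0 ?sqr_ge0// powR_ge0.
  rewrite -EFinM lee_fin mulrC ler_wpM2l ?sqr_ge0//.
  have gr := green_ge Da Dp pa pd.
  by apply: ge0_ler_powR => //; rewrite nnegrE ltW//; exact: lt_le_trans gr.
by apply: (ereal_chain L0 (pi_gt0 R) I0 le1); move: hC; rewrite disc_integralE.
Qed.

(* [lint] along each side is controlled through [2 |u| <= r |u|^2 + 1 / r]. *)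
Lemma lint_kernel_le (c e a : Cplx R) t0 t1 (u : Cplx R -> Cplx R) (r k : R) :
  0 < r -> t0 <= t1 -> t1 - t0 <= 4 * r -> cabs e = 1 ->
  (forall t, t0 <= t <= t1 -> {for lpt c e t, continuous u}) ->
  (forall t, t0 <= t <= t1 -> r <= cabs (lpt c e t - a)) ->
  (\int[leb]_(t in `[t0, t1]) (cabs (u (lpt c e t)) ^+ 2)%:E <= k%:E)%E ->
  cabs (lint t0 t1 c e (fun z => u z / (z - a))) <= k + 4 / r.
Proof.
move=> r0 ht hl e1 cu hr hk.
have ch := cts_on_lpt cu.
have za t : t0 <= t <= t1 -> lpt c e t != a.
  by move=> /hr; rewrite -subr_eq0 -cabs_gt0; apply: lt_le_trans.
have cuV : cts_on t0 t1 (fun t => u (lpt c e t) / (lpt c e t - a)).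
  apply: (cts_on_lpt (g := fun z => u z / (z - a))) => t tt.
  by apply: ctsM; [exact: cu|exact: cts_subV (za t tt)].
have csq t : t0 <= t <= t1 -> {for t, continuous (fun t => cabs (u (lpt c e t)) ^+ 2)}.
  move=> /ch /cts_cabs cc.
  have -> : (fun t => cabs (u (lpt c e t)) ^+ 2) =
     (fun t => cabs (u (lpt c e t)) * cabs (u (lpt c e t))).
    by apply/funext => q; rewrite expr2.
  exact: (ctsM cc cc).
pose v t := 2^-1 * cabs (u (lpt c e t)) ^+ 2 + 2^-1 * (r^-1 * r^-1).
have iv : leb.-integrable `[t0, t1] (EFin \o v).
  apply: cts_integrable => t tt; apply: ctsD; last exact: cts_cst.
  by apply: ctsM; [exact: cts_cst|exact: csq].
have isq := cts_integrable csq.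
have le_v t : t0 <= t <= t1 -> cabs (u (lpt c e t) / (lpt c e t - a)) <= v t.
  move=> tt; rewrite cabsM cabsV.
  apply: (@le_trans _ _ (cabs (u (lpt c e t)) * r^-1)).
    apply: ler_wpM2l; first exact: cabs_ge0.
    have := hr t tt => hrt; rewrite lef_pV2// posrE//; exact: lt_le_trans hrt.
  rewrite /v; move: (cabs _) => A; move: (r^-1) => B.
  have := sqr_ge0 (A - B); nra.
have := cint_le_Rintegral cuV iv le_v.
rewrite lintE cabsM e1 mul1r => h; apply: le_trans h _.
have -> : \int[leb]_(t in `[t0, t1]) v t =
    2^-1 * \int[leb]_(t in `[t0, t1]) (cabs (u (lpt c e t)) ^+ 2) +
    2^-1 * (r^-1 * r^-1) * (t1 - t0).
  rewrite RintegralD//; first by rewrite RintegralZl// Rintegral_cst_itv.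
    by apply: cts_integrable => t tt; apply: ctsM; [exact: cts_cst|exact: csq].
  by apply: cts_integrable => t tt; exact: cts_cst.
rewrite mulrDr !mulrA divff// !mul1r; apply: lerD.
  rewrite /Rintegral -lee_fin fineK//.
  exact: (integrable_fin_num _ isq).
apply: (@le_trans _ _ (r^-1 * r^-1 * (4 * r))).
  by rewrite ler_wpM2l// mulr_ge0// invr_ge0 ltW.
by have -> : r^-1 * r^-1 * (4 * r) = 4 / r by field; rewrite gt_eqF.
Qed.

(** Between the squares of half sides r and 2 r around a lie four strips of width r that avoid a. A
    good line is taken in each, and the four lines bound the rectangle to which Cauchy's formula for
    g' is applied. *)
Theorem Qspace_bloch s g : 0 <= s -> Qspace s g -> exists K, forall a,
  disc R a -> cabs (derive1 g a) * (1 - cabs a) <= K.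
Proof.
move=> s0 Qg; have [C0 C00 hC0] := Qspace_bounded Qg.
have Hg : Hol R g by case: Qg.
have dg := Hol_holo_on Hg.
pose C := pi * C0 / (ln 2 `^ s).
have Cge0 : 0 <= C by rewrite /C divr_ge0 ?powR_ge0// mulr_ge0// pi_ge0.
(* The contour estimate gives |g'(a)| / 4 <= 4 (C + 5) / r, and r is (1 - |a|) / 8. *)
exists (128 * (C + 5)) => a Da.
(* With this r the square of half side 2 r lies within 4 r = (1 - |a|) / 2 of a, which is the range
   of [green_ge]. *)
pose r := (1 - cabs a) / 8.
have a1 : cabs a < 1 := Da.
have r0 : 0 < r by rewrite /r divr_gt0 // subr_gt0.
have ar : 1 - cabs a = 8 * r by rewrite /r; field.
pose x0 := re a - 2 * r; pose x1 := re a + 2 * r.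
pose y0 := im a - 2 * r; pose y1 := im a + 2 * r.
have [ex0 ex1 ey0 ey1] : [/\ re a - r - x0 = r, x1 - (re a + r) = r,
    im a - r - y0 = r & y1 - (im a + r) = r] by rewrite /x0 /x1 /y0 /y1; split; ring.
have [sx0 sx1 sx2 sx3] : [/\ x0 <= re a - r, re a - r <= x1, x0 <= re a + r &
    re a + r <= x1] by rewrite /x0 /x1; split; lra.
have [sy0 sy1 sy2 sy3] : [/\ y0 <= im a - r, im a - r <= y1, y0 <= im a + r &
    im a + r <= y1] by rewrite /y0 /y1; split; lra.
have [sr sl si su] : [/\ re a - r < re a, re a < re a + r, im a - r < im a &
    im a < im a + r] by split; lra.
have near_a z : rect x0 x1 y0 y1 z -> 2 * cabs (z - a) <= 1 - cabs a /\ disc R z.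
  move=> [/andP[z1 z2] /andP[z3 z4]].
  have h : cabs (z - a) <= 4 * r.
    apply: le_trans (cabs_le_re_im _) _; rewrite reB imB.
    have h1 : `|re z - re a| <= 2 * r by rewrite ler_norml; apply/andP; split; rewrite /x0 /x1 in z1 z2; lra.
    have h2 : `|im z - im a| <= 2 * r by rewrite ler_norml; apply/andP; split; rewrite /y0 /y1 in z3 z4; lra.
    lra.
  split; first by rewrite ar; lra.
  by rewrite /disc /=; have := cabsB_ge z a; lra.
have strip u0 u1 v0 v1 : x0 <= u0 -> u1 <= x1 -> y0 <= v0 -> v1 <= y1 ->
    (re a < u0 \/ u1 < re a \/ im a < v0 \/ v1 < im a) ->
    measurable_fun (rectR u0 u1 v0 v1)
      (fun p => cabs (derive1 g (mkC p.1 p.2)) ^+ 2) /\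
    (\int[leb \x leb]_(p in rectR u0 u1 v0 v1)
      (cabs (derive1 g (mkC p.1 p.2)) ^+ 2)%:E <= C%:E)%E.
  move=> k1 k2 k3 k4 ka; apply: (strip_le s0 Hg Da (hC0 a Da)) => p.
  move=> [/=]; rewrite !in_itv/= => /andP[p1 p2] /andP[p3 p4].
  have [|h Dp] := near_a (mkC p.1 p.2).
    clear -k1 k2 k3 k4 p1 p2 p3 p4.
    by split; rewrite ?re_mkC ?im_mkC; apply/andP; split; lra.
  split => //; apply/eqP => pa.
  move: ka; rewrite -pa re_mkC im_mkC; clear -p1 p2 p3 p4.
  by case=> [|[|[|]]]; lra.
(* Averaging over a strip of width r requires k r > C. *)
pose k := (C + 1) / r.
have kr : k * r = C + 1 by rewrite /k divfK// gt_eqF.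
have k0 : 0 <= k by rewrite /k divr_ge0 ?ltW//; lra.
have sq0 (p : R * R) : 0 <= cabs (derive1 g (mkC p.1 p.2)) ^+ 2 by exact: sqr_ge0.
have [X0 /andP[X0a X0b] hX0] : exists2 x, x0 <= x <= re a - r &
    (\int[leb]_(y in `[y0, y1]) (cabs (derive1 g (mkC x y)) ^+ 2)%:E <= k%:E)%E.
  have [mf hf] : _ := strip x0 (re a - r) y0 y1 (lexx _) sx1 (lexx _) (lexx _)
    (or_intror (or_introl sr)).
  apply: (exists_good_vertical _ mf sq0 hf _ k0); first exact: sx0.
  by rewrite ex0 kr ltrDl.
have [X1 /andP[X1a X1b] hX1] : exists2 x, re a + r <= x <= x1 &
    (\int[leb]_(y in `[y0, y1]) (cabs (derive1 g (mkC x y)) ^+ 2)%:E <= k%:E)%E.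
  have [mf hf] : _ := strip (re a + r) x1 y0 y1 sx2 (lexx _) (lexx _) (lexx _)
    (or_introl sl).
  apply: (exists_good_vertical _ mf sq0 hf _ k0); first exact: sx3.
  by rewrite ex1 kr ltrDl.
have [Y0 /andP[Y0a Y0b] hY0] : exists2 y, y0 <= y <= im a - r &
    (\int[leb]_(x in `[x0, x1]) (cabs (derive1 g (mkC x y)) ^+ 2)%:E <= k%:E)%E.
  have [mf hf] : _ := strip x0 x1 y0 (im a - r) (lexx _) (lexx _) (lexx _) sy1
    (or_intror (or_intror (or_intror si))).
  apply: (exists_good_horizontal _ mf sq0 hf _ k0); first exact: sy0.
  by rewrite ey0 kr ltrDl.
have [Y1 /andP[Y1a Y1b] hY1] : exists2 y, im a + r <= y <= y1 &
    (\int[leb]_(x in `[x0, x1]) (cabs (derive1 g (mkC x y)) ^+ 2)%:E <= k%:E)%E.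
  have [mf hf] : _ := strip x0 x1 (im a + r) y1 (lexx _) (lexx _) sy2 (lexx _)
    (or_intror (or_intror (or_introl su))).
  apply: (exists_good_horizontal _ mf sq0 hf _ k0); first exact: sy3.
  by rewrite ey1 kr ltrDl.
have sub z : rect X0 X1 Y0 Y1 z -> disc R z.
  move=> [/andP[z1 z2] /andP[z3 z4]]; apply: (near_a z _).2; split; apply/andP; split.
  - exact: le_trans z1.
  - exact: le_trans X1b.
  - exact: le_trans z3.
  - exact: le_trans Y1b.
have [dx0 dx1 dy0 dy1] : [/\ r <= re a - X0 <= 4 * r, r <= X1 - re a <= 4 * r,
    r <= im a - Y0 <= 4 * r & r <= Y1 - im a <= 4 * r].
  clear -r0 X0a X0b X1a X1b Y0a Y0b Y1a Y1b; rewrite /x0 /x1 /y0 /y1 in X0a X1b Y0a Y1b.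
  by split; apply/andP; split; lra.
have [lx ly] : X1 - X0 <= 4 * r /\ Y1 - Y0 <= 4 * r.
  clear -r0 X0a X1b Y0a Y1b; rewrite /x0 /x1 /y0 /y1 in X0a X1b Y0a Y1b.
  by split; lra.
have iw : inside X0 X1 Y0 Y1 a.
  by clear -r0 dx0 dx1 dy0 dy1; split; apply/andP; split; lra.
have [hx hy] := inside_le iw.
have cg' : cts_rect X0 X1 Y0 Y1 (derive1 g).
  by move=> z /sub Dz; exact: (continuous_derive1 dg (nbhs_disc Dz)).
have [c1 c2 c3 c4] := cts_sides hx hy (cts_rect_bdry cg').
have E := cauchy_formula_derive1 iw (fun z hz => dg z (sub z hz)) cg'.
have W : 1 / 4 <= cabs (winding X0 X1 Y0 Y1 a).
  exact: (winding_ge r0).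
(* The good lines were chosen for integrals across the full square, since the ends of each side
   depend on the other three choices. Restricting to the actual sides only decreases the
   integrals. *)
have sublx (f : R -> \bar R) : (forall x, 0 <= f x)%E ->
    (\int[leb]_(x in `[X0, X1]) f x <= \int[leb]_(x in `[x0, x1]) f x)%E.
  move=> f0; apply: ge0_le_integral_subset => // x /=; rewrite !in_itv/= => /andP[h1 h2].
  by rewrite (le_trans X0a h1) (le_trans h2 X1b).
have subly (f : R -> \bar R) : (forall x, 0 <= f x)%E ->
    (\int[leb]_(x in `[Y0, Y1]) f x <= \int[leb]_(x in `[y0, y1]) f x)%E.
  move=> f0; apply: ge0_le_integral_subset => // x /=; rewrite !in_itv/= => /andP[h1 h2].
  by rewrite (le_trans Y0a h1) (le_trans h2 Y1b).
have hR : cabs (rint X0 X1 Y0 Y1 (fun z => derive1 g z / (z - a))) <= 4 * (k + 4 / r).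
  have ef0 (f : R -> R * R) x : (0 <= (cabs (derive1 g (mkC (f x).1 (f x).2)) ^+ 2)%:E)%E.
    by rewrite lee_fin sqr_ge0.
  apply: rint_le_sides; split.
  - apply: (lint_kernel_le r0 hx lx (cabs1 R) c1) => [t tt|].
      rewrite lpt_hor; apply: le_trans (im_le_cabs _).
      by rewrite imB im_mkC -normrN opprB (le_trans _ (ler_norm _))//; case/andP: dy0.
    under eq_integral do rewrite lpt_hor.
    exact: le_trans (sublx _ (ef0 (fun x => (x, Y0)))) hY0.
  - apply: (lint_kernel_le r0 hx lx (cabs1 R) c2) => [t tt|].
      rewrite lpt_hor; apply: le_trans (im_le_cabs _).
      by rewrite imB im_mkC (le_trans _ (ler_norm _))//; case/andP: dy1.
    under eq_integral do rewrite lpt_hor.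
    exact: le_trans (sublx _ (ef0 (fun x => (x, Y1)))) hY1.
  - apply: (lint_kernel_le r0 hy ly (@cabs_i R) c3) => [t tt|].
      rewrite lpt_ver; apply: le_trans (re_le_cabs _).
      by rewrite reB re_mkC -normrN opprB (le_trans _ (ler_norm _))//; case/andP: dx0.
    under eq_integral do rewrite lpt_ver.
    exact: le_trans (subly _ (ef0 (fun y => (X0, y)))) hX0.
  - apply: (lint_kernel_le r0 hy ly (@cabs_i R) c4) => [t tt|].
      rewrite lpt_ver; apply: le_trans (re_le_cabs _).
      by rewrite reB re_mkC (le_trans _ (ler_norm _))//; case/andP: dx1.
    under eq_integral do rewrite lpt_ver.
    exact: le_trans (subly _ (ef0 (fun y => (X1, y)))) hX1.
move: hR; rewrite E cabsM => hR.
have kk : k + 4 / r = (C + 5) / r by rewrite /k -mulrDl; congr (_ / _); ring.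
have : cabs (derive1 g a) * (1 / 4) <= 4 * ((C + 5) / r).
  rewrite -kk; apply: le_trans hR; apply: ler_wpM2l W; exact: cabs_ge0.
rewrite mulrA ler_pdivlMr// ar; move: (cabs _) => A; clear; lra.
Qed.

End BlochBound.

(** * Liouville's theorem *)

Section Liouville.
Variable R : realType.
Implicit Types (z w a : Cplx R) (g phi : Cplx R -> Cplx R).

Lemma entire_holo phi : entire phi -> holo_on setT phi.
Proof. by move=> hphi z _; exists (derive1 phi z); exact: derivable_cder. Qed.

(** Cauchy's formula for phi' on the square of half side S: on the boundary phi' is at most |K| / S
    and 1/|z - w| at most 2 / S, while the sides have length 2 S, so phi'(w) is of order 1 / S. *)
Lemma entire_derive1_eq0 phi K T : entire phi ->
  (forall w, T <= cabs w -> cabs (derive1 phi w) * cabs w <= K) ->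
  forall w, derive1 phi w = 0.
Proof.
move=> /entire_holo dphi hK w; apply/eqP; rewrite -cabs_eq0 eq_le cabs_ge0 andbT.
apply/ler_addgt0Pr => e e0; rewrite add0r.
(* The term |T| makes the decay hypothesis available on the boundary, 2 |w| gives |z - w| >= S / 2
   there and centers w enough for [winding_ge], and the last term brings 32 |K| / S below e / 4. *)
pose S := 1 + `|T| + 2 * cabs w + 128 * `|K| / e.
have nT := normr_ge0 T; have nK := normr_ge0 K; have w0 := cabs_ge0 w.
have Ke : 0 <= 128 * `|K| / e by rewrite divr_ge0 ?mulr_ge0// ltW.
have S0 : 0 < S by rewrite /S; lra.
have ST : T <= S by have := ler_norm T; rewrite /S; lra.
have Sw : 2 * cabs w <= S by rewrite /S; lra.
have SK : 128 * `|K| <= e * S.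
  have -> : 128 * `|K| = e * (128 * `|K| / e) by field; rewrite gt_eqF.
  by rewrite ler_pM2l// /S; lra.
have rw : re w <= cabs w := le_trans (ler_norm _) (re_le_cabs w).
have rN : - cabs w <= re w by rewrite lerNl; apply: le_trans (re_le_cabs w); rewrite -normrN ler_norm.
have iw' : im w <= cabs w := le_trans (ler_norm _) (im_le_cabs w).
have iN : - cabs w <= im w by rewrite lerNl; apply: le_trans (im_le_cabs w); rewrite -normrN ler_norm.
have iw : inside (- S) S (- S) S w by split; apply/andP; split; lra.
have [hx _] := inside_le iw.
have dR : holo_on (rect (- S) S (- S) S) phi by move=> z _; exact: dphi.
have cg : cts_rect (- S) S (- S) S (derive1 phi).
  by move=> z _; apply: (continuous_derive1 dphi); exact: filterT.
have E := cauchy_formula_derive1 iw dR cg.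
have S2 : 0 < S / 2 by rewrite divr_gt0.
have W : 1 / 4 <= cabs (winding (- S) S (- S) S w).
  by apply: (winding_ge S2); apply/andP; split; lra.
have c1 : cts_rbdry (- S) S (- S) S (fun z => derive1 phi z / (z - w)).
  exact: (cts_bdry_kernel (n := 1) iw (cts_rect_bdry cg)).
have M0 : 0 <= `|K| / S * (2 / S) by rewrite mulr_ge0// divr_ge0// ltW.
have SL : S - - S <= 2 * S by lra.
have hz z : rbdry (- S) S (- S) S z -> S <= cabs z.
  move=> [_]; have hr := re_le_cabs z; have hi := im_le_cabs z.
  case=> ez; rewrite ez ?normrN (ger0_norm (ltW S0)) in hr hi *; by [].
have B := rint_le hx hx SL SL M0 c1.
have {}B : cabs (rint (- S) S (- S) S (fun z => derive1 phi z / (z - w))) <=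
   8 * (`|K| / S * (2 / S) * (2 * S)).
  apply: B => z /hz Sz; have z0 : 0 < cabs z by lra.
  rewrite cabsM cabsV; apply: ler_pM; [exact: cabs_ge0|by rewrite invr_ge0 cabs_ge0| |].
    have h : cabs (derive1 phi z) * cabs z <= `|K|.
      by apply: le_trans (hK z _) (ler_norm K); lra.
    rewrite ler_pdivlMr//; apply: le_trans h; apply: ler_wpM2l Sz; exact: cabs_ge0.
  have hzw : S / 2 <= cabs (z - w) by have := cabsB_ge z w; lra.
  by rewrite -[2 / S]invf_div lef_pV2// posrE//; lra.
move: B; rewrite E cabsM => B.
have : cabs (derive1 phi w) * (1 / 4) <= 8 * (`|K| / S * (2 / S) * (2 * S)).
  apply: le_trans B; apply: ler_wpM2l W; exact: cabs_ge0.
have -> : 8 * (`|K| / S * (2 / S) * (2 * S)) = 32 * `|K| / S by field; rewrite gt_eqF.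
have : 32 * `|K| / S <= e / 4 by rewrite ler_pdivrMr//; lra.
move: (cabs _) => A; lra.
Qed.

(** Along a line both phi and 0 are primitives of 0, so phi has the same increments as 0. A vertical
    and a horizontal segment join z to the origin. *)
Lemma entire_cst phi : entire phi -> (forall w, derive1 phi w = 0) ->
  forall z, phi z = phi 0.
Proof.
move=> hphi d0.
have dphi w : cder phi w 0 by rewrite -(d0 w); apply: derivable_cder; exact: hphi.
have seg c e x y : phi (lpt c e x) = phi (lpt c e y).
  wlog xy : x y / x <= y.
    by move=> H; have [/H//|/ltW/H] := leP x y.
  have cz t : x <= t <= y -> {for lpt c e t, continuous (fun=> 0 : Cplx R)}.
    by move=> _; exact: cts_cst.
  have h1 := lint_derive (G := phi) xy cz (fun t _ => dphi _).
  have h2 := lint_derive (G := fun=> 0 : Cplx R) xy cz (fun t _ => cder_cst 0 _).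
  by apply/eqP; rewrite eq_sym -subr_eq0 -h1 h2 subrr.
move=> z; rewrite -[z]mkC_re_im -lpt_ver (seg _ _ _ 0) lpt_ver.
rewrite -[mkC (re z) 0]lpt_hor (seg _ _ _ 0) lpt_hor.
by congr phi; apply: Cplx_eq; rewrite ?re_mkC ?im_mkC ?re0 ?im0.
Qed.

End Liouville.

(** * Test functions *)

Section SquareRootIterates.
Variable R : realType.
Implicit Types (z w a c d : Cplx R).

(** The principal square root in coordinates. It maps the right half-plane into itself and can
    therefore be iterated there. *)
Definition csqrt z : Cplx R :=
  mkC (Num.sqrt ((cabs z + re z) / 2)) (im z / (2 * Num.sqrt ((cabs z + re z) / 2))).

Lemma csqrt_gt0 z : 0 < re z -> 0 < re (csqrt z).
Proof.
move=> z0; rewrite /csqrt re_mkC sqrtr_gt0 divr_gt0//.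
by have := cabs_ge0 z; lra.
Qed.

Lemma csqrt_sqr z : 0 < re z -> csqrt z ^+ 2 = z.
Proof.
move=> z0; have s0 := csqrt_gt0 z0; rewrite /csqrt re_mkC in s0 *.
have h : Num.sqrt ((cabs z + re z) / 2) ^+ 2 = (cabs z + re z) / 2.
  by rewrite sqr_sqrtr// divr_ge0//; have := cabs_ge0 z; lra.
have hc := cabs_sqr z.
move: s0 h; set s := Num.sqrt _ => s0 h.
have n0 : cabs z + re z != 0 by apply: lt0r_neq0; have := cabs_ge0 z; lra.
rewrite expr2; apply: Cplx_eq; rewrite ?(reM, imM) !(re_mkC, im_mkC); last first.
  by field; rewrite gt_eqF.
have -> : s * s - im z / (2 * s) * (im z / (2 * s)) = s ^+ 2 - im z ^+ 2 / (4 * s ^+ 2).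
  by field; rewrite gt_eqF.
have -> : im z ^+ 2 = cabs z ^+ 2 - re z ^+ 2 by rewrite hc; ring.
by rewrite h; field.
Qed.

(** The other factor of the difference of squares, [csqrt z + w], has positive real part. *)
Lemma csqrt_unique z w : 0 < re w -> w ^+ 2 = z -> 0 < re z -> csqrt z = w.
Proof.
move=> w0 wz z0; have s0 := csqrt_gt0 z0; have sz := csqrt_sqr z0.
have : (csqrt z - w) * (csqrt z + w) = 0 by rewrite -subr_sqr sz wz subrr.
move/eqP; rewrite mulf_eq0 => /orP[|/eqP e]; first by rewrite subr_eq0 => /eqP.
by have := addr_gt0 s0 w0; rewrite -reD e re0 ltxx.
Qed.

Lemma nbhs_re_gt0 z : 0 < re z -> \near z, 0 < re z.
Proof.
move=> z0; apply/nbhs_cabsP; exists (re z) => // w hw.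
have := le_lt_trans (re_le_cabs (w - z)) hw; rewrite reB ltr_norml; lra.
Qed.

(** The difference of roots times their sum is w - z, and the sum has modulus at least
    [re (csqrt z)]. *)
Lemma cts_csqrt z : 0 < re z -> {for z, continuous csqrt}.
Proof.
move=> z0; apply/cts_cabsP => e e0; have s0 := csqrt_gt0 z0.
have /nbhs_cabsP[k k0 hk] := nbhs_re_gt0 z0.
apply/nbhs_cabsP; exists (Num.min k (e * re (csqrt z))).
  by rewrite lt_min k0 mulr_gt0.
move=> w; rewrite lt_min => /andP[/hk w0 hw].
have sw0 := csqrt_gt0 w0.
have : (csqrt w - csqrt z) * (csqrt w + csqrt z) = w - z.
  by rewrite -subr_sqr !csqrt_sqr.
move/(congr1 (@cabs R)); rewrite cabsM => h.
have h2 : re (csqrt z) <= cabs (csqrt w + csqrt z).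
  apply: le_trans (le_trans (ler_norm _) (re_le_cabs _)).
  by rewrite reD lerDr ltW.
rewrite -(ltr_pM2r s0); apply: le_lt_trans hw; rewrite -h.
by apply: ler_wpM2l h2; exact: cabs_ge0.
Qed.

Lemma cder_csqrt z : 0 < re z -> cder csqrt z (2 * csqrt z)^-1.
Proof.
move=> z0; have s0 := csqrt_gt0 z0; have cs := cts_csqrt z0.
have n0 w : 0 < re w -> csqrt w + csqrt z != 0.
  move=> w0; apply/eqP => e.
  by have := addr_gt0 (csqrt_gt0 w0) s0; rewrite -reD e re0 ltxx.
pose q w := (csqrt w + csqrt z)^-1.
apply: (@near_cder _ (fun w => csqrt z + q w * (w - z))).
  apply: filterS (nbhs_re_gt0 z0) => w w0.
  have -> : w - z = (csqrt w - csqrt z) * (csqrt w + csqrt z).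
    by rewrite -subr_sqr !csqrt_sqr.
  rewrite /q mulrCA mulVf ?n0// mulr1; ring.
exists q; split.
- apply: (ctsV (f := fun w => csqrt w + csqrt z) (n0 z z0)).
  by apply: ctsD; [exact: cs|exact: cts_cst].
- by rewrite /q; congr (_^-1); ring.
- by move=> w; rewrite subrr mulr0 addr0 addrC addKr.
Qed.

(** On the right half-plane this is the principal branch of $z^{2^{-m}}$. *)
Definition croot m z : Cplx R := iter m csqrt z.

Lemma croot0 z : croot 0 z = z. Proof. by []. Qed.

Lemma crootS m z : croot m.+1 z = csqrt (croot m z). Proof. by []. Qed.

Lemma croot_gt0 m z : 0 < re z -> 0 < re (croot m z).
Proof. by move=> z0; elim: m => // m IH; exact: csqrt_gt0. Qed.

Lemma croot_neq0 m z : 0 < re z -> croot m z != 0.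
Proof.
move=> /(croot_gt0 m); apply: contraTneq => ->; by rewrite re0 ltxx.
Qed.

Lemma cabs_croot m z : 0 < re z -> cabs (croot m z) = cabs z `^ (2 ^- m).
Proof.
move=> z0; elim: m => [|m IH].
  by rewrite expr0 invr1 powRr1// cabs_ge0.
have h := csqrt_sqr (croot_gt0 m z0).
have {}h : cabs (croot m.+1 z) ^+ 2 = cabs (croot m z) by rewrite -cabsX; congr cabs.
have -> : 2 ^- m.+1 = 2 ^- m * 2^-1 :> R by rewrite exprS invfM mulrC.
rewrite powRrM -IH -h -powR_mulrn ?cabs_ge0// -powRrM.
by rewrite divff// powRr1// cabs_ge0.
Qed.

Lemma cder_croot m z : 0 < re z ->
  cder (croot m) z (croot m z / (2 ^+ m * z)).
Proof.
move=> z0; have zn0 : z != 0 by apply: contraTneq z0 => ->; rewrite re0 ltxx.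
elim: m => [|m IH].
  have -> : croot 0 z / (2 ^+ 0 * z) = 1 by rewrite expr0 mul1r /croot /= divff.
  exact: cder_id.
have key (s : Cplx R) : s != 0 ->
    (2 * s)^-1 * (s ^+ 2 / (2 ^+ m * z)) = s / (2 ^+ m.+1 * z).
  move=> sn0; rewrite [2 ^+ m.+1]exprS.
  have : (2 : Cplx R) ^+ m != 0 by rewrite expf_neq0 ?pnatr_eq0.
  move: (2 ^+ m) => t t0; field; by rewrite zn0 sn0 t0.
have s0 : csqrt (croot m z) != 0 := croot_neq0 m.+1 z0.
have := cder_comp IH (cder_csqrt (croot_gt0 m z0)).
have -> : (2 * csqrt (croot m z))^-1 * (croot m z / (2 ^+ m * z)) =
    csqrt (croot m z) / (2 ^+ m.+1 * z).
  by rewrite -(key _ s0) (csqrt_sqr (croot_gt0 m z0)).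
exact: id.
Qed.

Definition ftest m c z : Cplx R := c / croot m (1 - z).

Lemma ftestE m c z : ftest m c z = c / croot m (1 - z). Proof. by []. Qed.

Lemma re_1B_gt0 z : cabs z < 1 -> 0 < re (1 - z).
Proof.
move=> z1; rewrite reB re1; have := le_trans (ler_norm _) (re_le_cabs z); lra.
Qed.

(** The derivative is kept as a multiple of the function itself: where [ftest m c] takes the value
    w, the chain rule then produces phi'(w) w in [ray_bound]. *)
Lemma cder_ftest m c z : cabs z < 1 ->
  cder (ftest m c) z (ftest m c z / (2 ^+ m * (1 - z))).
Proof.
move=> z1; have z0 := re_1B_gt0 z1; have r0 : croot m (1 - z) != 0 := croot_neq0 m z0.
have zn0 : 1 - z != 0 by apply: contraTneq z0 => ->; rewrite re0 ltxx.
have d1 : cder (fun z => 1 - z) z (0 - 1) by apply: cderB; [exact: cder_cst|exact: cder_id].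
have key (s u t : Cplx R) : s != 0 -> u != 0 -> t != 0 ->
    c * (- (s / (t * u) * (0 - 1)) / s ^+ 2) = c / s / (t * u).
  by move=> s0 u0 t0; field; rewrite u0 s0 t0.
have t0 : (2 : Cplx R) ^+ m != 0 by rewrite expf_neq0 ?pnatr_eq0.
have := cderZ c (cderV (g := fun w => croot m (1 - w)) r0 (cder_comp d1 (cder_croot m z0))).
rewrite (key _ _ _ r0 zn0 t0); exact: id.
Qed.

Lemma cabs2 : cabs (2 : Cplx R) = 2.
Proof.
have -> : 2 = mkC 2 0 :> Cplx R.
  by apply: Cplx_eq; rewrite ?(reD, imD) ?re1 ?im1 ?re_mkC ?im_mkC ?addr0.
by rewrite cabs_real ger0_norm.
Qed.

Lemma cabs_derive1_ftest m c z : cabs z < 1 ->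
  cabs (derive1 (ftest m c) z) =
  cabs c * 2 ^- m * cabs (1 - z) `^ (- (1 + 2 ^- m)).
Proof.
move=> z1; have z0 := re_1B_gt0 z1.
have zn0 : 1 - z != 0 by apply: contraTneq z0 => ->; rewrite re0 ltxx.
have zp : 0 < cabs (1 - z) by rewrite cabs_gt0.
have [_ ->] := cder_derivable (cder_ftest m c z1).
rewrite /ftest !cabsM !cabsV cabs_croot// cabsM cabsX.
rewrite cabs2.
rewrite opprD powRD; last by rewrite (gt_eqF zp) implybT.
rewrite powRN powRr1 ?cabs_ge0// powRN.
by rewrite invfM; ring.
Qed.

End SquareRootIterates.
#[global] Opaque csqrt croot.

(** * Integrability of the test functions *)

Section PowerIntegrals.
Variable R : realType.
Notation leb := (@lebesgue_measure R).
Implicit Types (a b c e k x : R).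

Lemma measurable_powR_comp d (T : measurableType d) (f : T -> R) k :
  measurable_fun setT f -> measurable_fun setT (fun t => f t `^ k).
Proof. exact: (measurableT_comp (measurable_powR k)). Qed.

(** The sign e covers powers of x - c and of c - x at once. The base stays positive; singular
    endpoints are reached by exhaustion below. *)
Lemma Rintegral_powR e c u v k : -1 < k -> e * e = 1 -> u <= v ->
  (forall x, u <= x <= v -> 0 < e * (x - c)) ->
  leb.-integrable `[u, v] (EFin \o (fun x => (e * (x - c)) `^ k)) /\
  \int[leb]_(x in `[u, v]) (e * (x - c)) `^ k =
  e * (e * (v - c)) `^ (k + 1) / (k + 1) - e * (e * (u - c)) `^ (k + 1) / (k + 1).
Proof.
move=> k1 ee uv h.
have k0 : k + 1 != 0 by rewrite gt_eqF//; lra.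
have ca x : {for x, continuous (fun x => e * (x - c))}.
  apply: ctsM; first exact: cts_cst.
  by apply: ctsB; [exact: cvg_id|exact: cts_cst].
have cp (j x : R) : 0 < x -> {for x, continuous (fun x => x `^ j)}.
  move=> x0; have [dx _] := is_derive1_powR j x0.
  exact/differentiable_continuous/derivable1_diffP.
have cf j x : u <= x <= v -> {for x, continuous (fun x => (e * (x - c)) `^ j)}.
  by move=> /h hx; exact: (continuous_comp (ca x) (cp j _ hx)).
split; first by apply: cts_integrable => x /cf.
apply: (Rintegral_derive (U := fun x => e * (e * (x - c)) `^ (k + 1) / (k + 1)) uv).
  by move=> x /cf.
move=> x /[dup] xuv /h hx.
have /is_derive1_caratheodory[q [qE cq qx]] := is_derive1_powR (k + 1) hx.
exists (fun s => q (e * (s - c)) / (k + 1)); split.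
- apply: ctsM; last exact: cts_cst.
  exact: (continuous_comp (ca x) cq).
- by rewrite qx addrK mulrAC divff// mul1r.
- move=> s; rewrite -mulrBl -mulrBr qE.
  have -> : e * (s - c) - e * (x - c) = e * (s - x) by ring.
  by rewrite mulrCA [e * (_ * _)]mulrA ee mul1r mulrAC.
Qed.

(** Monotone convergence: a bound uniform in n passes to the union. *)
Lemma integral_itv_le_lim (f : R -> R) (F : nat -> set R) (A : set R) M :
  {homo F : n m / (n <= m)%N >-> (n <= m)%O} ->
  (forall n, measurable (F n)) -> measurable_fun setT f -> (forall x, 0 <= f x) ->
  \bigcup_n F n = A ->
  (forall n, \int[leb]_(x in F n) (f x)%:E <= M%:E)%E ->
  (\int[leb]_(x in A) (f x)%:E <= M%:E)%E.
Proof.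
move=> hF mF mf f0 <- hM.
have H : (\int[leb]_(x in F n) (f x)%:E)%E @[n --> \oo] -->
    (\int[leb]_(x in \bigcup_n F n) (f x)%:E)%E.
  apply: ge0_nondecreasing_set_cvg_integral => //.
    by move=> n; apply/measurable_EFinP; exact: measurable_funS mf.
  by move=> n x _; rewrite lee_fin.
rewrite -(cvg_lim _ H)//; apply: lime_le; first by apply/cvg_ex; eexists; exact: H.
by apply: nearW.
Qed.

Lemma ex_invS_lt (x : R) : 0 < x -> exists n : nat, n.+1%:R^-1 <= x.
Proof.
move=> x0; exists (Num.truncn x^-1); rewrite invf_ple ?posrE//.
exact/ltW/truncnS_gt.
Qed.

(** For k < 0 the integrand blows up at a, so the half-open interval is exhausted by
    [a + 1/(n+1), b]. *)
Lemma integral_powR_left a b k : -1 < k -> a <= b ->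
  (\int[leb]_(x in `[a, b]) ((x - a) `^ k)%:E <= ((b - a) `^ (k + 1) / (k + 1))%:E)%E.
Proof.
move=> k1 ab; have mf : measurable_fun setT (fun x => (x - a) `^ k).
  by apply: measurable_powR_comp; apply: measurable_funB.
rewrite -integral_itv_obnd_cbnd; last first.
  by apply/measurable_EFinP; exact: measurable_funS mf.
have k10 : 0 < k + 1 by lra.
apply: (integral_itv_le_lim (F := fun n => `[a + n.+1%:R^-1, b]%classic)) => //.
- move=> n m nm; rewrite subsetEset => x /=; rewrite !in_itv/= => /andP[h1 ->].
  rewrite andbT; apply: le_trans h1; rewrite lerD2l lef_pV2 ?posrE// ler_nat ltnS.
  exact: nm.
- by move=> x; exact: powR_ge0.
- apply/seteqP; split=> [x [n _]|x] /=; rewrite !in_itv/= => /andP[h1 h2].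
    rewrite h2 andbT; apply: lt_le_trans h1; rewrite ltrDl invr_gt0//.
  have [n hn] := ex_invS_lt (x := x - a) ltac:(lra).
  by exists n => //=; rewrite in_itv/= h2 andbT -lerBrDl.
- move=> n; have n0 : 0 < n.+1%:R^-1 :> R by rewrite invr_gt0.
  have [le|gt] := leP (a + n.+1%:R^-1) b; last first.
    by rewrite set_itv_ge ?bnd_simp -?ltNge// integral_set0 lee_fin divr_ge0 ?powR_ge0 ?ltW.
  have [|iR E] := @Rintegral_powR 1 a (a + n.+1%:R^-1) b k k1 (mul1r 1) le.
    by move=> x /andP[x1 _]; rewrite mul1r subr_gt0; apply: lt_le_trans x1; rewrite ltrDl.
  have -> : (fun x => ((x - a) `^ k)%:E) = EFin \o (fun x => (1 * (x - a)) `^ k).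
    by apply/funext => x; rewrite /= mul1r.
  rewrite -(fineK (integrable_fin_num _ iR))// lee_fin.
  rewrite [leLHS]E !mul1r lerBlDr lerDl.
  by rewrite divr_ge0 ?powR_ge0 ?ltW.
Qed.

Lemma integral_powR_right a b k : -1 < k -> a <= b ->
  (\int[leb]_(x in `[a, b]) ((b - x) `^ k)%:E <= ((b - a) `^ (k + 1) / (k + 1))%:E)%E.
Proof.
move=> k1 ab; have mf : measurable_fun setT (fun x => (b - x) `^ k).
  by apply: measurable_powR_comp; apply: measurable_funB.
rewrite -integral_itv_bndo_bndc; last first.
  by apply/measurable_EFinP; exact: measurable_funS mf.
have k10 : 0 < k + 1 by lra.
apply: (integral_itv_le_lim (F := fun n => `[a, b - n.+1%:R^-1]%classic)) => //.
- move=> n m nm; rewrite subsetEset => x /=; rewrite !in_itv/= => /andP[-> h1].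
  apply: le_trans h1 _; rewrite lerD2l lerN2 lef_pV2 ?posrE// ler_nat ltnS.
  exact: nm.
- by move=> x; exact: powR_ge0.
- apply/seteqP; split=> [x [n _]|x] /=; rewrite !in_itv/= => /andP[h1 h2].
    by rewrite h1/=; apply: le_lt_trans h2 _; rewrite ltrBlDr ltrDl invr_gt0.
  have [n hn] := ex_invS_lt (x := b - x) ltac:(lra).
  by exists n => //=; rewrite in_itv/= h1 lerBrDr -lerBrDl.
- move=> n; have n0 : 0 < n.+1%:R^-1 :> R by rewrite invr_gt0.
  have [le|gt] := leP a (b - n.+1%:R^-1); last first.
    by rewrite set_itv_ge ?bnd_simp -?ltNge// integral_set0 lee_fin divr_ge0 ?powR_ge0 ?ltW.
  have [|iR E] := @Rintegral_powR (-1) b a (b - n.+1%:R^-1) k k1 ltac:(ring) le.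
    move=> x /andP[_ x2]; rewrite mulN1r opprB subr_gt0.
    by apply: le_lt_trans x2 _; rewrite gtrBl.
  have -> : (fun x => ((b - x) `^ k)%:E) = EFin \o (fun x => (-1 * (x - b)) `^ k).
    by apply/funext => x; rewrite /= mulN1r opprB.
  rewrite -(fineK (integrable_fin_num _ iR))// lee_fin.
  rewrite [leLHS]E !mulN1r !mulNr opprK addrC [- (a - b)]opprB gerBl.
  by rewrite divr_ge0 ?powR_ge0 ?ltW.
Qed.

Lemma integral_even_le (f g : R -> R) a (M : R) : 0 <= a ->
  measurable_fun setT f -> (forall x : R, 0 <= f x) ->
  (forall x : R, 0 <= x <= a -> f x = g x /\ f (- x) = g x) ->
  (\int[leb]_(x in `[0%R, a]) (g x)%:E <= M%:E)%E ->
  (\int[leb]_(x in `[(- a)%R, 0%R]) (g (- x))%:E <= M%:E)%E ->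
  (\int[leb]_(x in `[(- a)%R, a]) (f x)%:E <= (2 * M)%:E)%E.
Proof.
move=> a0 mf f0 fg h1 h2.
have mE (A : set R) : measurable A -> measurable_fun A (EFin \o f).
  by move=> mA; apply/measurable_EFinP; exact: measurable_funS mf.
have -> : `[- a, a]%classic = `[- a, 0[%classic `|` `[0, a]%classic :> set R.
  rewrite -itv_bndbnd_setU// bnd_simp; lra.
rewrite ge0_integral_setU//=; last first.
- apply/disj_setPS => x [/=]; rewrite !in_itv/= => /andP[_ x1] /andP[x2 _].
  by move: (lt_le_trans x1 x2); rewrite ltxx.
- by move=> x _; rewrite lee_fin.
- by apply: mE; exact: measurableU.
rewrite mulr_natl mulr2n EFinD; apply: leeD.
  rewrite integral_itv_bndo_bndc; last exact: mE.
  apply: le_trans h2; rewrite le_eqVlt; apply/orP; left; apply/eqP.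
  apply: eq_integral => x; rewrite inE/= in_itv/= => /andP[x1 x2].
  by have [_ <-] := fg (- x) ltac:(apply/andP; split; lra); rewrite opprK.
apply: le_trans h1; rewrite le_eqVlt; apply/orP; left; apply/eqP.
apply: eq_integral => x; rewrite inE/= in_itv/= => hx.
by have [<- _] := fg x hx.
Qed.

(** Serves for the horizontal chords of the disc, of half length a, and with a = 1 for the
    singularity of [slice_bound] at |y| = 1. *)
Lemma integral_chord a k : -1 < k -> 0 <= a ->
  (\int[leb]_(x in `[(- a)%R, a]) ((a - `|x|) `^ k)%:E <=
   (2 * (a `^ (k + 1) / (k + 1)))%:E)%E.
Proof.
move=> k1 a0; apply: (integral_even_le (g := fun x => (a - x) `^ k)) => //.
- apply: measurable_powR_comp; apply: measurable_funB; first exact: measurable_cst.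
  exact: (@normr_measurable R setT).
- by move=> x; exact: powR_ge0.
- by move=> x /andP[x0 _]; rewrite normrN ger0_norm.
- by apply: le_trans (integral_powR_right k1 a0) _; rewrite subr0.
- under eq_integral do rewrite opprK addrC -[in (_ + a)%R](opprK a).
  by apply: le_trans (integral_powR_left k1 _) _; rewrite ?opprK ?add0r//; lra.
Qed.

Lemma integral_abs_powR k : -1 < k ->
  (\int[leb]_(x in `[(-1)%R, 1%R]) (`|x| `^ k)%:E <= (2 * (k + 1)^-1)%:E)%E.
Proof.
move=> k1; apply: (integral_even_le (g := fun x => x `^ k)) => //.
- by apply: measurable_powR_comp; exact: (@normr_measurable R setT).
- by move=> x /andP[x0 _]; rewrite normrN ger0_norm.
- have := integral_powR_left k1 (ler01 : 0 <= 1 :> R); rewrite subr0 powR1 mul1r.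
  by under eq_integral do rewrite subr0.
- have h : -1 <= 0 :> R by lra.
  have := integral_powR_right k1 h; rewrite sub0r opprK powR1 mul1r.
  by under eq_integral do rewrite sub0r.
Qed.

End PowerIntegrals.

(** * Finiteness of the weighted area integral *)

Section WeightIntegral.
Variable R : realType.
Notation leb := (@lebesgue_measure R).
Implicit Types (a b r x y bt gm : R).

Lemma powR_antitone r a b : r <= 0 -> 0 < a -> a <= b -> b `^ r <= a `^ r.
Proof.
move=> r0 a0 ab; have b0 : 0 < b by lra.
rewrite -[r]opprK !(powRN _ (- r)) lef_pV2 ?posrE ?powR_gt0//.
by apply: ge0_ler_powR; rewrite ?nnegrE ?oppr_ge0// ltW.
Qed.

Lemma powR_half_le r : -1 <= r -> (1 / 2 : R) `^ r <= 2.
Proof.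
move=> r1; have h : 0 < (1 / 2 : R) <= 1 by lra.
apply: le_trans (ger_powR h r1) _.
by rewrite powR_inv1 ?div1r ?invrK// invr_ge0.
Qed.

(** One of a and b is at least 1/2, and its power is then at most 2. This turns a product with
    singularities at both ends into a sum. *)
Lemma powR_prod_le a b r k : -1 <= r <= 0 -> -1 <= k <= 0 -> 0 <= a -> 0 < b ->
  a + b = 1 -> a `^ r * b `^ k <= 2 * a `^ r + 2 * b `^ k.
Proof.
move=> /andP[r1 r0] /andP[k1 k0] a0 b0 ab.
have A0 := powR_ge0 a r; have B0 := powR_ge0 b k.
have [h|h] := leP (1 / 2) b.
  have hb : b `^ k <= 2.
    by apply: le_trans (powR_antitone k0 _ h) (powR_half_le k1); lra.
  nra.
have ha : a `^ r <= 2.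
  by apply: le_trans (powR_antitone r0 _ _) (powR_half_le r1); lra.
nra.
Qed.

Definition semichord y : R := Num.sqrt (1 - y ^+ 2).

Lemma semichord_sqr y : `|y| < 1 -> semichord y ^+ 2 = 1 - y ^+ 2.
Proof. by move=> y1; rewrite sqr_sqrtr// subr_ge0 -real_normK ?num_real// expr_le1// ltW. Qed.

Lemma semichord_gt0 y : `|y| < 1 -> 0 < semichord y.
Proof. by move=> y1; rewrite sqrtr_gt0 subr_gt0 -real_normK ?num_real// expr_lt1. Qed.

Lemma semichord_le1 y : semichord y <= 1.
Proof. by rewrite -[leRHS]sqrtr1 ler_wsqrtr// lerBlDr lerDl sqr_ge0. Qed.

Section Weight.
Variables (bt gm : R).
Hypotheses (bt1 : -1 < bt) (bt0 : bt <= 0) (gm0 : 0 < gm) (gmbt : gm < bt + 2).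

(* The exponent of [|1 - z|] is split as [g1 + g2] with [g1 < bt + 1] and [g2 < 1],
   so that the two factors are integrable in [x] and in [y] respectively. *)
Let g1 := gm * (bt + 1) / (bt + 2).
Let g2 := gm / (bt + 2).

Let hyps : [/\ -1 < bt, bt <= 0, 0 < gm & gm < bt + 2]. Proof. by []. Qed.

Let b2 : 0 < bt + 2. Proof. by have [h1 h2 h3 h4] := hyps; lra. Qed.

Let g1_lt : bt - g1 > -1.
Proof.
have [h1 h2 h3 h4] := hyps; suff : g1 < bt + 1 by lra.
rewrite /g1 mulrAC -[ltRHS]mul1r ltr_pM2r; last lra.
by rewrite ltr_pdivrMr// mul1r.
Qed.

Let g1_gt : 0 < g1.
Proof. by have [h1 h2 h3 h4] := hyps; rewrite /g1 divr_gt0// mulr_gt0//; lra. Qed.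

Let g2_lt : g2 < 1. Proof. by rewrite /g2 ltr_pdivrMr// mul1r. Qed.
Let g2_gt : 0 < g2. Proof. by rewrite /g2 divr_gt0. Qed.
Let g12 : gm = g1 + g2. Proof. by rewrite /g1 /g2; field; rewrite gt_eqF. Qed.

(** Up to a constant this dominates the integrand of [ftest] in D^p_alpha, after [powR_weight_le]
    has made the first exponent nonpositive. *)
Definition weight (p : R * R) : R :=
  (1 - cabs (mkC p.1 p.2) ^+ 2) `^ bt * cabs (1 - mkC p.1 p.2) `^ (- gm).

Definition weight_bound (p : R * R) : R :=
  semichord p.2 `^ bt * `|p.2| `^ (- g2) * (semichord p.2 - `|p.1|) `^ (bt - g1).

Lemma discR_chord p : discR p -> `|p.2| < 1 /\ `|p.1| < semichord p.2.
Proof.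
rewrite /discR /= => h.
have : cabs (mkC p.1 p.2) ^+ 2 < 1 by rewrite expr_lt1// cabs_ge0.
rewrite cabs_sqr re_mkC im_mkC => h2.
have y1 : `|p.2| < 1.
  rewrite -(expr_lt1 (n := 2))// real_normK ?num_real//.
  by apply: le_lt_trans h2; rewrite lerDr sqr_ge0.
split=> //; rewrite -(ltr_pXn2r (n := 2))// ?nnegrE ?ltW ?semichord_gt0//.
by rewrite semichord_sqr// real_normK ?num_real//; lra.
Qed.

(** With X the half chord at height y, 1 - |z|^2 = (X - |x|)(X + |x|), and |1 - z| is at least |y|
    and, since X <= 1, at least X - |x|. The axis y = 0 is excluded because the power of |y| there
    has the default value 0. *)
Lemma weight_le p : discR p -> p.2 != 0 -> weight p <= weight_bound p.
Proof.
have [h1 h2 h3 h4] := hyps; have h5 := g1_lt; have h6 := g1_gt.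
have h7 := g2_lt; have h8 := g2_gt.
move=> Dp y0; have [y1 xX] := discR_chord Dp.
have X0 := semichord_gt0 y1; have X1 := semichord_le1 p.2.
have x0 := normr_ge0 p.1.
rewrite /weight /weight_bound.
set X := semichord p.2 in xX X0 X1 *.
have -> : 1 - cabs (mkC p.1 p.2) ^+ 2 = (X - `|p.1|) * (X + `|p.1|).
  rewrite cabs_sqr re_mkC im_mkC -subr_sqr semichord_sqr// real_normK ?num_real//.
  ring.
have d0 : 0 < X - `|p.1| by rewrite subr_gt0.
rewrite powRM; [|lra|lra].
set b := cabs (1 - _).
have rb : X - `|p.1| <= b.
  apply: le_trans (le_trans (ler_norm _) (re_le_cabs _)).
  by rewrite reB re1 re_mkC; have := ler_norm p.1; lra.
have ib : `|p.2| <= b.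
  by apply: le_trans (im_le_cabs _); rewrite imB im1 im_mkC sub0r normrN.
have b0 : 0 < b by lra.
have -> : b `^ (- gm) = b `^ (- g1) * b `^ (- g2).
  by rewrite g12 opprD powRD// (gt_eqF b0) implybT.
rewrite (powRD (r := bt) (s := - g1)); last by rewrite (gt_eqF d0) implybT.
have ny0 : 0 < `|p.2| by rewrite normr_gt0.
have e1 : (X + `|p.1|) `^ bt <= X `^ bt.
  by apply: powR_antitone; [exact: h2|exact: X0|rewrite lerDl].
have e2 : b `^ (- g1) <= (X - `|p.1|) `^ (- g1).
  by apply: powR_antitone; [rewrite oppr_le0 ltW|exact: d0|exact: rb].
have e3 : b `^ (- g2) <= `|p.2| `^ (- g2).
  by apply: powR_antitone; [rewrite oppr_le0 ltW|exact: ny0|exact: ib].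
have -> : X `^ bt * `|p.2| `^ (- g2) * ((X - `|p.1|) `^ bt * (X - `|p.1|) `^ (- g1)) =
  ((X - `|p.1|) `^ bt * X `^ bt) * ((X - `|p.1|) `^ (- g1) * `|p.2| `^ (- g2)) by ring.
apply: ler_pM; rewrite ?mulr_ge0 ?powR_ge0//.
  by rewrite ler_wpM2l// powR_ge0.
by apply: ler_pM; rewrite ?powR_ge0.
Qed.

(** The constant 2 / (bt - g1 + 1) of [integral_chord] times the 2 of [powR_prod_le]. *)
Let M : R := 2 * (2 / (bt - g1 + 1)).

Let M0 : 0 <= M.
Proof. by have := g1_lt; rewrite /M => h; rewrite mulr_ge0// divr_ge0//; lra. Qed.

Definition slice_bound y : R := M * ((1 - `|y|) `^ (- 2^-1) + `|y| `^ (- g2)).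

Lemma slice_bound_ge0 y : 0 <= slice_bound y.
Proof. by rewrite /slice_bound mulr_ge0 ?M0// addr_ge0 ?powR_ge0. Qed.

(** Integrating over the chord leaves a power of X times |y|^(-g2). The first is singular only at
    |y| = 1 and the second only at 0, so [powR_prod_le] separates them. *)
Lemma slice_le y : `|y| < 1 ->
  (\int[leb]_x (((EFin \o weight_bound) \_ @discR R) (x, y)) <= (slice_bound y)%:E)%E.
Proof.
have [h1 h2 h3 h4] := hyps; have h5 := g1_lt; have h6 := g1_gt.
have h7 := g2_lt; have h8 := g2_gt.
move=> y1; have X0 := semichord_gt0 y1; have X1 := semichord_le1 y.
set X := semichord y in X0 X1 *.
pose k := X `^ bt * `|y| `^ (- g2).
have k0 : 0 <= k by rewrite mulr_ge0 ?powR_ge0.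
apply: (@le_trans _ _ (\int[leb]_(x in `[(- X)%R, X]) (k%:E * ((X - `|x|) `^ (bt - g1))%:E))%E).
  rewrite [leRHS]integral_mkcond.
  apply: ge0_le_integral_subset => // x _.
  - by rewrite /patch; case: ifP => //= _; rewrite lee_fin !mulr_ge0 ?powR_ge0.
  - by rewrite /patch; case: ifP => //= _; rewrite lee_fin mulr_ge0 ?powR_ge0.
  rewrite /patch; case: ifPn => [|_].
    rewrite inE => /discR_chord[/= _]; rewrite -/X => xX.
    rewrite ifT ?inE/= ?in_itv/=; last by move: xX; rewrite ltr_norml => /andP[? ?]; rewrite !ltW.
    by rewrite /weight_bound.
  by case: ifP => //= _; rewrite lee_fin mulr_ge0 ?powR_ge0.
rewrite ge0_integralZl//; last first.
- by move=> x _; rewrite lee_fin powR_ge0.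
- apply/measurable_EFinP; apply: (measurable_funS (E := setT)) => //.
  apply: measurable_powR_comp; apply: measurable_funB; first exact: measurable_cst.
  exact: (@normr_measurable R setT).
have bg1 := g1_lt.
apply: le_trans (lee_wpmul2l _ (integral_chord bg1 (ltW X0))) _; first by rewrite lee_fin.
rewrite -EFinM lee_fin /slice_bound.
have kp : 0 < bt - g1 + 1 by lra.
have E : k * (2 * (X `^ (bt - g1 + 1) / (bt - g1 + 1))) =
    2 / (bt - g1 + 1) * (X `^ (bt + (bt - g1 + 1)) * `|y| `^ (- g2)).
  rewrite (powRD (r := bt) (s := bt - g1 + 1)); last by rewrite (gt_eqF X0) implybT.
  rewrite /k; move: (bt - g1 + 1) kp => q q0.
  by field; rewrite gt_eqF.
rewrite E /M.
have -> : 2 * (2 / (bt - g1 + 1)) * ((1 - `|y|) `^ (- 2^-1) + `|y| `^ (- g2)) =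
  2 / (bt - g1 + 1) * (2 * (1 - `|y|) `^ (- 2^-1) + 2 * `|y| `^ (- g2)) by ring.
rewrite ler_pM2l; last by rewrite divr_gt0.
have y0 : 0 < 1 - `|y| by rewrite subr_gt0.
have H : X `^ (bt + (bt - g1 + 1)) <= (1 - `|y|) `^ (- 2^-1).
  (* The exponent 2 bt - g1 + 1 exceeds bt, hence -1, and 0 < X <= 1. Below, X^2 = 1 - y^2 is at
     least 1 - |y|. *)
  apply: (@le_trans _ _ (X `^ (-1))).
    by apply: ger_powR; [rewrite X0 X1|lra].
  have -> : X `^ (-1) = (X ^+ 2) `^ (- 2^-1).
    by rewrite -powR_mulrn ?ltW// -powRrM mulrN divff.
  apply: powR_antitone; [by rewrite oppr_le0 invr_ge0|exact: y0|].
  rewrite semichord_sqr// -real_normK ?num_real// expr2.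
  by have := normr_ge0 y; nra.
apply: (@le_trans _ _ ((1 - `|y|) `^ (- 2^-1) * `|y| `^ (- g2))).
  by rewrite ler_wpM2r ?powR_ge0.
rewrite mulrC [leRHS]addrC; apply: powR_prod_le => //; last by ring.
- by have := g2_lt; have := g2_gt; lra.
- lra.
Qed.

Lemma cts_p1 (p : R * R) : {for p, continuous (fun p : R * R => p.1)}.
Proof. exact: cvg_fst. Qed.

Lemma cts_p2 (p : R * R) : {for p, continuous (fun p : R * R => p.2)}.
Proof. exact: cvg_snd. Qed.

Lemma cts_measurableT (f : R * R -> R) : (forall p, {for p, continuous f}) ->
  measurable_fun setT f.
Proof. by move=> cf; apply: cts_measurable_fun => //; exact: openT. Qed.

Lemma cts_normr (p : R * R) (f : R * R -> R) : {for p, continuous f} ->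
  {for p, continuous (fun p => `|f p|)}.
Proof. by move=> cf; apply: (continuous_comp cf); exact: norm_continuous. Qed.

Lemma cts_semichord (p : R * R) : {for p, continuous (fun p : R * R => semichord p.2)}.
Proof.
have c1 : {for p, continuous (fun p : R * R => 1 - p.2 * p.2)}.
  apply: ctsB; first exact: cts_cst.
  exact: (ctsM (cts_p2 (p := p)) (cts_p2 (p := p))).
have -> : (fun p : R * R => semichord p.2) = Num.sqrt \o (fun p => 1 - p.2 * p.2).
  by apply/funext => q; rewrite /semichord /= expr2.
by apply: (continuous_comp c1); exact: sqrt_continuous.
Qed.

Lemma measurable_weight_bound : measurable_fun setT weight_bound.
Proof.
apply: measurable_funM; [apply: measurable_funM|].
- by apply: measurable_powR_comp; apply: cts_measurableT => p; exact: cts_semichord.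
- apply: measurable_powR_comp; apply: cts_measurableT => p.
  by apply: cts_normr; exact: cts_p2.
- apply: measurable_powR_comp; apply: cts_measurableT => p.
  by apply: ctsB; [exact: cts_semichord|apply: cts_normr; exact: cts_p1].
Qed.

Lemma measurable_weight : measurable_fun setT weight.
Proof.
apply: measurable_funM; apply: measurable_powR_comp; apply: cts_measurableT => p.
- have cc := cts_cabs (cts_mkC2 (p := p)).
  have -> : (fun p : R * R => 1 - cabs (mkC p.1 p.2) ^+ 2) =
     (fun p : R * R => 1 - cabs (mkC p.1 p.2) * cabs (mkC p.1 p.2)).
    by apply/funext => q; rewrite expr2.
  by apply: ctsB; [exact: cts_cst|exact: (ctsM cc cc)].
- apply: (@cts_cabs _ _ (fun p : R * R => 1 - mkC p.1 p.2)).
  by apply: ctsB; [exact: cts_cst|exact: cts_mkC2].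
Qed.

Lemma integral_weight_lty :
  (\int[leb \x leb]_(p in @discR R) (weight p)%:E < +oo)%E.
Proof.
have mD : measurable (@discR R) := open_prod_measurable (@open_discR R).
have mE (f : R * R -> R) : measurable_fun setT f -> measurable_fun (@discR R) (EFin \o f).
  by move=> mf; apply/measurable_EFinP; exact: measurable_funS mf.
apply: (@le_lt_trans _ _ (\int[leb \x leb]_(p in @discR R) (weight_bound p)%:E)%E).
  apply: ae_ge0_le_integral => //.
  - by move=> p _; rewrite lee_fin mulr_ge0 ?powR_ge0.
  - exact: (mE _ measurable_weight).
  - by move=> p _; rewrite lee_fin !mulr_ge0 ?powR_ge0.
  - exact: (mE _ measurable_weight_bound).
  (* The pointwise bound can fail on the real axis, which is a null set. *)
  exists (setT `*` [set 0]); split.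
  - exact: measurableX.
  - apply: etrans (@product_measure1E _ _ _ _ R leb leb setT [set 0] measurableT (measurable_set1 0)) _.
    apply: etrans (congr1 (fun t => leb setT * t)%E (lebesgue_measure_set1 0)) _.
    exact: mule0.
  - move=> p /=; apply: contra_notP => np Dp.
    by rewrite lee_fin; apply: weight_le => //; apply/eqP => p2; apply: np; split.
pose F := (EFin \o weight_bound) \_ (@discR R).
have F0 p : (0 <= F p)%E.
  by rewrite /F /patch; case: ifP => // _; rewrite lee_fin !mulr_ge0 ?powR_ge0.
have mF : measurable_fun setT F.
  by apply/(measurable_restrictT _ mD); exact: (mE _ measurable_weight_bound).
rewrite integral_mkcond; change (\int[leb \x leb]_p F p < +oo)%E.
rewrite (@fubini_tonelli2 _ _ _ _ R leb leb F mF F0).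
apply: (@le_lt_trans _ _ (\int[leb]_(y in `[(-1)%R, 1%R]) (slice_bound y)%:E)%E).
  rewrite [leRHS]integral_mkcond; apply: ge0_le_integral_subset => // y _.
  - exact: integral_ge0.
  - by rewrite /patch; case: ifP => // _; rewrite lee_fin slice_bound_ge0.
  have [y1|y1] := ltP `|y| 1.
    rewrite /patch ifT; first exact: slice_le.
    by rewrite inE/= in_itv/=; move: y1; rewrite ltr_norml => /andP[? ?]; rewrite !ltW.
  rewrite /fubini_G integral0_eq.
    by rewrite /patch; case: ifP => // _; rewrite lee_fin slice_bound_ge0.
  move=> x _; rewrite /F /patch; case: ifPn => //; rewrite inE => /discR_chord[/=].
  by rewrite ltNge y1.
have mpow (k : R) (f : R -> R) : measurable_fun setT f ->
    measurable_fun (`[-1, 1]%classic : set R) (EFin \o (fun y => f y `^ k)).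
  move=> mf; apply/measurable_EFinP; apply: (measurable_funS (E := setT)) => //.
  exact: measurable_powR_comp.
have mn : measurable_fun setT (fun y : R => `|y|) := @normr_measurable R setT.
have m1n : measurable_fun setT (fun y : R => 1 - `|y|).
  by apply: measurable_funB; [exact: measurable_cst|exact: mn].
have h2 : -1 < - 2^-1 :> R by lra.
have hg : -1 < - g2 by have := g2_lt; lra.
under eq_integral do rewrite EFinM EFinD.
have Z : (\int[leb]_(y in `[(-1)%R, 1%R])
    (M%:E * ((((1 - `|y|) `^ (- 2^-1))%:E) + (`|y| `^ (- g2))%:E)) =
    M%:E * (\int[leb]_(y in `[(-1)%R, 1%R]) ((1 - `|y|) `^ (- 2^-1))%:E +
            \int[leb]_(y in `[(-1)%R, 1%R]) (`|y| `^ (- g2))%:E))%E.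
  rewrite -ge0_integralD; first apply: ge0_integralZl.
  - exact: measurable_itv.
  - apply: emeasurable_funD; [exact: (mpow _ _ m1n)|exact: (mpow _ _ mn)].
  - by move=> y _; rewrite adde_ge0 ?lee_fin ?powR_ge0.
  - by rewrite lee_fin M0.
  - exact: measurable_itv.
  - by move=> y _; rewrite lee_fin powR_ge0.
  - exact: (mpow _ _ m1n).
  - by move=> y _; rewrite lee_fin powR_ge0.
  - exact: (mpow _ _ mn).
rewrite Z.
apply: (@le_lt_trans _ _ (M%:E * ((2 * (1 `^ (- 2^-1 + 1) / (- 2^-1 + 1)))%:E +
    (2 * (- g2 + 1)^-1)%:E))%E); last by rewrite -EFinD -EFinM ltry.
apply: lee_wpmul2l; first by rewrite lee_fin M0.
by apply: leeD; [exact: (integral_chord h2 ler01)|exact: (integral_abs_powR hg)].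
Qed.

End Weight.

End WeightIntegral.

(** * Decay of the derivative of the symbol *)

Section TestFunctions.
Variable R : realType.
Notation leb := (@lebesgue_measure R).
Implicit Types (c w z s u : Cplx R) (phi : Cplx R -> Cplx R).

(** For positive alpha the factor U^alpha is absorbed by b through U <= 2 b, which lowers the
    exponent gm by alpha. In the application U is 1 - |z|^2 and b is |1 - z|. *)
Lemma powR_weight_le (alpha gm U b : R) : 0 < U -> U <= 2 * b -> 0 < b ->
  U `^ alpha * b `^ (- gm) <= 2 `^ Num.max alpha 0 *
    (U `^ Num.min alpha 0 * b `^ (- (gm - Num.max alpha 0))).
Proof.
move=> U0 Ub b0; have [a0|a0] := leP alpha 0.
  by rewrite powRr0 mul1r subr0.
rewrite powRr0 mul1r opprB.
have -> : 2 `^ alpha * b `^ (alpha - gm) = (2 * b) `^ alpha * b `^ (- gm).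
  rewrite (powRM _ (ler0n _ 2) (ltW b0)) powRD ?mulrA//.
  by rewrite (gt_eqF b0) implybT.
apply: ler_wpM2r; first exact: powR_ge0.
by apply: ge0_ler_powR; rewrite ?nnegrE// ltW// mulr_gt0.
Qed.

Lemma ftest_Dspace (p alpha : R) m c : 0 < p -> -1 < alpha -> alpha < p - 1 ->
  p * (1 + 2 ^- m) < alpha + 2 -> Dspace p alpha (ftest m c).
Proof.
move=> p0 a1 ap hm; split.
  by move=> z Dz; have [] := cder_derivable (cder_ftest m c Dz).
rewrite disc_integralE -/(@discR R).
pose e : R := 2 ^- m; have e0 : 0 < e by rewrite invr_gt0 exprn_gt0.
pose gm := p * (1 + e).
pose bt := Num.min alpha 0; pose gm' := gm - Num.max alpha 0.
have gmp : p < gm by rewrite /gm mulrDr mulr1 ltrDl mulr_gt0.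
(* For either sign of alpha, gm' < bt + 2 amounts to gm < alpha + 2. Positivity of gm' comes from p
   < gm, together with alpha < p - 1 when alpha is positive. *)
have [b1 b0 g0 gb] : [/\ -1 < bt, bt <= 0, 0 < gm' & gm' < bt + 2].
  by rewrite /gm' /bt -/e -/gm in hm *; have [h|h] := leP alpha 0; split; lra.
pose C := (cabs c * e) `^ p * 2 `^ Num.max alpha 0.
have C0 : 0 <= C by rewrite mulr_ge0 ?powR_ge0.
have le1 : (\int[leb \x leb]_(q in @discR R)
   ((1 - cabs (mkC q.1 q.2) ^+ 2) `^ alpha *
    cabs (derive1 (ftest m c) (mkC q.1 q.2)) `^ p)%:E <=
   \int[leb \x leb]_(q in @discR R) (C%:E * (weight bt gm' q)%:E))%E.
  apply: ge0_le_integral_subset => [//|q _|q _|q Dq].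
  - by rewrite lee_fin mulr_ge0 ?powR_ge0.
  - by rewrite -EFinM lee_fin mulr_ge0// mulr_ge0 ?powR_ge0.
  rewrite -EFinM lee_fin cabs_derive1_ftest//.
  have z0 : 0 < cabs (1 - mkC q.1 q.2).
    by have := cabsB_ge 1 (mkC q.1 q.2); move: Dq; rewrite /discR /= cabs1; lra.
  have -> : (cabs c / 2 ^+ m * cabs (1 - mkC q.1 q.2) `^ (- (1 + 2 ^- m))) `^ p =
      (cabs c * e) `^ p * cabs (1 - mkC q.1 q.2) `^ (- gm).
    have -> : - gm = - (1 + 2 ^- m) * p by rewrite /gm /e mulNr mulrC.
    by rewrite powRrM -powRM ?powR_ge0 ?mulr_ge0 ?cabs_ge0 ?ltW.
  have U0 : 0 < 1 - cabs (mkC q.1 q.2) ^+ 2.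
    by rewrite subr_gt0 expr_lt1// cabs_ge0.
  have Ub : 1 - cabs (mkC q.1 q.2) ^+ 2 <= 2 * cabs (1 - mkC q.1 q.2).
    have h1 := cabsB_ge 1 (mkC q.1 q.2); rewrite cabs1 in h1.
    have h2 : cabs (mkC q.1 q.2) < 1 by [].
    have h3 := cabs_ge0 (mkC q.1 q.2).
    nra.
  rewrite mulrCA /C -mulrA ler_wpM2l ?powR_ge0//.
  exact: powR_weight_le.
have mD : measurable (@discR R) := open_prod_measurable (@open_discR R).
have Z : (\int[leb \x leb]_(q in @discR R) (C%:E * (weight bt gm' q)%:E) =
   C%:E * \int[leb \x leb]_(q in @discR R) (weight bt gm' q)%:E)%E.
  apply: ge0_integralZl.
  - exact: mD.
  - apply/measurable_EFinP; apply: (measurable_funS (E := setT)) => //.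
    exact: measurable_weight.
  - by move=> q _; rewrite lee_fin mulr_ge0 ?powR_ge0.
  - by rewrite lee_fin.
rewrite Z in le1.
apply: lte_mul_pinfty; rewrite ?lee_fin ?invr_ge0 ?pi_ge0//.
apply: le_lt_trans le1 _; apply: lte_mul_pinfty; rewrite ?lee_fin//.
exact: integral_weight_lty.
Qed.

Lemma ex_small_exponent (p alpha : R) : 0 < p -> p - 2 < alpha ->
  exists m, p * (1 + 2 ^- m) < alpha + 2.
Proof.
move=> p0 h; have d0 : 0 < alpha + 2 - p by lra.
exists (Num.truncn (p / (alpha + 2 - p))).+1.
have H : p / (alpha + 2 - p) < 2 ^+ (Num.truncn (p / (alpha + 2 - p))).+1.
  apply: lt_le_trans (truncnS_gt _) _.
  by rewrite -natrX ler_nat; apply/ltnW/ltn_expl.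
move: (2 ^+ _) H => N; rewrite ltr_pdivrMr// => H.
have N0 : 0 < N by rewrite -(pmulr_lgt0 _ d0) mulrC; lra.
rewrite mulrDr mulr1 -ltrBrDl ltr_pdivrMr//; lra.
Qed.

(** Each [csqrt] undoes one squaring as long as the intermediate powers stay in the right
    half-plane. *)
Lemma croot_pow m s : (forall k, (k <= m)%N -> 0 < re (s ^+ (2 ^ k))) ->
  croot m (s ^+ (2 ^ m)) = s.
Proof.
elim: m s => [|m IH] s hs; first by rewrite expn0 expr1 croot0.
rewrite expnS exprM crootS IH.
  apply: csqrt_unique => //; first by have := hs 0%N isT; rewrite expn0 expr1.
  exact: (hs 1%N).
by move=> k km; rewrite -exprM -expnS; exact: hs.
Qed.

Lemma mkCX (x : R) n : mkC x 0 ^+ n = mkC (x ^+ n) 0.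
Proof.
elim: n => [|n IH].
  by rewrite !expr0; apply: Cplx_eq; rewrite ?re1 ?im1 ?re_mkC ?im_mkC.
rewrite !exprS IH; apply: Cplx_eq; rewrite ?(reM, imM) !(re_mkC, im_mkC); ring.
Qed.

(** Closeness of the direction of w to c has to survive powers up to 2^m. With h <= 1, one more
    multiplication costs at most a factor 4. *)
Lemma cabs_subX1_le u (h : R) n : cabs (u - 1) <= h -> h <= 1 ->
  cabs (u ^+ n - 1) <= 4 ^+ n * h.
Proof.
move=> uh h1; have h0 := le_trans (cabs_ge0 _) uh.
elim: n => [|n IH]; first by rewrite !expr0 subrr cabs0 mul1r.
have -> : u ^+ n.+1 - 1 = (u - 1) * (u ^+ n - 1) + (u ^+ n - 1) + (u - 1).
  rewrite exprS; ring.
have n0 := cabs_ge0 (u ^+ n - 1); have u0 := cabs_ge0 (u - 1).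
have q1 : 1 <= 4 ^+ n :> R by rewrite exprn_ege1// ler1n.
apply: le_trans (cabsD_le _ _) _.
have := cabsD_le ((u - 1) * (u ^+ n - 1)) (u ^+ n - 1); rewrite cabsM.
rewrite exprS.
move: (cabs (u - 1)) (cabs (u ^+ n - 1)) uh u0 n0 IH => A B.
move: (cabs _) (4 ^+ n) q1 => D Q; nra.
Qed.

(* The point [a] is chosen so that [ftest m c a = w]: with [s = c / w] it is
   [1 - s ^ (2 ^ m)], and it approaches [1] nontangentially as [w] grows. *)
Lemma ray_bound phi m c w (K : R) : entire phi ->
  (forall a, disc R a ->
     cabs (derive1 (superposition phi (ftest m c)) a) * (1 - cabs a) <= K) ->
  9 <= cabs w ->
  cabs (c * mkC (cabs w) 0 / w - 1) <= (2 * 4 ^+ (2 ^ m))^-1 ->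
  cabs (derive1 phi w) * cabs w <= 4 * 2 ^+ m * K.
Proof.
move=> hphi hK w9 hu.
pose t := cabs w; pose u := c * mkC t 0 / w; pose N := (2 ^ m)%N.
have t9 : 9 <= t := w9.
have t0 : 0 < t by lra.
have w0 : w != 0 by rewrite -cabs_gt0.
have T0 : mkC t 0 != 0 by rewrite -cabs_gt0 cabs_real gtr0_norm.
pose s := c / w.
have sE : s = u * mkC t^-1 0.
  have TT : mkC t 0 * mkC t^-1 0 = 1.
    apply: Cplx_eq; rewrite ?(reM, imM) !(re_mkC, im_mkC) ?re1 ?im1.
      by rewrite divff ?gt_eqF// mul0r subr0.
    by rewrite mulr0 mul0r addr0.
  have -> : u * mkC t^-1 0 = s * (mkC t 0 * mkC t^-1 0) by rewrite /u /s; ring.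
  by rewrite TT mulr1.
have q0 : 0 < 2 * 4 ^+ N :> R by rewrite mulr_gt0// exprn_gt0.
(* This is the origin of the tolerance in the hypothesis: after a loss of at most 4^N, every power
   of u up to N is still within 1/2 of 1. *)
have uX j : (j <= N)%N -> cabs (u ^+ j - 1) <= 1 / 2.
  move=> jN; have h1 : (2 * 4 ^+ N)^-1 <= 1 :> R.
    rewrite invf_le1//; have : 1 <= 4 ^+ N :> R by rewrite exprn_ege1// ler1n.
    lra.
  apply: le_trans (cabs_subX1_le j hu h1) _.
  rewrite ler_pdivrMr// mulrA divfK// mul1r.
  by rewrite ler_weXn2l// ler1n.
have reu j : (j <= N)%N -> 1 / 2 <= re (u ^+ j) <= 3 / 2.
  move=> /uX h; have := le_trans (re_le_cabs (u ^+ j - 1)) h.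
  by rewrite reB re1 ler_norml => /andP[h1 h2]; apply/andP; split; lra.
have sX j : s ^+ j = u ^+ j * mkC (t^-1 ^+ j) 0 by rewrite sE exprMn mkCX.
have res j : re (s ^+ j) = re (u ^+ j) * t^-1 ^+ j.
  by rewrite sX reM re_mkC im_mkC mulr0 subr0.
have ti0 j : 0 < t^-1 ^+ j by rewrite exprn_gt0// invr_gt0.
have rt : croot m (s ^+ N) = s.
  apply: croot_pow => k km; rewrite res mulr_gt0//.
  have /reu/andP[h _] : (2 ^ k <= N)%N by rewrite leq_exp2l.
  lra.
pose tau := t^-1 ^+ N; have tau0 : 0 < tau := ti0 N.
(* The hypothesis 9 <= |w| serves here: it gives |z|^2 <= (3/2 tau)^2 <= tau / 4, small against 2 re
   z >= tau in the formula for |a|^2. *)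
have tau9 : tau <= 1 / 9.
  have h9 : t^-1 <= 1 / 9 by rewrite div1r lef_pV2// posrE.
  apply: le_trans h9; rewrite /tau -[leRHS]expr1.
  rewrite ler_wiXn2l ?invr_ge0 ?ltW ?invf_lt1//; last by rewrite expn_gt0.
  lra.
pose z := s ^+ N.
have zabs : cabs z <= 3 / 2 * tau.
  rewrite /z sX cabsM cabs_real (ger0_norm (ltW (ti0 N))).
  apply: ler_wpM2r; first exact: ltW.
  by have := cabsB_ge (u ^+ N) 1; have := uX N (leqnn N); rewrite cabs1; lra.
have zre : 1 / 2 * tau <= re z.
  rewrite /z res; apply: ler_wpM2r; first exact: ltW.
  by have /andP[] := reu N (leqnn N).
have z0 : 0 < cabs z.
  apply: lt_le_trans (le_trans (ler_norm _) (re_le_cabs _)).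
  by apply: lt_le_trans zre; rewrite mulr_gt0.
pose a := 1 - z.
have aE : cabs a ^+ 2 = 1 - 2 * re z + cabs z ^+ 2.
  by rewrite /a !cabs_sqr reB imB re1 im1; ring.
have a2 : cabs a ^+ 2 <= 1 - 3 / 4 * tau.
  rewrite aE; have : cabs z ^+ 2 <= 1 / 4 * tau.
    rewrite expr2; apply: le_trans (ler_pM _ _ zabs zabs) _; rewrite ?cabs_ge0//.
    nra.
  lra.
have a0 := cabs_ge0 a.
have a1 : cabs a < 1 by rewrite -(expr_lt1 (n := 2))//; lra.
have da : 3 / 8 * tau <= 1 - cabs a by nra.
have fa : ftest m c a = w.
  rewrite ftestE /a opprB addrCA subrr addr0 rt /s invf_div mulrCA divff ?mulr1//.
  apply/eqP => c0; have := uX 1%N; rewrite expr1 /u c0 !mul0r sub0r cabsN cabs1.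
  rewrite expn_gt0 => /(_ isT); lra.
have df := cder_ftest m c a1; rewrite fa in df.
have dphi := derivable_cder (hphi w); rewrite -{1}fa in dphi.
have [_ dg] := cder_derivable (cder_comp df dphi).
have := hK a a1; rewrite [derive1 _ a]dg !cabsM cabsV.
have -> : 2 ^+ m * (1 - a) = 2 ^+ m * z by rewrite /a opprB addrCA subrr addr0.
rewrite cabsM cabsX cabs2 invfM.
have M0 : 0 < 2 ^+ m :> R by rewrite exprn_gt0.
have P0 := cabs_ge0 (derive1 phi w).
have zi : 2 / (3 * tau) <= (cabs z)^-1.
  have -> : 2 / (3 * tau) = (3 / 2 * tau)^-1 by field; rewrite gt_eqF.
  by rewrite lef_pV2// posrE mulr_gt0.
(* The Stolz angle condition: (1 - |a|) / |1 - a| is bounded below independently of w. *)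
have zda : 1 / 4 <= (cabs z)^-1 * (1 - cabs a).
  have -> : 1 / 4 = 2 / (3 * tau) * (3 / 8 * tau) by field; rewrite gt_eqF.
  by apply: ler_pM; rewrite ?zi ?da// ?divr_ge0 ?mulr_ge0// ltW.
have -> : cabs (derive1 phi w) * (cabs w * ((2 ^+ m)^-1 * (cabs z)^-1)) * (1 - cabs a) =
   cabs (derive1 phi w) * cabs w / 2 ^+ m * ((cabs z)^-1 * (1 - cabs a)) by ring.
move=> h; have {}h : cabs (derive1 phi w) * cabs w / 2 ^+ m * (1 / 4) <= K.
  apply: le_trans h; apply: ler_wpM2l => //.
  by rewrite divr_ge0 ?mulr_ge0 ?cabs_ge0// ltW.
have -> : cabs (derive1 phi w) * cabs w =
    4 * 2 ^+ m * (cabs (derive1 phi w) * cabs w / 2 ^+ m * (1 / 4)).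
  by field; rewrite gt_eqF.
by rewrite ler_wpM2l// mulr_ge0// ltW.
Qed.

(** Candidates for c: a grid of mesh 1/n on the square [-1, 1]^2, which comes within 2/n of every
    unit direction. *)
Definition grid n (j k : nat) : Cplx R := mkC (j%:R / n%:R - 1) (k%:R / n%:R - 1).

Lemma ex_grid_coord n (x : R) : (0 < n)%N -> `|x| <= 1 ->
  exists2 j, (j < (2 * n).+1)%N & `|j%:R / n%:R - 1 - x| <= n%:R^-1.
Proof.
move=> n0; rewrite ler_norml => /andP[x1 x2].
have nR : 0 < n%:R :> R by rewrite ltr0n.
have y0 : 0 <= (x + 1) * n%:R by rewrite mulr_ge0 ?ler0n//; lra.
have [h1 h2] := andP (truncn_itv y0).
set j := Num.truncn _ in h1 h2; exists j.
  rewrite ltnS -(ler_nat R) natrM; apply: le_trans h1 _.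
  by rewrite ler_wpM2r ?ler0n//; lra.
have -> : j%:R / n%:R - 1 - x = (j%:R - (x + 1) * n%:R) / n%:R by field; rewrite gt_eqF.
rewrite normrM [`|n%:R^-1|]ger0_norm ?invr_ge0 ?ler0n// ler_piMl ?invr_ge0 ?ler0n//.
rewrite ler_norml; rewrite -natr1 in h2; apply/andP; split; lra.
Qed.

Lemma ex_grid n (d : Cplx R) : (0 < n)%N -> cabs d = 1 ->
  exists j k, [/\ (j < (2 * n).+1)%N, (k < (2 * n).+1)%N &
    cabs (grid n j k - d) <= 2 / n%:R].
Proof.
move=> n0 d1.
have [|j jn hj] := @ex_grid_coord n (re d) n0; first by rewrite -d1 re_le_cabs.
have [|k kn hk] := @ex_grid_coord n (im d) n0; first by rewrite -d1 im_le_cabs.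
exists j, k; split=> //; apply: le_trans (cabs_le_re_im _) _.
have -> : 2 / n%:R = n%:R^-1 + n%:R^-1 :> R by ring.
by rewrite reB imB /grid re_mkC im_mkC; apply: lerD.
Qed.

Lemma ex_bound2 n (F : nat -> nat -> R) :
  exists K, forall j k, (j < n)%N -> (k < n)%N -> F j k <= K.
Proof.
exists (\sum_(j < n) \sum_(k < n) `|F j k|) => j k jn kn.
rewrite (bigD1 (Ordinal jn))//= (bigD1 (Ordinal kn))//= -addrA.
apply: le_trans (ler_norm _) _; rewrite lerDl addr_ge0//.
  by apply: sumr_ge0 => i _.
by apply: sumr_ge0 => i _; apply: sumr_ge0 => i' _.
Qed.

Lemma superposition_decay phi (s p alpha : R) : entire phi -> 0 <= s -> 0 < p ->
  -1 < alpha -> p - 2 < alpha -> alpha < p - 1 ->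
  superposition phi @` Dspace p alpha `<=` Qspace s ->
  exists K, forall w, 9 <= cabs w -> cabs (derive1 phi w) * cabs w <= K.
Proof.
move=> hphi s0 p0 a1 plow pup H.
have [m hm] := ex_small_exponent p0 plow.
have [Kf hKf] : {Kf : Cplx R -> R & forall c a, disc R a ->
    cabs (derive1 (superposition phi (ftest m c)) a) * (1 - cabs a) <= Kf c}.
  apply: (@choice _ _ (fun c K => forall a, disc R a ->
    cabs (derive1 (superposition phi (ftest m c)) a) * (1 - cabs a) <= K)) => c.
  apply: (Qspace_bloch s0); apply: H; exists (ftest m c) => //.
  exact: ftest_Dspace.
(* Chosen so that the covering distance 2/n of the grid equals the tolerance of [ray_bound]. *)
pose n := (2 * (2 * 4 ^ (2 ^ m)))%N.
have n0 : (0 < n)%N by rewrite !muln_gt0 /= expn_gt0.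
have nE : 2 / n%:R = (2 * 4 ^+ (2 ^ m))^-1 :> R.
  by rewrite /n !natrM natrX; field; rewrite expf_neq0.
have [K hK] := ex_bound2 (2 * n).+1 (fun j k => Kf (grid n j k)).
exists (4 * 2 ^+ m * K) => w w9.
have w0 : w != 0 by rewrite -cabs_gt0; lra.
have t0 : 0 < cabs w by lra.
have T0 : mkC (cabs w) 0 != 0 by rewrite -cabs_gt0 cabs_real gtr0_norm.
have d1 : cabs (w / mkC (cabs w) 0) = 1.
  by rewrite cabsM cabsV cabs_real gtr0_norm// divff// gt_eqF.
have [j [k [jn kn hjk]]] := ex_grid n0 d1.
have hu : cabs (grid n j k * mkC (cabs w) 0 / w - 1) <= (2 * 4 ^+ (2 ^ m))^-1.
  rewrite -nE; apply: le_trans hjk.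
  (* Multiplication by |w| / w, of modulus 1, turns closeness of c to w / |w| into closeness of c
     |w| / w to 1. *)
  have -> : grid n j k * mkC (cabs w) 0 / w - 1 =
      (grid n j k - w / mkC (cabs w) 0) * (mkC (cabs w) 0 / w).
    by field; rewrite w0 T0.
  rewrite cabsM [X in _ * X]cabsM cabsV cabs_real gtr0_norm// divff ?gt_eqF// mulr1.
  exact: lexx.
apply: le_trans (ray_bound hphi (hKf _) w9 hu) _.
by rewrite ler_wpM2l ?mulr_ge0 ?exprn_ge0//; exact: hK.
Qed.

Lemma superposition_cst phi c (s : R) (X : set (Cplx R -> Cplx R)) :
  (forall z, phi z = c) -> superposition phi @` X `<=` Qspace s.
Proof.
move=> hc _ [f _ <-].
have -> : superposition phi f = fun=> c by apply/funext => z; exact: hc.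
have d0 z : derivable (fun=> c : Cplx R) z 1 /\ derive1 (fun=> c : Cplx R) z = 0.
  exact: cder_derivable (cder_cst c z).
split; first by move=> z _; case: (d0 z).
apply: (@le_lt_trans _ _ 0%E); last exact: ltry.
apply: ge_ereal_sup => _ [a _ <-]; rewrite disc_integralE integral0_eq ?mule0//.
by move=> q _; rewrite (d0 _).2 cabs0 expr0n mul0r.
Qed.

End TestFunctions.

Theorem theorem7 (R : realType) (phi : Cplx R -> Cplx R) (s p alpha : R)
  (hphi : entire phi) (hs : 0 <= s) (hp : 0 < p) (halpha : -1 < alpha)
  (hlow : p - 2 < alpha) (hupp : alpha < p - 1) :
  (superposition phi @` Dspace p alpha `<=` Qspace s) <->
  (exists c : Cplx R, forall z : Cplx R, phi z = c).
Proof.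
split=> [H|[c hc]]; last exact: superposition_cst hc.
have [K hK] := superposition_decay hphi hs hp halpha hlow hupp H.
by exists (phi 0); apply: entire_cst => //; exact: entire_derive1_eq0 hphi hK.
Qed.
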